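(* Let $d\ge 1$, $T>0$, $x\in\mathbb{R}^d$, $\lambda>0$, $\mu\in\mathbb{R}^d$, $\sigma$ a constant $d\times d$ real matrix, and let $f:[0,T]\times\mathbb{R}^d\times\mathbb{R}\to\mathbb{R}$, $g:\mathbb{R}^d\to\mathbb{R}$. Assume: (1) there is a constant $K$ such that $|f(t,x',y)-f(t,x',w)|\le K|y-w|$ for all $t\in[0,T]$, $x'\in\mathbb{R}^d$, $y,w\in\mathbb{R}$; (2) the PDE $(-\partial_t u-\mathcal{L}u)(t,x')=f(t,x',u(t,x'))$ for $t<T$, $x'\in\mathbb{R}^d$, with $u(T,\cdot)=g$, where $\mathcal{L}u=\mu\cdot Du+\frac12\mathrm{Trace}(\sigma\sigma^\top D^2u)$, has a solution $u\in C^{1,2}([0,T]\times\mathbb{R}^d)$ such that, for some $\theta\in(0,1]$ and some constant $\hat K$, $|u(t,x')-u(\tilde t,x')|\le\hat K|t-\tilde t|^\theta$ for all $t,\tilde t\in[0,T]$, $x'\in\mathbb{R}^d$, and $u(t,x')$ has quadratic growth in $x'$ uniformly in $t$. Let $p\ge 1$ be an integer, let $N_0,\dots,N_{p-1}$ be positive integers, and let $\bar u^p_\emptyset$ be the nested Monte Carlo estimator (with exponential switching times of parameter $\lambda$, started at $x$) defined in the context. Then $$ \mathbb{E}\big((\bar u_{\emptyset}^p-u(0,x))^2\big)\le \prod_{i=1}^p\Big(1+\frac{8}{N_{i-1}}\Big)\frac{K^{2p}e^{\lambda T}}{\lambda^p}T^{2\theta}\hat K^2\frac{T^p}{p\,\Gamma(p)}+\sum_{i=0}^{p-1}\frac{K^{2i}}{N_i}\prod_{j=1}^i\Big(1+\frac{8}{N_{j-1}}\Big)\frac{T^ie^{\lambda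 T}}{\lambda^i}\,\kappa_i, $$ where $$ \kappa_i=\frac{4T}{\lambda\,(i+1)!}\sup_{t\in[0,T]}\mathbb{E}\big(f(t,X_t,u(t,X_t))^2\big)+2\,\mathbb{E}\big(g(X_T)^2\big)\Big(\frac{1_{i>0}}{i\,\Gamma(i)}+1_{i=0}\Big), $$ $X_t=x+\mu t+\sigma W_t$ with $W$ a standard $d$-dimensional Brownian motion, and $\Gamma(s)=\int_0^\infty t^{s-1}e^{-t}\,dt$. (The term $1_{i>0}/(i\Gamma(i))$ is read as $0$ when $i=0$, and empty products equal $1$.)
   Context: The functions $f$ and $g$ are understood to be Borel measurable, so that the expectations make sense; the right-hand side of the bound may be $+\infty$. Exponential law: $\rho(s)=\lambda e^{-\lambda s}$ for $s\ge0$ and $\bar F(t)=\int_t^\infty\rho(s)\,ds=e^{-\lambda t}$. Index sets: for $i\in\{1,\dots,p\}$, $Q_i$ is the set of $i$-tuples $k=(k_1,\dots,k_i)$ with $k_j\in\{1,\dots,N_{j-1}\}$, and $Q^p=\bigcup_{i=1}^pQ_i$. For $k=(k_1,\dots,k_i)\in Q_i$ with $i<p$, $\tilde Q(k)=\{(k_1,\dots,k_i,m): m\in\{1,\dots,N_i\}\}\subset Q_{i+1}$; by convention $\tilde Q(\emptyset)=Q_1$. Randomness: $(\tau_k)_{k\in Q^p}$ are i.i.d. with density $\rho$; $(\bar W^k)_{k\in Q^p}$ are independent standard $d$-dimensional Brownian motions, independent of $(\tau_k)_{k\in Q^p}$. Switching dates: $T_\emptyset=0$, $T_{(j)}=\tau_{(j)}\wedge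 T$ for $j\in\{1,\dots,N_0\}$, and $T_{\tilde k}=(T_k+\tau_{\tilde k})\wedge T$ for $k\in Q_i$, $\tilde k\in\tilde Q(k)$. Particles: $X^{(j)}_t=x+\mu t+\sigma\bar W^{(j)}_t$ for $t\in[0,T_{(j)}]$, and for $\tilde k\in\tilde Q(k)$, $X^{\tilde k}_t=X^k_{T_k}+\mu(t-T_k)+\sigma\bar W^{\tilde k}_{t-T_k}$ for $t\in[T_k,T_{\tilde k}]$. Define $$\phi(s,t,y,z)=\frac{1_{\{t\ge T\}}}{\bar F(T-s)}g(y)+\frac{1_{\{t<T\}}}{\rho(t-s)}f(t,y,z).$$ Estimator: $\bar u^p_{\tilde k}=g(X^{\tilde k}_{T_{\tilde k}})$ for $\tilde k\in Q_p$; $\bar u^p_k=\frac1{N_i}\sum_{\tilde k\in\tilde Q(k)}\phi(T_k,T_{\tilde k},X^{\tilde k}_{T_{\tilde k}},\bar u^p_{\tilde k})$ for $k\in Q_i$, $1\le i<p$, $T_k<T$; $\bar u^p_\emptyset=\frac1{N_0}\sum_{j=1}^{N_0}\phi(0,T_{(j)},X^{(j)}_{T_{(j)}},\bar u^p_{(j)})$. When $T_{\tilde k}=T$ with $T_k<T$, $\phi(T_k,T_{\tilde k},\cdot,\bar u^p_{\tilde k})$ does not depend on $\bar u^p_{\tilde k}$, so values of $\bar u^p_k$ with $T_k=T$ are never needed. *)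

(* Defs.v *)
From HB Require Import structures.
From mathcomp Require Import all_boot all_order all_algebra finmap.
From mathcomp Require Import all_classical all_reals all_analysis.

Set Implicit Arguments.
Unset Strict Implicit.
Unset Printing Implicit Defensive.

Import Order.TTheory GRing.Theory Num.Theory.
Import numFieldNormedType.Exports.

Local Open Scope classical_set_scope.
Local Open Scope ring_scope.

Section functions.
Context {R : realType} {d : nat}.
Implicit Types (f : R -> 'cV[R]_d -> R -> R) (g : 'cV[R]_d -> R).
Implicit Types (u : R -> 'cV[R]_d -> R).

(* Measurability on D for the sigma-algebra generated by the open sets of X. *)
Definition Borel_on (X : topologicalType) (D : set X) (h : X -> R) : Prop :=
  forall B, measurable B -> <<s @open X >> (D `&` h @^-1` B).

(* [0, T] x R^d. Functions of time are total in Rocq; every condition below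
   only constrains their values on [0, T]. *)
Definition slab (T : R) : set (R * 'cV[R]_d) := [set z | 0 <= z.1 <= T].

Definition bvec (i : 'I_d) : 'cV[R]_d := delta_mx i ord0.

(* Difference quotients in time with t + h kept in [0, T]: the time derivative
   is two-sided for 0 < t < T and one-sided at t = 0 and t = T. *)
Definition dt_quot (T : R) u (t : R) (x : 'cV[R]_d) : set_system R :=
  (fun h : R => h^-1 * (u (t + h) x - u t x))
    @ within [set h : R | 0 <= t + h <= T] 0^'.

Definition dt (T : R) u t x : R := lim (dt_quot T u t x).

Definition dx (i : 'I_d) u t : 'cV[R]_d -> R := 'D_(bvec i) (u t).

Definition dxx (i j : 'I_d) u t : 'cV[R]_d -> R := 'D_(bvec j) (dx i u t).

Record C12 (T : R) u : Prop := {
  C12_dt_ex : forall t x, 0 <= t <= T -> cvg (dt_quot T u t x) ;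
  C12_dx_ex : forall i t x, 0 <= t <= T -> derivable (u t) x (bvec i) ;
  C12_dxx_ex : forall i j t x, 0 <= t <= T ->
    derivable (dx i u t) x (bvec j) ;
  C12_cont : {within slab T, continuous (fun z => u z.1 z.2)} ;
  C12_dt_cont : {within slab T, continuous (fun z => dt T u z.1 z.2)} ;
  C12_dx_cont : forall i,
    {within slab T, continuous (fun z => dx i u z.1 z.2)} ;
  C12_dxx_cont : forall i j,
    {within slab T, continuous (fun z => dxx i j u z.1 z.2)}
}.

Definition hessian u t x : 'M[R]_d := \matrix_(i, j) dxx i j u t x.

Definition generator (mu : 'cV[R]_d) (sigma : 'M[R]_d) u t x : R :=
  \sum_(i < d) mu i ord0 * dx i u t x
  + 2^-1 * \tr (sigma *m sigma^T *m hessian u t x).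

Record solves_PDE (T : R) (mu : 'cV[R]_d) (sigma : 'M[R]_d) f g u : Prop := {
  PDE_interior : forall t x, 0 <= t < T ->
    - dt T u t x - generator mu sigma u t x = f t x (u t x) ;
  PDE_terminal : forall x, u T x = g x
}.

(* `|x| is the max norm of R^d; the choice of norm only affects C. *)
Definition quadratic_growth (T : R) u : Prop :=
  exists C : R, forall t x, 0 <= t <= T -> `|u t x| <= C * (1 + `|x| ^+ 2).

Definition Gamma (s : R) : R :=
  \int[lebesgue_measure]_(t in `]0, +oo[) (t `^ (s - 1) * expR (- t)).

End functions.

Section probability.
Context {R : realType} {dO : measure_display} {Omega : measurableType dO}.
Variable P : probability Omega R.

(* The sigma-algebra generated by the real variables Y i, i in D. *)
Definition sigma_of (I : Type) (D : set I) (Y : I -> Omega -> R) :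
    set (set Omega) :=
  <<s \bigcup_(i in D) preimage_set_system setT (Y i) measurable >>.

Definition independent_family (I : choiceType) (D : set I)
    (S : I -> set (set Omega)) : Prop :=
  forall (J : {fset I}) (A : I -> set Omega),
    [set` J] `<=` D -> (forall i, i \in J -> S i (A i)) ->
    P (\bigcap_(i in [set` J]) A i) = (\prod_(i <- J) P (A i))%E.

Definition independent2 (S1 S2 : set (set Omega)) : Prop :=
  forall A B, S1 A -> S2 B -> P (A `&` B) = (P A * P B)%E.

(* B t is only looked at for t >= 0. *)
Record brownian1 (B : R -> Omega -> R) : Prop := {
  brownian1_meas : forall t, 0 <= t -> measurable_fun setT (B t) ;
  brownian1_start : {ae P, forall w, B 0 w = 0} ;
  brownian1_indep : forall (n : nat) (t : nat -> R),
    0 <= t 0%N -> (forall i, (i < n)%N -> t i <= t i.+1) ->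
    independent_family [set: 'I_n]
      (fun i => sigma_of [set: unit] (fun _ w => B (t i.+1) w - B (t i) w)) ;
  (* the second parameter of normal_prob is the standard deviation *)
  brownian1_gauss : forall s t, 0 <= s < t -> forall A, measurable A ->
    P ((fun w => B t w - B s w) @^-1` A) = normal_prob 0 (Num.sqrt (t - s)) A ;
  brownian1_cont : forall w, {within `[0, +oo[, continuous (fun t => B t w)}
}.

Definition sigma_process (d : nat) (W : R -> Omega -> 'cV[R]_d) :
    set (set Omega) :=
  sigma_of [set ti : R * 'I_d | 0 <= ti.1] (fun ti w => W ti.1 w ti.2 ord0).

Record brownian (d : nat) (W : R -> Omega -> 'cV[R]_d) : Prop := {
  brownian_coord : forall i : 'I_d, brownian1 (fun t w => W t w i ord0) ;
  brownian_indep : independent_family [set: 'I_d]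
    (fun i => sigma_of [set t : R | 0 <= t] (fun t w => W t w i ord0))
}.

End probability.

(* The tuple k = (k_1, ..., k_i) is stored youngest index first, as
   [:: k_i; ...; k_1]: the offspring of k are the lists m :: k with
   1 <= m <= N (size k), and the root is [::]. *)
Fixpoint is_index (N : nat -> nat) (k : seq nat) : bool :=
  if k is m :: k' then (1 <= m <= N (size k'))%N && is_index N k' else true.

Definition Qset (N : nat -> nat) (i : nat) : set (seq nat) :=
  [set k | size k = i /\ is_index N k].

Definition Qupto (N : nat -> nat) (p : nat) : set (seq nat) :=
  \bigcup_(i in [set i | (1 <= i <= p)%N]) Qset N i.

Section tree_randomness.
Context {R : realType} {dO : measure_display} {Omega : measurableType dO}.

Record switching_times (P : probability Omega R) (lambda : R)
    (Q : set (seq nat)) (tau : seq nat -> Omega -> R) : Prop := {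
  switching_meas : forall k, Q k -> measurable_fun setT (tau k) ;
  switching_law : forall k, Q k -> forall A, measurable A ->
    P (tau k @^-1` A) = exponential_prob lambda A ;
  switching_indep :
    independent_family P Q (fun k => sigma_of [set: unit] (fun _ => tau k))
}.

Record brownian_motions (d : nat) (P : probability Omega R)
    (Q : set (seq nat)) (W : seq nat -> R -> Omega -> 'cV[R]_d) : Prop := {
  motions_law : forall k, Q k -> brownian P (W k) ;
  motions_indep : independent_family P Q (fun k => sigma_process (W k))
}.

Definition times_motions_indep (d : nat) (P : probability Omega R)
    (Q : set (seq nat)) (tau : seq nat -> Omega -> R)
    (W : seq nat -> R -> Omega -> 'cV[R]_d) : Prop :=
  independent2 P (sigma_of Q tau)
    (sigma_of [set kti : seq nat * R * 'I_d | Q kti.1.1 /\ 0 <= kti.1.2]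
       (fun kti w => W kti.1.1 kti.1.2 w kti.2 ord0)).

End tree_randomness.

(* Everything in this section is for one realization tau, W of the randomness. *)
Section estimator.
Context {R : realType} {d : nat}.
Variables (T lambda : R) (x mu : 'cV[R]_d) (sigma : 'M[R]_d).
Variables (f : R -> 'cV[R]_d -> R -> R) (g : 'cV[R]_d -> R).
Variable N : nat -> nat.
Variables (tau : seq nat -> R) (W : seq nat -> R -> 'cV[R]_d).

Fixpoint switch_date (k : seq nat) : R :=
  if k is m :: k' then Num.min (switch_date k' + tau k) T else 0.

(* The root value is x, the common starting point of the first particles. *)
Fixpoint particle (k : seq nat) (t : R) : 'cV[R]_d :=
  if k is m :: k' then
    particle k' (switch_date k') + (t - switch_date k') *: mu
    + sigma *m W k (t - switch_date k')
  else x.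

Definition rho (s : R) : R := exponential_pdf lambda s.

(* For t >= 0, the integral of rho over [t, +oo[. *)
Definition Fbar (t : R) : R := expR (- lambda * t).

Definition phi (s t : R) (y : 'cV[R]_d) (z : R) : R :=
  (T <= t)%R%:R / Fbar (T - s) * g y + (t < T)%R%:R / rho (t - s) * f t y z.

(* n is the number of generations below k: n = p - size k. For n > 0 the
   recursion is also run when switch_date k = T; those values are multiplied by
   (t < T)%:R = 0 in the parent and do not matter. *)
Fixpoint ubar_rec (n : nat) (k : seq nat) : R :=
  if n is n'.+1 then
    (N (size k))%:R^-1 *
    \sum_(1 <= m < (N (size k)).+1)
      phi (switch_date k) (switch_date (m :: k))
          (particle (m :: k) (switch_date (m :: k))) (ubar_rec n' (m :: k))
  else g (particle k (switch_date k)).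

Definition ubar (p : nat) : R := ubar_rec p [::].

End estimator.

Section bound.
Context {R : realType} {d : nat} {dO : measure_display}
  {Omega : measurableType dO}.
Variables (P : probability Omega R) (T lambda : R).
Variables (f : R -> 'cV[R]_d -> R -> R) (g : 'cV[R]_d -> R).
Variables (u : R -> 'cV[R]_d -> R) (X : R -> Omega -> 'cV[R]_d).
Local Open Scope ereal_scope.

(* The supremum may be +oo, so that kappa and the bound live in \bar R. *)
Definition kappa (i : nat) : \bar R :=
  (4 * T / (lambda * (i.+1)`!%:R))%:E *
    ereal_sup [set 'E_P[(fun w => f t (X t w) (u t (X t w)) ^+ 2)%R]
              | t in `[0%R, T]]
  + 2%:E * 'E_P[(fun w => g (X T w) ^+ 2)%R] *
    ((if (0 < i)%N then (i%:R * Gamma i%:R)^-1 else 0) + (i == 0%N)%:R)%:E.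

Definition error_bound (p : nat) (N : nat -> nat) (K Khat theta : R) : \bar R :=
  ((\prod_(1 <= i < p.+1) (1 + 8 / (N i.-1)%:R))
    * (K ^+ (2 * p) * expR (lambda * T) / lambda ^+ p)
    * T `^ (2 * theta) * Khat ^+ 2 * (T ^+ p / (p%:R * Gamma p%:R)))%:E
  + \sum_(0 <= i < p)
      (K ^+ (2 * i) / (N i)%:R * (\prod_(1 <= j < i.+1) (1 + 8 / (N j.-1)%:R))
        * (T ^+ i * expR (lambda * T) / lambda ^+ i))%:E * kappa i.

End bound.

(* Main.v *)
Require Import Defs.
From HB Require Import structures.
From mathcomp Require Import all_boot all_order all_algebra finmap.
From mathcomp Require Import all_classical all_reals all_analysis.
From mathcomp Require Import measurable_realfun ring lra.

(** Why the bound holds. The estimator is compared with the solution by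
    induction over the generations, for the tree restarted at an arbitrary
    date [s] and position [y]; conditioning on the ancestors of a particle leads
    to such trees.

    Unbiasedness. Suppose that the offspring estimator of a particle is replaced
    by the exact value of [u] at its switching date. Integrating its clock, which
    is independent of its motion and of its offspring, multiplies [g] by the
    survival probability and the driver by the exponential density
    ([branch_integral]). These cancel the weights of the estimator, and what
    remains is the Feynman-Kac representation of [u s y] ([exact_payoff_mean]).
    In the second moment one factor [exp (lambda r)] survives
    ([exact_payoff_sqr]).

    One generation. The payoff of an actual child differs from the exact one by
    at most [K] times the error of its offspring estimator, up to the same weights
    ([child_error]). The children are independent, so averaging [N] of them
    divides the variances by [N] and leaves the squared bias
    ([mean_square_average]). With [e n] the mean square error for [n] remaining
    generations and [P_r] the transition semigroup of the diffusion, this gives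
    ([tree_estimator_error])
      [e n.+1 (s, y) <= (1 + 2/N) (K^2/lambda) int_0^(T-s) exp(lambda r) P_r (e n) dr
                        + (2/N) second_moment (s, y)].
    In the last generation the estimator is [g = u T], and the time regularity of
    [u] bounds its error by [Khat T^theta].

    Solving the recursion. Averaged along the diffusion started at [x], the
    iterated transition operators collapse by the semigroup property and the
    exponentials combine to [exp (lambda (T - s))]. What is left is a scalar
    recursion by integration over time, whose solution is a polynomial with
    coefficients [T^k / k!] ([integrated_error], [error_polyS]). Since
    [k Gamma(k) = k!] ([Gamma_fact]), the stated bound dominates it term by term
    ([error_poly_le]). If one of the two moments in the bound is infinite, so is
    the bound, through its summand of index [0].

    The Feynman-Kac formula. For a solution of class C^(1,2) with quadratic
    growth it is proved by a discrete maximum principle in place of the Ito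
    formula. A second-order Taylor expansion and the moments of Gaussian increments
    give the formula over one short time step, up to an error [o(dl)] that is
    uniform on balls ([taylor_global], [one_step]). The errors are summed by
    backward induction on a time grid ([comparison]). Outside a large ball the
    inequality holds because a small multiple of the convex function
    [sum_i w_i^4], whose mean along the Brownian motion increases, dominates the
    quadratic growth ([le_heat_quart], [sqsum_far]); the source, which need not be
    bounded there, is controlled by its second moment along the path. Applied to
    both signs, the comparison yields the formula ([feynman_kac_abstract],
    [feynman_kac]). *)

Set Implicit Arguments.
Unset Strict Implicit.
Unset Printing Implicit Defensive.

Import Order.TTheory GRing.Theory Num.Theory.
Import numFieldNormedType.Exports.

Local Open Scope classical_set_scope.
Local Open Scope ring_scope.

(** * Independence and decoupling *)

Section pi_systems.
Context {R : realType} {dO : measure_display} {Omega : measurableType dO}.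
Variable P : probability Omega R.

(** The events whose intersection with [B] has the product probability form a
    Dynkin class, so they contain the sigma-algebra generated by a pi-system as
    soon as they contain the pi-system. *)
Lemma indep_pi_left (G : set (set Omega)) (B : set Omega) :
  setI_closed G -> G `<=` measurable -> measurable B ->
  (forall A, G A -> P (A `&` B) = (P A * P B)%E) ->
  forall A, <<s G >> A -> P (A `&` B) = (P A * P B)%E.
Proof.
move=> GI Gm mB GB.
pose Q (A : set Omega) := measurable A /\ P (A `&` B) = (P A * P B)%E.
suff QG : <<s G >> `<=` Q by move=> A /QG[].
rewrite -(setI_closed_g_dynkin_g_sigma_algebra GI).
apply: smallest_sub; last by move=> A GA; split; [exact: Gm|exact: GB].
split.
- by split => //; rewrite setTI probability_setT mul1e.
- move=> A [mA QA]; split; first exact: measurableC.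
  rewrite setIC -setDE measureD// ?ltey_eq ?fin_num_measure//.
  rewrite setIC in QA; have -> : (P B - P (B `&` A) = P B - P A * P B)%E.
    by congr (_ - _)%E; exact: QA.
  rewrite probability_setC// muleBl ?mul1e// ?fin_num_measure//.
- move=> F tF QF; split; first by apply: bigcup_measurable => k _; have [] := QF k.
  rewrite setI_bigcupl measure_bigcup//; last 2 first.
    by move=> k _; apply: measurableI => //; have [] := QF k.
    by apply: trivIset_setIr.
  rewrite measure_bigcup//; last by move=> k _; have [] := QF k.
  rewrite [RHS]muleC -[P B]fineK ?fin_num_measure// -nneseriesZl//.
  by apply: eq_eseriesr => k _; rewrite fineK ?fin_num_measure// muleC; exact: (QF k).2.
Qed.

Lemma independent2_pi (G1 G2 : set (set Omega)) :
  setI_closed G1 -> setI_closed G2 -> G1 `<=` measurable -> G2 `<=` measurable ->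
  (forall A B, G1 A -> G2 B -> P (A `&` B) = (P A * P B)%E) ->
  independent2 P <<s G1 >> <<s G2 >>.
Proof.
move=> I1 I2 m1 m2 G12 A B sA sB.
have sm (G : set (set Omega)) : G `<=` measurable -> <<s G >> `<=` measurable.
  move=> Gm; apply: smallest_sub => //.
  exact: sigma_algebra_measurable.
apply: (indep_pi_left I1 m1) => //; first exact: sm sB.
move=> {sA}A1 GA1; rewrite setIC muleC.
apply: (indep_pi_left I2 m2) => //; first exact: m1.
by move=> B1 GB1; rewrite setIC muleC; exact: G12.
Qed.

End pi_systems.

Section groups.
Context {R : realType} {dO : measure_display} {Omega : measurableType dO}.
Variable P : probability Omega R.

Lemma sigma_algebra_setI (T : pointedType) (S : set (set T)) :
  sigma_algebra setT S -> setI_closed S.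
Proof.
move=> sS A B; rewrite -(sigma_algebra_id sS) => SA SB.
exact: (@measurableI _ (g_sigma_algebraType S) A B SA SB).
Qed.

Lemma sigma_algebra_setT (T : pointedType) (S : set (set T)) :
  sigma_algebra setT S -> S setT.
Proof.
by move=> sS; rewrite -(sigma_algebra_id sS); exact: (@measurableT _ (g_sigma_algebraType S)).
Qed.

(** A pi-system that generates the join of the sigma-algebras [S i], [i] in [D]. *)
Definition cylinders (I : choiceType) (D : set I) (S : I -> set (set Omega)) :
    set (set Omega) :=
  [set A | exists J : {fset I}, exists F : I -> set Omega,
    [/\ [set` J] `<=` D, forall i, i \in J -> S i (F i)
      & A = \bigcap_(i in [set` J]) F i]].

Lemma cylinders_setI (I : choiceType) (D : set I) (S : I -> set (set Omega)) :
  (forall i, D i -> sigma_algebra setT (S i)) -> setI_closed (cylinders D S).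
Proof.
move=> sS _ _ [J1 [F1 [J1D F1S ->]]] [J2 [F2 [J2D F2S ->]]].
exists (J1 `|` J2)%fset, (fun i => (if i \in J1 then F1 i else setT) `&`
   (if i \in J2 then F2 i else setT)); split.
- by move=> i /=; rewrite in_fsetU => /orP[/J1D|/J2D].
- move=> i iJ; have Di : D i.
    by move: iJ; rewrite in_fsetU => /orP[/J1D|/J2D].
  apply: (sigma_algebra_setI (sS i Di)).
    by case: ifPn => [/F1S//|_]; exact: sigma_algebra_setT (sS i Di).
  by case: ifPn => [/F2S//|_]; exact: sigma_algebra_setT (sS i Di).
- apply/seteqP; split => [w [h1 h2] i /= iJ|w h].
    by split; case: ifPn => // iJ'; [exact: h1|exact: h2].
  by split => i /= iJ; have := h i; rewrite /= in_fsetU iJ ?orbT => /(_ erefl)[].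
Qed.

Lemma sub_cylinders (I : choiceType) (D : set I) (S : I -> set (set Omega)) :
  \bigcup_(i in D) S i `<=` cylinders D S.
Proof.
move=> A [i Di SA]; exists [fset i]%fset, (fun=> A); split.
- by move=> j /=; rewrite inE => /eqP ->.
- by move=> j; rewrite inE => /eqP ->.
- apply/seteqP; split => [w Aw j _//|w]; apply.
  by rewrite /= inE.
Qed.

Lemma cylinders_measurable (I : choiceType) (D : set I)
    (S : I -> set (set Omega)) :
  (forall i, D i -> S i `<=` measurable) -> cylinders D S `<=` measurable.
Proof.
move=> mS _ [J [F [JD FS ->]]]; apply: fin_bigcap_measurable => // i iJ.
by apply: mS (FS i iJ); exact: JD.
Qed.

(** Disjoint blocks of an independent family are independent: on the generating
    pi-systems this is the product rule of the family for the union of two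
    disjoint finite index sets. *)
Lemma indep_groups (I : choiceType) (D D1 D2 : set I)
    (S : I -> set (set Omega)) :
  (forall i, D i -> sigma_algebra setT (S i)) ->
  (forall i, D i -> S i `<=` measurable) ->
  independent_family P D S -> D1 `<=` D -> D2 `<=` D -> D1 `&` D2 = set0 ->
  independent2 P <<s \bigcup_(i in D1) S i >> <<s \bigcup_(i in D2) S i >>.
Proof.
move=> sS mS iS D1D D2D D12 A B sA sB.
suff : independent2 P <<s cylinders D1 S >> <<s cylinders D2 S >>.
  by apply; [apply: sub_sigma_algebra2 sA|apply: sub_sigma_algebra2 sB];
    exact: sub_cylinders.
apply: independent2_pi.
- by apply: cylinders_setI => i /D1D/sS.
- by apply: cylinders_setI => i /D2D/sS.
- by apply: cylinders_measurable => i /D1D/mS.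
- by apply: cylinders_measurable => i /D2D/mS.
move=> _ _ [J1 [F1 [J1D F1S ->]]] [J2 [F2 [J2D F2S ->]]].
have J12 : [disjoint J1 & J2]%fset.
  apply/fdisjointP => i i1; apply/negP => i2.
  by have : (D1 `&` D2) i; [split; [exact: J1D|exact: J2D]|rewrite D12].
pose F i := if i \in J1 then F1 i else F2 i.
have FE2 i : i \in J2 -> F i = F2 i.
  by rewrite /F; case: ifPn => // i1 i2; have /fdisjointP/(_ i i1) := J12; rewrite i2.
have -> : \bigcap_(i in [set` J1]) F1 i `&` \bigcap_(i in [set` J2]) F2 i =
    \bigcap_(i in [set` (J1 `|` J2)%fset]) F i.
  apply/seteqP; split => [w [h1 h2] i /=|w h].
    by rewrite in_fsetU /F; case: ifPn => [/h1//|_ /= /h2].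
  split => i /= iJ; have := h i; rewrite /= in_fsetU iJ ?orbT => /(_ erefl).
    by rewrite /F iJ.
  by rewrite FE2.
rewrite iS; last 2 first.
- by move=> i /=; rewrite in_fsetU => /orP[/J1D/D1D|/J2D/D2D].
- move=> i; rewrite in_fsetU /F; case: ifPn => [/F1S//|_ /=]; exact: F2S.
rewrite (perm_big (enum_fset J1 ++ enum_fset J2)) /=; last first.
  apply: uniq_perm; rewrite ?fset_uniq ?cat_uniq ?fset_uniq ?andbT //=.
    by apply/hasPn => i i2; apply/negP => i1; have /fdisjointP/(_ i i1) := J12; rewrite i2.
  by move=> i; rewrite mem_cat in_fsetU.
rewrite big_cat/= iS//; last by move=> i /J1D/D1D.
rewrite iS//; last by move=> i /J2D/D2D.
congr (_ * _)%E; rewrite !big_seq; apply: eq_bigr => i iJ.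
  by rewrite /F iJ.
by rewrite FE2.
Qed.

End groups.

Section decoupling.
Context {R : realType} {dO : measure_display} {Omega : measurableType dO}.
Variable P : probability Omega R.
Context {d1 d2 : measure_display} {E1 : measurableType d1} {E2 : measurableType d2}.
Local Open Scope ereal_scope.

(** Decoupling. The joint law of the pair is the product of the two laws, so by
    Tonelli one variable can be frozen while the other is integrated. *)
Lemma indep_integral (Z1 : Omega -> E1) (Z2 : Omega -> E2)
    (h : (E1 * E2)%type -> \bar R) :
  measurable_fun setT Z1 -> measurable_fun setT Z2 ->
  (forall A B, measurable A -> measurable B ->
    P (Z1 @^-1` A `&` Z2 @^-1` B) = P (Z1 @^-1` A) * P (Z2 @^-1` B)) ->
  measurable_fun [set: (E1 * E2)%type] h -> (forall z, 0 <= h z) ->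
  \int[P]_w h (Z1 w, Z2 w) = \int[P]_w1 \int[P]_w2 h (Z1 w1, Z2 w2).
Proof.
move=> m1 m2 Z12 mh h0.
have m12 : measurable_fun setT (fun w => (Z1 w, Z2 w)).
  by apply/measurable_fun_pairP.
pose f1 : {mfun Omega >-> E1} := HB.pack Z1 (isMeasurableFun.Build _ _ _ _ _ m1).
pose f2 : {mfun Omega >-> E2} := HB.pack Z2 (isMeasurableFun.Build _ _ _ _ _ m2).
pose f12 : {mfun Omega >-> (E1 * E2)%type} :=
  HB.pack (fun w => (Z1 w, Z2 w)) (isMeasurableFun.Build _ _ _ _ _ m12).
pose mu1 : probability E1 R := distribution P f1.
pose mu2 : probability E2 R := distribution P f2.
pose mu12 : probability (E1 * E2)%type R := distribution P f12.
have mu12E X : measurable X -> (mu1 \x mu2) X = mu12 X.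
  apply: product_measure_unique => A B mA mB.
  rewrite /mu12 /mu1 /mu2 /distribution /pushforward /= -Z12//.
transitivity (\int[mu12]_z h z).
  by rewrite ge0_integral_distribution.
transitivity (\int[mu1 \x mu2]_z h z).
  by apply: eq_measure_integral => A mA _; exact/esym/mu12E.
rewrite fubini_tonelli1//=.
rewrite /fubini_F ge0_integral_distribution//=; last 2 first.
- exact: measurable_fun_fubini_tonelli_F.
- by move=> x; apply: integral_ge0.
apply: eq_integral => w _.
rewrite [LHS]ge0_integral_distribution//.
exact: measurableT_comp.
Qed.

End decoupling.

Section density.
Context {R : realType} {d : measure_display} {E : measurableType d}.
Variables (mu : {measure set E -> \bar R}) (nu : {measure set E -> \bar R}).
Variable p : E -> R.
Hypotheses (mp : measurable_fun setT p) (p0 : forall x, 0 <= p x).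
Local Open Scope ereal_scope.
Hypothesis nuE : forall A, measurable A -> nu A = \int[mu]_(x in A) (p x)%:E.

Import HBNNSimple.

(** Both integrals are limits along the same increasing sequence of simple
    functions, for which the identity is the hypothesis on the measure of sets. *)
Lemma integral_density (f : E -> \bar R) :
  measurable_fun setT f -> (forall x, 0 <= f x) ->
  \int[nu]_x f x = \int[mu]_x (f x * (p x)%:E).
Proof.
move=> mf f0.
pose h := nnsfun_approx measurableT mf.
have mpE : measurable_fun setT (EFin \o p) by exact/measurable_EFinP.
have hcvg x : (EFin \o h n) x @[n --> \oo] --> f x by exact: cvg_nnsfun_approx.
have -> : \int[nu]_x f x = lim (\int[nu]_x (EFin \o h n) x @[n --> \oo]).
  transitivity (\int[nu]_x (lim ((EFin \o h n) x @[n --> \oo]))).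
    by apply: eq_integral => x _; apply/esym/cvg_lim.
  apply: monotone_convergence => //.
  - by move=> n; exact/measurable_EFinP.
  - by move=> n x _; rewrite lee_fin.
  - by move=> x _ a b ab; rewrite lee_fin; exact/lefP/nd_nnsfun_approx.
have -> : \int[mu]_x (f x * (p x)%:E) =
    lim (\int[mu]_x ((EFin \o h n) x * (p x)%:E) @[n --> \oo]).
  transitivity (\int[mu]_x (lim (((EFin \o h n) x * (p x)%:E) @[n --> \oo]))).
    by apply: eq_integral => x _; apply/esym/cvg_lim => //; exact: cvgeZr.
  apply: monotone_convergence => //.
  - by move=> n; apply/emeasurable_funM => //; exact/measurable_EFinP.
  - by move=> n x _; rewrite mule_ge0 ?lee_fin.
  - move=> x _ a b ab; rewrite lee_wpmul2r ?lee_fin//.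
    exact/lefP/nd_nnsfun_approx.
apply/congr_lim/funext => n.
transitivity (\int[nu]_x
   (\sum_(y \in range (h n)) (y * \1_(h n @^-1` [set y]) x)%:E)).
  by apply: eq_integral => t _; rewrite /= fimfunE -fsumEFin.
have indich m r : measurable_fun setT (fun x => (r * \1_(h m @^-1` [set r]) x)%:E).
  by apply: (measurable_comp measurableT) => //; exact: measurable_funM.
rewrite ge0_integral_fsum//; last by move=> m y Ey; exact: nnfun_muleindic_ge0.
transitivity (\int[mu]_x (\sum_(y \in range (h n))
    (y * \1_(h n @^-1` [set y]) x)%:E * (p x)%:E)); last first.
  under [LHS]eq_integral => x xE.
    rewrite -ge0_mule_fsuml => [|y]; last exact: nnfun_muleindic_ge0.
    rewrite fsumEFin // -(fimfunE _ x); over.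
  by [].
rewrite [RHS]ge0_integral_fsum//; last 2 first.
  - by move=> y; apply: emeasurable_funM.
  - move=> m y Ey; apply: mule_ge0; last by rewrite lee_fin.
    exact: nnfun_muleindic_ge0.
apply: eq_fsbigr => r rhn.
under [RHS]eq_integral do rewrite EFinM -muleA.
rewrite ge0_integralZl//; last 3 first.
- apply: emeasurable_funM => //; exact/measurable_EFinP.
- by move=> t _; rewrite mule_ge0 ?lee_fin.
- by move: rhn; rewrite inE => -[t _ <-]; rewrite lee_fin.
have -> : \int[mu]_x ((\1_(h n @^-1` [set r]) x)%:E * (p x)%:E) =
    nu (h n @^-1` [set r]).
  rewrite nuE// [RHS]integral_mkcond; apply: eq_integral => x _.
  by rewrite epatch_indic muleC.
under eq_integral do rewrite EFinM.
by rewrite integralZl_indic_nnsfun//= integral_indic// setIT.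
Qed.

End density.

(** * Measurability of vectors and matrices *)

(** The boxes generate the product sigma-algebra of the entries and form a
    pi-system, so that a law on matrices is determined by the probabilities of
    boxes. *)
Definition mx_boxes (R : realType) (m n : nat) : set (set 'M[R]_(m, n)) :=
  [set [set x : 'M[R]_(m, n) | forall i j, A i j (x i j)] |
     A in [set A : 'I_m -> 'I_n -> set R | forall i j, measurable (A i j)]].

HB.instance Definition _ (R : realType) m n :=
  Measurable.copy 'M[R]_(m, n) (g_sigma_algebraType (@mx_boxes R m n)).

Section mx_measurable.
Context {R : realType} {m n : nat} {dE : measure_display} {E : measurableType dE}.

Lemma measurable_mxP (X : E -> 'M[R]_(m, n)) :
  (forall i j, measurable_fun setT (fun w => X w i j)) -> measurable_fun setT X.
Proof.
move=> mX; apply: (@measurability _ _ _ _ _ _ (@mx_boxes R m n)) => //.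
move=> _ [_ [A mA <-] <-].
have -> : setT `&` X @^-1` [set x | forall i j, A i j (x i j)] =
    \bigcap_(i in [set: 'I_m]) \bigcap_(j in [set: 'I_n])
      (fun w => X w i j) @^-1` A i j.
  rewrite setTI; apply/seteqP; split => [w h i _ j _ //|w h i j]; exact: h.
apply: fin_bigcap_measurable => // i _.
apply: fin_bigcap_measurable => // j _.
by rewrite -[X in measurable X]setTI; exact: mX.
Qed.

Lemma measurable_mx_coord i j : measurable_fun setT (fun x : 'M[R]_(m, n) => x i j).
Proof.
move=> _ A mA; rewrite setTI; apply: sub_sigma_algebra.
exists (fun i' j' => if (i' == i) && (j' == j) then A else setT).
  by move=> i' j'; case: ifP.
apply/seteqP; split => [x /(_ i j)|x /= Ax i' j']; first by rewrite !eqxx.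
by case: ifPn => // /andP[/eqP -> /eqP ->].
Qed.

Lemma measurable_mx_entry (X : E -> 'M[R]_(m, n)) i j :
  measurable_fun setT X -> measurable_fun setT (fun w => X w i j).
Proof. by move=> mX; exact: (measurableT_comp (measurable_mx_coord i j) mX). Qed.

Lemma measurable_addmx (X Y : E -> 'M[R]_(m, n)) :
  measurable_fun setT X -> measurable_fun setT Y ->
  measurable_fun setT (fun w => X w + Y w).
Proof.
move=> mX mY; apply: measurable_mxP => i j; under eq_fun do rewrite mxE.
by apply: measurable_funD; exact: measurable_mx_entry.
Qed.

Lemma measurable_scalemx (r : E -> R) (X : E -> 'M[R]_(m, n)) :
  measurable_fun setT r -> measurable_fun setT X ->
  measurable_fun setT (fun w => r w *: X w).
Proof.
move=> mX mY; apply: measurable_mxP => i j; under eq_fun do rewrite mxE.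
by apply: measurable_funM => //; exact: measurable_mx_entry.
Qed.

End mx_measurable.

Lemma measurable_mulmxl {R : realType} m n {dE : measure_display}
  {E : measurableType dE} k (s : 'M[R]_(k, m)) (X : E -> 'M[R]_(m, n)) :
  measurable_fun setT X -> measurable_fun setT (fun w => s *m X w).
Proof.
move=> mX; apply: measurable_mxP => i j; under eq_fun do rewrite mxE.
apply: measurable_sum => l; apply: measurable_funM => //.
exact: measurable_mx_entry.
Qed.

Section open_measurable.
Context {R : realType}.

(** Second countability in metric form: an open set is the union of the balls
    with centre [q k] and radius an inverse integer that it contains. *)
Lemma open_measurable_ball (E : pseudoMetricType R) (dO : measure_display)
    (Om : measurableType dO) (Z : Om -> E) (U : countType) (q : U -> E) :
  (forall (x : E) (e : R), 0 < e -> exists k, ball x e (q k)) ->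
  (forall k e, measurable (Z @^-1` ball (q k) e)) ->
  forall O, open O -> measurable (Z @^-1` O).
Proof.
move=> qd mq O oO.
pose F (k : U * nat) : set Om :=
  if `[< ball (q k.1) k.2.+1%:R^-1 `<=` O >] then Z @^-1` ball (q k.1) k.2.+1%:R^-1
  else set0.
have -> : Z @^-1` O = \bigcup_k F k.
  apply/seteqP; split => [w /= Ow|w [k _]]; last first.
    by rewrite /F; case: ifPn => // /asboolP kO /kO.
  have /nbhs_ballP[e /= e0 eO] : nbhs (Z w) O by exact: open_nbhs_nbhs.
  have [k ke] : exists k : nat, k.+1%:R^-1 < e / 2.
    have e20 : 0 < e / 2 by lra.
    exists (Num.trunc (e / 2)^-1); rewrite invf_plt ?posrE//.
    exact: truncnS_gt.
  have [l lk] : exists l, ball (Z w) k.+1%:R^-1 (q l) by apply: qd; rewrite invr_gt0.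
  exists (l, k) => //; rewrite /F /=; case: ifPn => [_|/asboolP[]]; first exact: ball_sym.
  move=> y ly; apply: eO; have := ball_triangle lk ly; apply: le_ball.
  by move: (_^-1) ke => r; lra.
apply: countable_bigcupT_measurable; first exact: countableP.
by move=> k; rewrite /F; case: ifP.
Qed.

Lemma ratr_dense (x e : R) : 0 < e -> exists q : rat, ball x e (ratr q).
Proof.
move=> e0; have /rat_in_itvoo[q] : x - e < x + e by lra.
rewrite in_itv /= => /andP[q1 q2]; exists q.
by rewrite /ball /= ltr_norml; apply/andP; split; lra.
Qed.

Lemma ratr_mx_dense m n (x : 'M[R]_(m, n)) e :
  0 < e -> exists q : 'M[rat]_(m, n), ball x e (map_mx ratr q).
Proof.
move=> e0; have h i j := ratr_dense (x i j) e0.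
exists (\matrix_(i, j) projT1 (cid (h i j))); split => // i j.
by rewrite !mxE; exact: (projT2 (cid (h i j))).
Qed.

Context {dO : measure_display} {Om : measurableType dO}.

Lemma measurable_preball (Z : Om -> R) c e :
  measurable_fun setT Z -> measurable (Z @^-1` ball c e).
Proof.
by move=> mZ; rewrite -[X in measurable X]setTI; apply: mZ => //; exact: measurable_ball.
Qed.

Lemma measurable_preball_mx m n (Z : Om -> 'M[R]_(m, n)) c e :
  measurable_fun setT Z -> measurable (Z @^-1` ball c e).
Proof.
move=> mZ.
have [e0|e0] := ltP 0 e; last first.
  rewrite (_ : _ @^-1` _ = set0)//; apply/seteqP; split => // w [].
  by rewrite ltNge e0.
have -> : Z @^-1` ball c e =
    \bigcap_(i in [set: 'I_m]) \bigcap_(j in [set: 'I_n])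
      (fun w => Z w i j) @^-1` ball (c i j) e.
  apply/seteqP; split => [w [_ h] i _ j _ //|w h]; first exact: h.
  by split => // i j; exact: h.
apply: fin_bigcap_measurable => // i _.
apply: fin_bigcap_measurable => // j _.
by apply: measurable_preball; exact: measurable_mx_entry.
Qed.

End open_measurable.

Section open_measurable_instances.
Context {R : realType}.

Lemma open_measurable_mx m n (O : set 'M[R]_(m, n)) : open O -> measurable O.
Proof.
apply: (@open_measurable_ball R 'M[R]_(m, n) _ 'M[R]_(m, n) id
  'M[rat]_(m, n) (map_mx ratr)).
  by move=> x e; exact: ratr_mx_dense.
by move=> k e; exact: measurable_preball_mx.
Qed.

Lemma open_measurable_prod m n (O : set (R * 'M[R]_(m, n))) : open O -> measurable O.
Proof.
apply: (@open_measurable_ball R (R * 'M[R]_(m, n))%type _ (R * 'M[R]_(m, n))%type id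
  (rat * 'M[rat]_(m, n))%type
  (fun q => (ratr q.1, map_mx ratr q.2))).
  move=> x e e0; have [q1 h1] := ratr_dense x.1 e0.
  by have [q2 h2] := ratr_mx_dense x.2 e0; exists (q1, q2).
move=> k e; rewrite (_ : _ @^-1` _ =
  fst @^-1` ball (ratr k.1 : R) e `&` snd @^-1` ball (map_mx ratr k.2 : 'M[R]_(m, n)) e)//.
apply: measurableI; first exact: measurable_preball.
exact: measurable_preball_mx.
Qed.

Lemma open_measurable_prod3 m n (O : set (R * 'M[R]_(m, n) * R)) : open O -> measurable O.
Proof.
apply: (@open_measurable_ball R (R * 'M[R]_(m, n) * R)%type _
  (R * 'M[R]_(m, n) * R)%type id (rat * 'M[rat]_(m, n) * rat)%type
  (fun q => (ratr q.1.1, map_mx ratr q.1.2, ratr q.2))).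
  move=> x e e0; have [q1 h1] := ratr_dense x.1.1 e0.
  have [q2 h2] := ratr_mx_dense x.1.2 e0.
  by have [q3 h3] := ratr_dense x.2 e0; exists (q1, q2, q3).
move=> k e; rewrite (_ : _ @^-1` _ =
  (fst \o fst) @^-1` ball (ratr k.1.1 : R) e `&` (snd \o fst) @^-1` ball (map_mx ratr k.1.2 : 'M[R]_(m, n)) e
  `&` snd @^-1` ball (ratr k.2 : R) e)//.
apply: measurableI; last exact: measurable_preball.
apply: measurableI; first by apply: measurable_preball; exact: measurableT_comp.
by apply: measurable_preball_mx; exact: measurableT_comp.
Qed.

End open_measurable_instances.

Section borel.
Context {R : realType}.

(** The sets whose preimage under [i] is measurable form a sigma-algebra that
    contains the open sets. *)
Lemma Borel_on_measurable (dE : measure_display) (E : measurableType dE)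
    (X : topologicalType) (i : E -> X) (D : set X) (h : X -> R) :
  (forall O, open O -> measurable (i @^-1` O)) ->
  Borel_on D h -> measurable_fun (i @^-1` D) (h \o i).
Proof.
move=> oi bh _ B mB.
have : <<s @open X >> `<=` [set S | measurable (i @^-1` S)].
  apply: smallest_sub => //; split => //=.
  - by rewrite preimage_set0.
  - by move=> A mA; rewrite setTD; exact: measurableC.
  - by move=> F mF; rewrite preimage_bigcup; exact: bigcup_measurable.
by move=> /(_ _ (bh B mB)).
Qed.

Lemma within_continuous_measurable (dE : measure_display) (E : measurableType dE)
    (X : topologicalType) (i : E -> X) (D : set X) (h : X -> R) :
  (forall O, open O -> measurable (i @^-1` O)) -> measurable (i @^-1` D) ->
  {within D, continuous h} -> measurable_fun (i @^-1` D) (h \o i).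
Proof.
move=> oi mD /continuousP ch.
apply: (measurability _ (RGenOpens.measurableE R)).
move=> _ [_ [a [b ->] <-]].
have /ch/open_subspaceP[V oV VD] : open `]a, b[%classic by exact: interval_open.
rewrite -[X in measurable X]/(i @^-1` (D `&` h @^-1` `]a, b[)) setIC -VD.
by rewrite setIC; apply: measurableI => //; exact: oi.
Qed.

End borel.

(** * Square-integrable variables *)

Section square_integrable.
Context {R : realType} {dO : measure_display} {Omega : measurableType dO}.
Variable P : probability Omega R.
Implicit Types X Y : Omega -> R.

Definition L2 X : Prop :=
  measurable_fun setT X /\ (\int[P]_w (X w ^+ 2)%:E < +oo)%E.

Lemma L2_sqr_integrable X : L2 X -> P.-integrable setT (fun w => (X w ^+ 2)%:E).
Proof.
move=> [mX X2]; apply/integrableP; split.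
  by apply/measurable_EFinP; exact: measurable_funX.
by under eq_integral do rewrite abse_EFin ger0_norm ?sqr_ge0//.
Qed.

Lemma prob_integrable_cst (c : R) : P.-integrable setT (fun=> c%:E).
Proof. exact: finite_measure_integrable_cst. Qed.

Lemma L2_mul_integrable X Y :
  L2 X -> L2 Y -> P.-integrable setT (fun w => (X w * Y w)%:E).
Proof.
move=> lX lY; apply: (@le_integrable _ _ _ P setT measurableT _
  (fun w => (X w ^+ 2)%:E + (Y w ^+ 2)%:E)%E).
- by apply/measurable_EFinP/measurable_funM; [exact: lX.1|exact: lY.1].
- move=> w _; rewrite -EFinD !abse_EFin lee_fin (@ger0_norm _ (_ + _)); last first.
    by rewrite addr_ge0// sqr_ge0.
  have h1 : 0 <= (X w - Y w) ^+ 2 by exact: sqr_ge0.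
  have h2 : 0 <= (X w + Y w) ^+ 2 by exact: sqr_ge0.
  have h3 : 0 <= X w ^+ 2 by exact: sqr_ge0.
  have h4 : 0 <= Y w ^+ 2 by exact: sqr_ge0.
  rewrite ler_norml; apply/andP; split; nra.
- exact: (@integrableD _ _ _ P _ measurableT _ _ (L2_sqr_integrable lX) (L2_sqr_integrable lY)).
Qed.

Lemma L2_cst (c : R) : L2 (fun=> c).
Proof.
by split => //; rewrite integral_cst//= probability_setT mule1 ltry.
Qed.

Lemma L2_integrable X : L2 X -> P.-integrable setT (fun w => (X w)%:E).
Proof.
move=> lX; have := L2_mul_integrable lX (L2_cst 1).
by under eq_fun do rewrite mulr1.
Qed.

Lemma L2D X Y : L2 X -> L2 Y -> L2 (fun w => X w + Y w).
Proof.
move=> lX lY; split; first by apply: measurable_funD; [exact: lX.1|exact: lY.1].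
have h : P.-integrable setT (fun w => (2 * X w ^+ 2 + 2 * Y w ^+ 2)%:E).
  under eq_fun do rewrite EFinD.
  by apply: integrableD => //; under eq_fun do rewrite EFinM; apply: integrableZl => //;
    exact: L2_sqr_integrable.
apply: (@le_lt_trans _ _ (\int[P]_w (2 * X w ^+ 2 + 2 * Y w ^+ 2)%:E)%E).
  apply: ge0_le_integral => //.
  - by move=> w _; rewrite lee_fin sqr_ge0.
  - apply/measurable_EFinP/measurable_funX.
    by apply: measurable_funD; [exact: lX.1|exact: lY.1].
  - exact: measurable_int h.
  - move=> w _; rewrite lee_fin.
    have h1 : 0 <= (X w - Y w) ^+ 2 by exact: sqr_ge0.
    nra.
exact: integrable_lty.
Qed.

Lemma L2Z (c : R) X : L2 X -> L2 (fun w => c * X w).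
Proof.
move=> lX; split; first by apply: measurable_funM => //; exact: lX.1.
under eq_integral do rewrite exprMn EFinM.
rewrite ge0_integralZl//=; last 3 first.
- by apply/measurable_EFinP/measurable_funX; exact: lX.1.
- by move=> w _; rewrite lee_fin sqr_ge0.
- by rewrite lee_fin sqr_ge0.
by rewrite lte_mul_pinfty ?lee_fin ?sqr_ge0 ?ltry//; exact: lX.2.
Qed.

Lemma L2B X Y : L2 X -> L2 Y -> L2 (fun w => X w - Y w).
Proof.
move=> lX lY; have := L2D lX (L2Z (-1) lY).
by under eq_fun do rewrite mulN1r.
Qed.

Lemma L2_sum (I : Type) (s : seq I) (F : I -> Omega -> R) :
  (forall i, L2 (F i)) -> L2 (fun w => \sum_(i <- s) F i w).
Proof.
move=> lF; elim: s => [|i s IH].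
  by under eq_fun do rewrite big_nil; exact: L2_cst.
by under eq_fun do rewrite big_cons; exact: L2D.
Qed.

Lemma le_L2 X Y : measurable_fun setT X -> L2 Y ->
  (forall w, X w ^+ 2 <= Y w ^+ 2) -> L2 X.
Proof.
move=> mX lY XY; split => //; apply: le_lt_trans lY.2.
apply: ge0_le_integral => //.
- by move=> w _; rewrite lee_fin sqr_ge0.
- by apply/measurable_EFinP/measurable_funX.
- by apply/measurable_EFinP/measurable_funX; exact: lY.1.
- by move=> w _; rewrite lee_fin.
Qed.

Lemma Rintegral_EFin X : P.-integrable setT (fun w => (X w)%:E) ->
  (\int[P]_w X w)%:E = (\int[P]_w (X w)%:E)%E.
Proof. by move=> iX; rewrite fineK//; exact: integrable_fin_num iX. Qed.

Lemma Rintegral_prob_cst (c : R) : \int[P]_w c = c.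
Proof. by rewrite Rintegral_cst//= probability_setT /= mulr1. Qed.

(** The variance is nonnegative. *)
Lemma sqr_mean_le X : L2 X -> (\int[P]_w X w) ^+ 2 <= \int[P]_w (X w ^+ 2).
Proof.
move=> lX; set m := \int[P]_w X w.
have iX := L2_integrable lX; have iX2 := L2_sqr_integrable lX.
have : 0 <= \int[P]_w ((X w - m) ^+ 2) by apply: Rintegral_ge0 => w _; exact: sqr_ge0.
have -> : (fun w => (X w - m) ^+ 2) = (fun w => X w ^+ 2 + (- (2 * m) * X w + m ^+ 2)).
  by apply/funext => w; ring.
have i1 : P.-integrable setT (fun w => (- (2 * m) * X w)%:E).
  by under eq_fun do rewrite EFinM; exact: integrableZl.
have i2 : P.-integrable setT (fun w => (- (2 * m) * X w + m ^+ 2)%:E).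
  by under eq_fun do rewrite EFinD; apply: integrableD => //; exact: prob_integrable_cst.
rewrite RintegralD// RintegralD//; last exact: prob_integrable_cst.
rewrite RintegralZl// Rintegral_prob_cst -/m.
nra.
Qed.

(** Decoupling is available for nonnegative integrands only; the product is
    recovered from the square of [X + Y], computed with and without decoupling. *)
Lemma mean_mul_indep X Y : L2 X -> L2 Y ->
  (forall A B, measurable A -> measurable B ->
    P (X @^-1` A `&` Y @^-1` B) = (P (X @^-1` A) * P (Y @^-1` B))%E) ->
  \int[P]_w (X w * Y w) = (\int[P]_w X w) * (\int[P]_w Y w).
Proof.
move=> lX lY XY.
have iX := L2_integrable lX; have iX2 := L2_sqr_integrable lX.
have iY := L2_integrable lY; have iY2 := L2_sqr_integrable lY.
have iXY := L2_mul_integrable lX lY.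
pose h (z : R * R) := ((z.1 + z.2) ^+ 2)%:E.
have mh : measurable_fun setT h.
  by apply/measurable_EFinP/measurable_funX/measurable_funD.
have H : (\int[P]_w ((X w + Y w) ^+ 2)%:E =
    \int[P]_w1 \int[P]_w2 ((X w1 + Y w2) ^+ 2)%:E)%E.
  by apply: (indep_integral lX.1 lY.1 XY mh) => z; rewrite lee_fin sqr_ge0.
have sqE (c : R) (Z : Omega -> R) : L2 Z ->
   \int[P]_w ((c + Z w) ^+ 2) = c ^+ 2 + 2 * c * (\int[P]_w Z w) + \int[P]_w (Z w ^+ 2).
  move=> lZ; under eq_Rintegral => w _.
    rewrite (_ : (c + Z w) ^+ 2 = Z w ^+ 2 + (2 * c * Z w + c ^+ 2)); last by ring.
    over.
  have i1 : P.-integrable setT (fun w => (2 * c * Z w)%:E).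
    by under eq_fun do rewrite EFinM; apply: integrableZl => //; exact: L2_integrable.
  have i2 : P.-integrable setT (fun w => (2 * c * Z w + c ^+ 2)%:E).
    by under eq_fun do rewrite EFinD; apply: integrableD => //; exact: prob_integrable_cst.
  rewrite RintegralD//; last exact: L2_sqr_integrable.
  rewrite RintegralD//; last exact: prob_integrable_cst.
  by rewrite RintegralZl//; [rewrite Rintegral_prob_cst; ring|exact: L2_integrable].
have lhsE : \int[P]_w ((X w + Y w) ^+ 2) =
   \int[P]_w (X w ^+ 2) + (2 * \int[P]_w (X w * Y w) + \int[P]_w (Y w ^+ 2)).
  under eq_Rintegral => w _.
    rewrite (_ : (X w + Y w) ^+ 2 = X w ^+ 2 + (2 * (X w * Y w) + Y w ^+ 2)); last by ring.
    over.
  have i1 : P.-integrable setT (fun w => (2 * (X w * Y w))%:E).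
    by under eq_fun do rewrite EFinM; apply: integrableZl.
  have i2 : P.-integrable setT (fun w => (2 * (X w * Y w) + Y w ^+ 2)%:E).
    by under eq_fun do rewrite EFinD; apply: integrableD.
  by rewrite RintegralD// RintegralD// RintegralZl.
have : \int[P]_w ((X w + Y w) ^+ 2) = \int[P]_w1 \int[P]_w2 ((X w1 + Y w2) ^+ 2).
  rewrite /Rintegral H; congr fine; apply: eq_integral => w _.
  rewrite -Rintegral_EFin//; apply: L2_sqr_integrable.
  exact: L2D (L2_cst _) lY.
rewrite lhsE.
under [RHS]eq_Rintegral => w _.
  rewrite (sqE _ _ lY) (_ : _ + _ + _ =
    X w ^+ 2 + (2 * (\int[P]_w Y w) * X w + \int[P]_w (Y w ^+ 2))); last by ring.
  over.
have i1 : P.-integrable setT (fun w => (2 * (\int[P]_w Y w) * X w)%:E).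
  by under eq_fun do rewrite EFinM; apply: integrableZl.
have i2 : P.-integrable setT
    (fun w => (2 * (\int[P]_w Y w) * X w + \int[P]_w (Y w ^+ 2))%:E).
  by under eq_fun do rewrite EFinD; apply: integrableD => //; exact: prob_integrable_cst.
rewrite RintegralD// RintegralD//; last exact: prob_integrable_cst.
rewrite RintegralZl// Rintegral_prob_cst.
nra.
Qed.

End square_integrable.

(** * Moments of the normal law *)

Section power_integrals.
Context {R : realType}.
Local Notation leb := (@lebesgue_measure R).

Lemma integral_mul_indic (d : measure_display) (E : measurableType d)
    (nu : {measure set E -> \bar R}) (A : set E) (g : E -> R) :
  measurable A ->
  (\int[nu]_x (g x * \1_A x)%:E = \int[nu]_(x in A) (g x)%:E)%E.
Proof.
move=> mA; rewrite [RHS]integral_mkcond; apply: eq_integral => x _.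
rewrite /patch indicE; case: ifPn => xA; first by rewrite mulr1.
by rewrite mulr0.
Qed.

Lemma integral_power (n : nat) (y : R) : 0 <= y ->
  (\int[leb]_(a in `[0%R, y]) (a ^+ n * n.+1%:R)%:E = (y ^+ n.+1)%:E)%E.
Proof.
rewrite le_eqVlt => /predU1P[<-|y0].
  by rewrite set_itv1 integral_set1 expr0n.
have cX k : continuous (fun a : R => a ^+ k) by exact: exprn_continuous.
rewrite (@continuous_FTC2 _ _ (fun a => a ^+ n.+1))//.
- by rewrite expr0n /= oppr0 adde0.
- have ch : continuous (fun a : R => a ^+ n * n.+1%:R).
    by move=> a; apply: cvgM; [exact: cX|exact: cst_continuous].
  by apply: continuous_subspaceT => a; exact: ch.
- split.
  + by move=> a _; exact: exprn_derivable.
  + by apply/cvg_at_right_filter; exact: cX.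
  + by apply/cvg_at_left_filter; exact: cX.
- by move=> a _; rewrite exp_derive1 /GRing.scale /= mulrC.
Qed.

Lemma integral_reflect (g : R -> \bar R) :
  measurable_fun setT g -> (forall x, 0 <= g x)%E ->
  (\int[leb]_x g (- x)%R = \int[leb]_x g x)%E.
Proof.
move=> mg g0.
transitivity (\int[pushforward leb (-%R : R -> measurableTypeR R)]_x g x)%E.
  by rewrite ge0_integral_pushforward//; exact: oppr_measurable.
by apply: eq_measure_integral => A mA _; exact: lebesgue_measureN.
Qed.

End power_integrals.

Section normal_moments.
Context {R : realType}.
Local Notation leb := (@lebesgue_measure R).
Variable (s : R).
Hypothesis s0 : 0 < s.
Let f := normal_pdf 0 s : R -> R.

Let fE y : f y = normal_peak s * expR (- (y ^+ 2 / (s ^+ 2 *+ 2))).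
Proof.
rewrite /f normal_pdfE ?gt_eqF//; congr (_ * expR _).
by rewrite subr0 mulNr.
Qed.

Let f0 y : 0 <= f y. Proof. exact: normal_pdf_ge0. Qed.
Let cf : continuous f. Proof. by apply: continuous_normal_pdf; rewrite gt_eqF. Qed.
Let mf : measurable_fun setT f. Proof. exact: measurable_normal_pdf. Qed.

(** [y * f y] is an exact derivative, which is what makes moments computable. *)
Let is_derive_f (y : R) : is_derive y 1 (fun y => - s ^+ 2 * f y) (y * f y).
Proof.
rewrite (_ : (fun y => _) = (fun y => - s ^+ 2 * (normal_peak s * expR (- (y ^+ 2 / (s ^+ 2 *+ 2)))))); last first.
  by apply/funext => z; rewrite fE.
apply: is_derive_eq.
rewrite /GRing.scale /= fE !mulr1 -mulr_natr; field.
by rewrite gt_eqF.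
Qed.

Let f_cvg0 : (- s ^+ 2 * f y) @[y --> +oo] --> 0.
Proof.
rewrite -(mulr0 (- s ^+ 2)); apply: cvgMr.
rewrite (_ : f = (fun y => normal_peak s * expR (- (y ^+ 2 / (s ^+ 2 *+ 2))))); last first.
  by apply/funext => y; rewrite fE.
rewrite -(mulr0 (normal_peak s)); apply: cvgMr.
apply: (@cvg_comp _ _ _ (fun y => y ^+ 2 / (s ^+ 2 *+ 2)) (fun z => expR (- z)) _ (pinfty_nbhs R));
  last exact: cvgr_expR.
apply: gt0_cvgMly; first by rewrite invr_gt0 pmulrn_lgt0// exprn_gt0.
apply/cvgryPge => A; near=> y.
have y1 : 1 <= y by near: y; exact: nbhs_pinfty_ge.
have yA : A <= y by near: y; exact: nbhs_pinfty_ge.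
by rewrite expr2; nra.
Unshelve. all: by end_near. Qed.

Lemma normal_tail (a : R) : 0 <= a ->
  (\int[leb]_(y in `[a, +oo[) (y * f y)%:E = (s ^+ 2 * f a)%:E)%E.
Proof.
move=> a0; rewrite (@ge0_continuous_FTC2y _ _ (fun y => - s ^+ 2 * f y) _ 0)//.
- by rewrite -EFinB mulNr sub0r opprK.
- by move=> y ay; rewrite mulr_ge0// (le_trans a0).
- by apply: continuous_subspaceT => y; apply: cvgM => //; exact: cf.
- by move=> y _; have [] := is_derive_f y.
- apply/cvg_at_right_filter.
  have : continuous (fun y : R => - s ^+ 2 * f y); last exact.
  by move=> y; apply: cvgM; [exact: cst_continuous|exact: cf].
- by move=> y _; rewrite derive1E; have [_ ->] := is_derive_f y.
Qed.

Let M n := (\int[leb]_(y in `[0%R, +oo[) (y ^+ n * f y)%:E)%E.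

(** Integration by parts: [y ^+ n.+1] is an integral over [[0, y]], and after
    exchanging the two integrals the inner one is a tail of [y * f y]. *)
Let MS n : (M n.+2 = (n.+1%:R * s ^+ 2)%:E * M n)%E.
Proof.
pose S : set (R * R) := [set z | 0 <= z.1 <= z.2].
have mS : measurable S.
  rewrite (_ : S = (fun z : R * R => (0 <= z.1) && (z.1 <= z.2)) @^-1` [set true])//.
  rewrite -[X in measurable X]setTI.
  suff : measurable_fun setT (fun z : R * R => (0 <= z.1) && (z.1 <= z.2)) by exact.
  by apply: measurable_and; apply: measurable_fun_ler.
pose h (z : R * R) := (z.1 ^+ n * n.+1%:R * (z.2 * f z.2) * \1_S z)%:E.
have mh : measurable_fun setT h.
  apply/measurable_EFinP/measurable_funM; last exact: measurable_indic.
  apply: measurable_funM; first by apply: measurable_funM => //; exact: measurable_funX.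
  by apply: measurable_funM => //; exact: measurableT_comp.
have h0 z : (0 <= h z)%E.
  rewrite /h indicE lee_fin; have [|_] := boolP (z \in S); last by rewrite mulr0.
  rewrite inE /S /= => /andP[z1 z12].
  by rewrite !mulr_ge0// ?exprn_ge0// (le_trans z1).
have := @fubini_tonelli _ _ _ _ _ leb leb h mh h0.
rewrite /fubini_F /fubini_G /h /=.
have -> : (\int[leb]_x \int[leb]_y
    (x ^+ n * n.+1%:R * (y * f y) * \1_S (x, y))%:E)%E = ((n.+1%:R * s ^+ 2)%:E * M n)%E.
  rewrite /M -ge0_integralZl//; last 3 first.
  - by apply/measurable_EFinP/measurable_funTS/measurable_funM => //; exact: measurable_funX.
  - by move=> y; rewrite /= in_itv /= andbT => y0; rewrite lee_fin mulr_ge0// exprn_ge0.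
  - by rewrite lee_fin mulr_ge0// sqr_ge0.
  rewrite [RHS]integral_mkcond; apply: eq_integral => x _; rewrite /patch.
  rewrite mem_setE in_itv /= andbT; case: ifPn => x0; last first.
    apply: integral0_eq => y _; rewrite indicE memNset ?mulr0//.
    by rewrite /S /= => /andP[]; rewrite (negbTE x0).
  transitivity (\int[leb]_y ((x ^+ n * n.+1%:R * (y * f y)) * \1_(`[x, +oo[%classic) y)%:E)%E.
    apply: eq_integral => y _; congr (_ * _)%:E.
    by rewrite !indicE; congr ((nat_of_bool _)%:R); apply/idP/idP; rewrite !inE /S /= in_itv /= x0 andbT.
  rewrite integral_mul_indic//.
  under eq_integral do rewrite EFinM.
  rewrite ge0_integralZl//; last 3 first.
  - by apply/measurable_EFinP/measurable_funTS/measurable_funM.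
  - move=> y; rewrite /= in_itv /= andbT => xy.
    by rewrite lee_fin mulr_ge0// (le_trans x0).
  - by rewrite lee_fin mulr_ge0// exprn_ge0.
  by rewrite normal_tail// -!EFinM; congr (_%:E); ring.
move=> ->.
rewrite /M [LHS]integral_mkcond; apply/esym/eq_integral => y _; rewrite /patch.
rewrite mem_setE in_itv /= andbT; case: ifPn => y0; last first.
  apply: integral0_eq => x _; rewrite indicE memNset ?mulr0//.
  rewrite /S /= => /andP[x0 xy]; move: y0; rewrite -ltNge => y0.
  by have := le_trans x0 xy; rewrite leNgt y0.
transitivity (\int[leb]_x ((y * f y * (x ^+ n * n.+1%:R)) * \1_(`[0%R, y]%classic) x)%:E)%E.
  apply: eq_integral => x _; congr (_%:E).
  have -> : \1_S (x, y) = \1_(`[0%R, y]%classic) x :> R.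
    by rewrite !indicE; congr ((nat_of_bool _)%:R); apply/idP/idP; rewrite !inE /S /= in_itv.
  by ring.
rewrite integral_mul_indic//.
under eq_integral do rewrite EFinM.
rewrite ge0_integralZl//; last 3 first.
- by apply/measurable_EFinP/measurable_funTS/measurable_funM => //; exact: measurable_funX.
- by move=> x; rewrite /= in_itv /= => /andP[x0 _]; rewrite lee_fin mulr_ge0// exprn_ge0.
- by rewrite lee_fin mulr_ge0.
by rewrite integral_power// -EFinM; congr (_%:E); rewrite !exprS; ring.
Qed.

Let even_integral n :
  (\int[leb]_y (y ^+ (2 * n) * f y)%:E = 2%:E * M (2 * n))%E.
Proof.
rewrite ge0_symfun_integralT.
- by rewrite -set_itvcy.
- by move=> y; rewrite mulr_ge0// exprM exprn_ge0// sqr_ge0.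
- have : continuous (fun y : R => y ^+ (2 * n) * f y); last exact.
  by move=> y; apply: cvgM; [exact: exprn_continuous|exact: cf].
- by move=> y; rewrite /= !fE !exprM sqrrN.
Qed.

Let M0 : (2%:E * M 0 = 1)%E.
Proof.
rewrite -[0%N]/(2 * 0)%N -even_integral -[RHS](@integral_normal_pdf R 0 s).
by apply: eq_integral => y _; rewrite muln0 expr0 mul1r.
Qed.

Lemma normal_moment2 : (\int[leb]_y (y ^+ 2 * f y)%:E = (s ^+ 2)%:E)%E.
Proof.
have := even_integral 1; rewrite muln1 => ->.
by rewrite MS muleCA M0 mule1 mul1r.
Qed.

Lemma normal_moment4 : (\int[leb]_y (y ^+ 4 * f y)%:E = (3 * s ^+ 4)%:E)%E.
Proof.
have := even_integral 2; rewrite -[(2 * 2)%N]/4%N => ->.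
rewrite !MS muleCA (muleCA 2%:E) M0 mule1 -EFinM; congr (_%:E).
by rewrite mul1r -mulrA; congr (_ * _); rewrite -exprD.
Qed.

Lemma normal_moment_pos_neg :
  (\int[leb]_y (Num.max y 0 * f y)%:E = \int[leb]_y (Num.max (- y) 0 * f y)%:E)%E.
Proof.
rewrite -[RHS]integral_reflect; last 2 first.
- apply/measurable_EFinP/measurable_funM => //.
  by apply: measurable_maxr => //; exact: measurable_funN.
- by move=> y; rewrite lee_fin mulr_ge0// le_max lexx orbT.
by apply: eq_integral => y _; rewrite opprK !fE sqrrN.
Qed.

End normal_moments.

(** * Measurability of continuous paths and equality of laws *)

Section path_measurability.
Context {R : realType}.

Lemma within_continuous_dist (X : pseudoMetricType R) (A : set X) (f : X -> R) x :
  {within A, continuous f} -> A x -> forall e, 0 < e ->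
  exists2 dl : R, 0 < dl & forall y, A y -> ball x dl y -> `|f x - f y| < e.
Proof.
move=> cf Ax e e0.
have := cf x => /cvgrPdist_lt/(_ e e0).
rewrite /prop_near1 /nbhs /= -nbhs_subspace_in// /within /=.
move=> /nbhs_ballP[dl /= dl0 h]; exists dl => // y Ay xy.
exact: h.
Qed.

(** A continuous path is the limit of its discretisations on the grids of mesh
    [n.+1%:R^-1]; on each cell of the grid a discretised path is a single
    measurable variable. *)
Lemma measurable_path (dE : measure_display) (E : measurableType dE)
    (B : R -> E -> R) :
  (forall t, 0 <= t -> measurable_fun setT (B t)) ->
  (forall w, {within `[0, +oo[, continuous (fun t => B t w)}) ->
  measurable_fun setT (fun z : R * E => B (Num.max z.1 0) z.2).
Proof.
move=> mB cB.
pose g (n : nat) (t : R) : nat := Num.trunc (n.+1%:R * Num.max t 0).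
pose Bn n (z : R * E) := B ((g n z.1)%:R / n.+1%:R) z.2.
have gn0 n t : 0 <= n.+1%:R * Num.max t 0 :> R.
  by rewrite mulr_ge0// le_max lexx orbT.
have mg n k : measurable [set t | g n t = k].
  have mgr : measurable_fun setT (fun t => (g n t)%:R : R).
    apply: nondecreasing_measurable => // a b ab; rewrite ler_nat.
    by apply: le_truncn; rewrite ler_pM2l// ge_max !le_max ab lexx orbT.
  have -> : [set t | g n t = k] = setT `&` (fun t => (g n t)%:R : R) @^-1` [set k%:R].
    rewrite setTI; apply/seteqP; split => t /= [].
      by move=> ->.
    by move/eqP; rewrite eqr_nat => /eqP.
  exact: mgr.
apply: (measurable_fun_cvg (h := Bn)) => //.
- move=> n _ A mA; rewrite setTI.
  have -> : Bn n @^-1` A = \bigcup_k ([set t | g n t = k] `*` (B (k%:R / n.+1%:R) @^-1` A)).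
    apply/seteqP; split => [[t w] /= Aw|[t w] [k _] [/= <-]]//.
    by exists (g n t).
  apply: bigcup_measurable => k _; apply: measurableX => //.
  by rewrite -[X in measurable X]setTI; apply: mB.
- move=> [t w] _ /=; set t0 := Num.max t 0.
  have t00 : 0 <= t0 by rewrite /t0 le_max lexx orbT.
  apply/cvgrPdist_lt => e e0.
  have t0i : `[0, +oo[%classic t0 by rewrite /= in_itv /= t00.
  have [dl dl0 h] := within_continuous_dist (cB w) t0i e0.
  near=> n; apply: h.
    by rewrite /= in_itv /= andbT divr_ge0.
  rewrite /ball /=.
  have gle : (g n t)%:R <= n.+1%:R * t0 by rewrite truncn_le.
  have ggt : n.+1%:R * t0 < (g n t).+1%:R by exact: truncnS_gt.
  have n0 : 0 < n.+1%:R :> R by [].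
  have -> : t0 - (g n t)%:R / n.+1%:R = (n.+1%:R * t0 - (g n t)%:R) / n.+1%:R.
    by rewrite mulrBl mulrAC divff ?mul1r// gt_eqF.
  rewrite ger0_norm; last by rewrite divr_ge0// subr_ge0.
  rewrite ltr_pdivrMr// (@le_lt_trans _ _ 1)//.
    by move: ggt; rewrite -natr1; lra.
  rewrite -ltr_pdivrMl// mulr1.
  near: n; exists (Num.trunc dl^-1) => //= n /= dn.
  apply: (lt_le_trans (truncnS_gt _)).
  by rewrite ler_nat ltnS.
Unshelve. all: by end_near. Qed.

End path_measurability.

Section laws.
Context {R : realType} {dO : measure_display} {Omega : measurableType dO}.
Variable P : probability Omega R.

Lemma ae_prob_eq (A1 A2 : set Omega) : measurable A1 -> measurable A2 ->
  {ae P, forall w, A1 w <-> A2 w} -> P A1 = P A2.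
Proof.
move=> m1 m2 A12; rewrite -[A1]setIT -[A2]setIT -!integral_indic//.
apply: ge0_ae_eq_integral => //.
- exact/measurable_EFinP.
- exact/measurable_EFinP.
apply: filterS A12 => w A12 _; rewrite !indicE; congr (_%:R%:E).
by congr nat_of_bool; apply/idP/idP; rewrite !inE => /A12.
Qed.

Lemma independent_family_all (I : finType) (S : I -> set (set Omega)) A :
  independent_family P [set: I] S -> (forall i, S i (A i)) ->
  P (\bigcap_i A i) = (\prod_i P (A i))%E.
Proof.
move=> iS SA; pose J : {fset I} := seq_fset tt (enum I).
have JT i : i \in J by rewrite seq_fsetE mem_enum.
have -> : \bigcap_i A i = \bigcap_(i in [set` J]) A i.
  by apply/seteqP; split => w h i _; apply: h => //=; exact: JT.
rewrite iS//; apply: perm_big; apply: uniq_perm; rewrite ?fset_uniq ?index_enum_uniq//.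
by move=> i; rewrite JT mem_index_enum.
Qed.

Lemma sigma_of_preimage (I : Type) (D : set I) (Y : I -> Omega -> R) i A :
  D i -> measurable A -> sigma_of D Y (Y i @^-1` A).
Proof.
move=> Di mA; apply: sub_sigma_algebra; exists i => //; exists A => //.
by rewrite setTI.
Qed.

Lemma sub_sigma_of (I : Type) (D : set I) (Y : I -> Omega -> R) :
  (forall i, D i -> measurable_fun setT (Y i)) -> sigma_of D Y `<=` measurable.
Proof.
move=> mY; apply: smallest_sub; first exact: sigma_algebra_measurable.
by move=> _ [i Di [A mA <-]]; exact: mY.
Qed.

Lemma measurable_sigma_of (I : Type) (D : set I) (Y : I -> Omega -> R) i :
  D i -> measurable_fun [set: g_sigma_algebraType
    (\bigcup_(i in D) preimage_set_system setT (Y i) measurable)] (Y i).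
Proof. by move=> Di _ A mA; rewrite setTI; exact: sigma_of_preimage. Qed.

End laws.

Section mx_laws.
Context {R : realType} {d : nat}.
Context {dO : measure_display} {Omega : measurableType dO}.
Context {dO' : measure_display} {Omega' : measurableType dO'}.
Variables (P : probability Omega R) (P' : probability Omega' R).

(** The boxes form a pi-system that generates the sigma-algebra of vectors. *)
Lemma mx_law_eq (X : Omega -> 'cV[R]_d) (X' : Omega' -> 'cV[R]_d) :
  measurable_fun setT X -> measurable_fun setT X' ->
  (forall A : 'I_d -> set R, (forall i, measurable (A i)) ->
    P [set w | forall i, A i (X w i ord0)] =
    P' [set w | forall i, A i (X' w i ord0)]) ->
  forall v : 'cV[R]_d -> \bar R, measurable_fun setT v -> (forall x, 0 <= v x)%E ->
  (\int[P]_w v (X w) = \int[P']_w v (X' w))%E.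
Proof.
move=> mX mX' XX' v mv v0.
pose f : {mfun Omega >-> 'cV[R]_d} := HB.pack X (isMeasurableFun.Build _ _ _ _ _ mX).
pose f' : {mfun Omega' >-> 'cV[R]_d} := HB.pack X' (isMeasurableFun.Build _ _ _ _ _ mX').
transitivity (\int[distribution P f]_x v x)%E.
  by rewrite ge0_integral_distribution.
transitivity (\int[distribution P' f']_x v x)%E; last first.
  by rewrite ge0_integral_distribution.
apply: eq_measure_integral => A mA _.
apply: (measure_unique (@mx_boxes R d 1) (fun=> setT)) => //.
- move=> _ _ [A1 mA1 <-] [A2 mA2 <-]; exists (fun i j => A1 i j `&` A2 i j).
    by move=> i j; exact: measurableI.
  by apply/seteqP; split => [x h|x [h1 h2] i j]; split => // i j; have [] := h i j.
- move=> _; exists (fun _ _ => setT) => //; exact/seteqP.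
- by apply/seteqP; split => // x _; exists 0%N.
- move=> _ [A1 mA1 <-]; rewrite /distribution /pushforward /=.
  have := XX' (fun i => A1 i ord0) (fun i => mA1 i ord0).
  have e (T : Type) (Y : T -> 'cV[R]_d) :
      [set w | forall i, A1 i ord0 (Y w i ord0)] =
      Y @^-1` [set x : 'cV[R]_d | forall i j, A1 i j (x i j)].
    by apply/seteqP; split => [w h i j|w h i]; [rewrite ord1|exact: h].
  by rewrite !e.
- by move=> _; apply: (le_lt_trans (probability_le1 _ _)); rewrite ?ltry.
Qed.

End mx_laws.

(** * One-dimensional Brownian motion *)

(** The centred normal law of variance [r], read as the Dirac mass at [0] when
    [r = 0]. *)
Definition gauss_law {R : realType} (r : R) (A : set R) : \bar R :=
  if r == 0 then (\1_A 0)%:E else normal_prob 0 (Num.sqrt r) A.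

Section brownian1_facts.
Context {R : realType} {dO : measure_display} {Omega : measurableType dO}.
Variable P : probability Omega R.
Variable B : R -> Omega -> R.
Hypothesis hB : brownian1 P B.

Lemma brownian1_inc_law s r A : 0 <= s -> 0 <= r -> measurable A ->
  P [set w | A (B (s + r) w - B s w)] = gauss_law r A.
Proof.
move=> s0; rewrite /gauss_law le_eqVlt => /predU1P[<- mA|r0 mA].
  rewrite eqxx addr0 (_ : [set w | _] = if 0 \in A then setT else set0).
    by rewrite indicE; case: ifP; rewrite ?probability_setT ?measure0.
  apply/seteqP; split => w; rewrite /= subrr.
    by move=> A0; rewrite mem_set.
  by case: ifPn => // /[1!inE].
have sr : 0 <= s < s + r by rewrite s0 ltrDl.
have h := brownian1_gauss hB sr mA.
have e : s + r - s = r by ring.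
by rewrite e in h; rewrite gt_eqF// -h.
Qed.

Lemma brownian1_val_law r A : 0 <= r -> measurable A ->
  P [set w | A (B r w)] = gauss_law r A.
Proof.
move=> r0 mA; rewrite -(brownian1_inc_law (lexx 0) r0 mA) add0r.
have mr := brownian1_meas hB r0; have m0 := brownian1_meas hB (lexx 0).
apply: ae_prob_eq.
- by rewrite -[X in measurable X]setTI; exact: mr.
- rewrite -[X in measurable X]setTI.
  by apply: (measurable_funB mr m0).
- by apply: filterS (brownian1_start hB) => w /= ->; rewrite subr0.
Qed.

Lemma brownian1_incs_indep s r A1 A2 : 0 <= s -> 0 <= r ->
  measurable A1 -> measurable A2 ->
  P ([set w | A1 (B s w - B 0 w)] `&` [set w | A2 (B (s + r) w - B s w)]) =
  (gauss_law s A1 * gauss_law r A2)%E.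
Proof.
move=> s0 r0 m1 m2.
pose t (i : nat) : R := if i is i'.+1 then (if i' is _.+1 then s + r else s) else 0.
have t01 i : (i < 2)%N -> t i <= t i.+1.
  by case: i => [|[|]]//= _; rewrite lerDl.
have hi := brownian1_indep hB (n := 2) (t := t) (lexx 0) t01.
pose E (i : 'I_2) : set Omega := if i == ord0 then [set w | A1 (B s w - B 0 w)]
  else [set w | A2 (B (s + r) w - B s w)].
have hE : (forall i : 'I_2, sigma_of [set: unit] (fun _ w => B (t i.+1) w - B (t i) w) (E i)).
  move=> i; rewrite /E; case: ifPn => [/eqP ->|i0].
    exact: (@sigma_of_preimage _ _ _ unit setT (fun _ w => B s w - B 0 w) tt).
  have -> : i = lift ord0 ord0.
    by apply/val_inj; case: i i0 => [[|[|]]].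
  exact: (@sigma_of_preimage _ _ _ unit setT (fun _ w => B (s + r) w - B s w) tt).
have := independent_family_all hi hE.
rewrite big_ord_recl big_ord1 /E /= => h.
rewrite -(brownian1_inc_law s0 r0 m2) -(brownian1_inc_law (lexx 0) s0 m1) add0r -h.
congr (P _); apply/seteqP; split => [w [h1 h2] i _|w hw].
  by case: ifP.
split; first exact: (hw ord0).
exact: (hw (lift ord0 ord0)).
Qed.

Lemma brownian1_ae0 : {ae P, forall w, B 0 w = 0}.
Proof. exact: brownian1_start hB. Qed.

Lemma brownian1_integral (r : R) (F : R -> \bar R) : 0 < r ->
  measurable_fun setT F -> (forall x, 0 <= F x)%E ->
  (\int[P]_w F (B r w) =
   \int[lebesgue_measure]_x (F x * (normal_pdf 0 (Num.sqrt r) x)%:E))%E.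
Proof.
move=> r0 mF F0.
have mB := brownian1_meas hB (ltW r0).
pose f : {mfun Omega >-> measurableTypeR R} :=
  HB.pack (B r) (isMeasurableFun.Build _ _ _ (measurableTypeR R) _ mB).
pose nu : {measure set (measurableTypeR R) -> \bar R} := distribution P f.
transitivity (\int[nu]_x F x)%E.
  by rewrite ge0_integral_distribution.
have mp := @measurable_normal_pdf R 0 (Num.sqrt r).
have p0 := @normal_pdf_ge0 R 0 (Num.sqrt r).
have nuE A : measurable A -> nu A =
    (\int[lebesgue_measure]_(x in A) (normal_pdf 0 (Num.sqrt r) x)%:E)%E.
  move=> mA; have := brownian1_val_law (ltW r0) mA.
  by rewrite /gauss_law gt_eqF.
exact: (@integral_density R _ _ (@lebesgue_measure R) nu _ mp p0 nuE F mF F0).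
Qed.

Lemma brownian1_moment2 r : 0 <= r -> (\int[P]_w (B r w ^+ 2)%:E = r%:E)%E.
Proof.
rewrite le_eqVlt => /predU1P[<-|r0].
  rewrite -[RHS](integral0 P setT).
  apply: ge0_ae_eq_integral => //.
  - apply/measurable_EFinP/measurable_funX; exact: (brownian1_meas hB).
  - by move=> w _; rewrite lee_fin sqr_ge0.
  by apply: filterS brownian1_ae0 => w -> _; rewrite expr0n.
rewrite (@brownian1_integral _ (fun x => (x ^+ 2)%:E))//.
- under eq_integral do rewrite -EFinM.
  by rewrite normal_moment2 ?sqrtr_gt0// sqr_sqrtr// ltW.
- by apply/measurable_EFinP/measurable_funX.
- by move=> x; rewrite lee_fin sqr_ge0.
Qed.

Lemma brownian1_moment4 r : 0 <= r -> (\int[P]_w (B r w ^+ 4)%:E = (3 * r ^+ 2)%:E)%E.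
Proof.
rewrite le_eqVlt => /predU1P[<-|r0].
  rewrite expr0n mulr0 -[RHS](integral0 P setT).
  apply: ge0_ae_eq_integral => //.
  - apply/measurable_EFinP/measurable_funX; exact: (brownian1_meas hB).
  - by move=> w _; rewrite lee_fin (exprM _ 2 2) sqr_ge0.
  by apply: filterS brownian1_ae0 => w -> _; rewrite expr0n.
rewrite (@brownian1_integral _ (fun x => (x ^+ 4)%:E))//.
- under eq_integral do rewrite -EFinM.
  rewrite normal_moment4 ?sqrtr_gt0//; congr (_%:E).
  by rewrite (exprM _ 2 2) sqr_sqrtr// ltW.
- by apply/measurable_EFinP/measurable_funX.
- by move=> x; rewrite lee_fin (exprM _ 2 2) sqr_ge0.
Qed.

Lemma brownian1_L2 r : 0 <= r -> L2 P (B r).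
Proof.
move=> r0; split; first exact: (brownian1_meas hB).
by rewrite brownian1_moment2// ltry.
Qed.

Lemma brownian1_sqr_L2 r : 0 <= r -> L2 P (fun w => B r w ^+ 2).
Proof.
move=> r0; split; first by apply: measurable_funX; exact: (brownian1_meas hB).
under eq_integral do rewrite -exprM.
by rewrite brownian1_moment4// ltry.
Qed.

(** The law is symmetric, so the positive and the negative parts have the same
    mean. *)
Lemma brownian1_mean r : 0 <= r -> \int[P]_w (B r w) = 0.
Proof.
rewrite le_eqVlt => /predU1P[<-|r0].
  rewrite /Rintegral (ae_eq_integral (cst 0%E)) ?integral0//.
  - by apply/measurable_EFinP; exact: (brownian1_meas hB).
  - by apply: filterS brownian1_ae0 => w -> _.
rewrite /Rintegral integralE.
have h (w : Omega) : (funepos (fun w => (B r w)%:E) w = (Num.max (B r w) 0)%:E)%E.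
  by rewrite funeposE EFin_max.
have h' (w : Omega) : (funeneg (fun w => (B r w)%:E) w = (Num.max (- B r w) 0)%:E)%E.
  by rewrite funenegE EFin_max.
under eq_integral do rewrite h.
under [X in (_ - X)%E]eq_integral do rewrite h'.
have -> : (\int[P]_w (Num.max (- B r w) 0)%:E = \int[P]_w (Num.max (B r w) 0)%:E)%E.
  rewrite (@brownian1_integral _ (fun x => (Num.max (- x) 0)%:E))//; last 2 first.
  - apply/measurable_EFinP/measurable_maxr => //; exact: measurable_funN.
  - by move=> x; rewrite lee_fin le_max lexx orbT.
  rewrite (@brownian1_integral _ (fun x => (Num.max x 0)%:E))//; last 2 first.
  - exact/measurable_EFinP/measurable_maxr.
  - by move=> x; rewrite lee_fin le_max lexx orbT.
  have := @normal_moment_pos_neg R (Num.sqrt r); rewrite sqrtr_gt0 => /(_ r0) e.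
  by under eq_integral do rewrite -EFinM; rewrite -e.
rewrite subee//.
have iB := L2_integrable (brownian1_L2 (ltW r0)).
have := integrable_pos_fin_num measurableT iB.
by under eq_integral do rewrite h.
Qed.

End brownian1_facts.

(** * Multidimensional Brownian motion *)

Section brownian_facts.
Context {R : realType} {d : nat} {dO : measure_display} {Omega : measurableType dO}.
Variable P : probability Omega R.
Variable B : R -> Omega -> 'cV[R]_d.
Hypothesis hB : brownian P B.

Let hB1 i := brownian_coord hB i.

Lemma measurable_brownian (t : R) : 0 <= t -> measurable_fun setT (B t).
Proof.
by move=> t0; apply: measurable_mxP => i j; rewrite ord1; exact: (brownian1_meas (hB1 i)).
Qed.

Lemma brownian_coords_event (E : 'I_d -> set Omega) :
  (forall i, sigma_of [set t : R | 0 <= t] (fun t w => B t w i ord0) (E i)) ->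
  P (\bigcap_i E i) = (\prod_i P (E i))%E.
Proof. by move=> hE; exact: (independent_family_all (brownian_indep hB) hE). Qed.

Let sub_event (i : 'I_d) (s t : R) (A : set R) : 0 <= s -> 0 <= t -> measurable A ->
  sigma_of [set t : R | 0 <= t] (fun t w => B t w i ord0)
    [set w | A (B t w i ord0 - B s w i ord0)].
Proof.
move=> s0 t0 mA.
have ms := @measurable_sigma_of R _ Omega R [set t : R | 0 <= t] (fun t w => B t w i ord0) s s0.
have mt := @measurable_sigma_of R _ Omega R [set t : R | 0 <= t] (fun t w => B t w i ord0) t t0.
by have := measurable_funB mt ms measurableT mA; rewrite setTI.
Qed.

Lemma brownian_inc_box (s r : R) (A : 'I_d -> set R) : 0 <= s -> 0 <= r ->
  (forall i, measurable (A i)) ->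
  P [set w | forall i, A i ((B (s + r) w - B s w) i ord0)] =
  (\prod_i gauss_law r (A i))%E.
Proof.
move=> s0 r0 mA.
pose E i := [set w | A i (B (s + r) w i ord0 - B s w i ord0)].
have sr0 : 0 <= s + r by exact: addr_ge0.
have hE i : sigma_of [set t : R | 0 <= t] (fun t w => B t w i ord0) (E i).
  exact: (sub_event s0 sr0 (mA i)).
have -> : [set w | forall i, A i ((B (s + r) w - B s w) i ord0)] = \bigcap_i E i.
  apply/seteqP; split => [w h i _|w h i].
    by have := h i; rewrite /E /= mxE mxE.
  by have := h i I; rewrite /E /= mxE mxE.
rewrite (brownian_coords_event hE).
by apply: eq_bigr => i _; exact: (brownian1_inc_law (hB1 i) s0 r0 (mA i)).
Qed.

Lemma brownian_val_box (r : R) (A : 'I_d -> set R) : 0 <= r ->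
  (forall i, measurable (A i)) ->
  P [set w | forall i, A i (B r w i ord0)] = (\prod_i gauss_law r (A i))%E.
Proof.
move=> r0 mA.
rewrite (_ : [set w | _] = \bigcap_i [set w | A i (B r w i ord0)]); last first.
  by apply/seteqP; split => [w h i _|w h i]; [exact: h|exact: h i I].
rewrite brownian_coords_event.
  by apply: eq_bigr => i _; rewrite -(brownian1_val_law (hB1 i) r0 (mA i)).
by move=> i; exact: (sigma_of_preimage (Y := fun t w => B t w i ord0)).
Qed.

(** The first increment starts from [B 0] because [B 0] vanishes only almost
    surely. On boxes the probability is a product over the coordinates, each of
    which has independent increments. *)
Lemma brownian_incs_indep (s r : R) : 0 <= s -> 0 <= r ->
  forall A1 A2 : set 'cV[R]_d, measurable A1 -> measurable A2 ->
  P ((fun w => B s w - B 0 w) @^-1` A1 `&` (fun w => B (s + r) w - B s w) @^-1` A2) =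
  (P ((fun w => B s w - B 0 w)%R @^-1` A1) *
   P ((fun w => B (s + r) w - B s w)%R @^-1` A2))%E.
Proof.
move=> s0 r0 A1 A2 mA1 mA2.
set Z1 := fun w => B s w - B 0 w; set Z2 := fun w => B (s + r) w - B s w.
have sr0 : 0 <= s + r by exact: addr_ge0.
have mZ1 : measurable_fun setT Z1.
  by apply: measurable_mxP => i j; under eq_fun do rewrite !mxE; rewrite ord1;
     apply: measurable_funB; exact: (brownian1_meas (hB1 i)).
have mZ2 : measurable_fun setT Z2.
  by apply: measurable_mxP => i j; under eq_fun do rewrite !mxE; rewrite ord1;
     apply: measurable_funB; exact: (brownian1_meas (hB1 i)).
pose G (Z : Omega -> 'cV[R]_d) := preimage_set_system setT Z (@mx_boxes R d 1).
have GI Z : setI_closed (G Z).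
  move=> _ _ [_ [a ma <-] <-] [_ [b mb <-] <-].
  exists [set x : 'cV[R]_d | forall i j, (a i j `&` b i j) (x i j)].
    by exists (fun i j => a i j `&` b i j) => // i j; exact: measurableI.
  rewrite !setTI; apply/seteqP; split => [w h|w [h1 h2] i j].
    by split => i j; have [] := h i j.
  by split; [exact: h1|exact: h2].
have Gm Z : measurable_fun setT Z -> G Z `<=` measurable.
  move=> mZ _ [_ [a ma <-] <-]; apply: mZ => //.
  by apply: sub_sigma_algebra; exists a.
have sG Z A : measurable A -> <<s G Z >> (Z @^-1` A).
  move=> mA; rewrite g_sigma_preimageE; exists A => //.
  by rewrite setTI.
suff H : independent2 P <<s G Z1 >> <<s G Z2 >> by apply: H; exact: sG.
apply: independent2_pi; [exact: GI|exact: GI|exact: Gm|exact: Gm|].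
move=> _ _ [_ [a ma <-] <-] [_ [b mb <-] <-]; rewrite !setTI.
have boxE (Z : Omega -> 'cV[R]_d) (c : 'I_d -> 'I_1 -> set R) :
    Z @^-1` [set x | forall i j, c i j (x i j)] = [set w | forall i, c i ord0 (Z w i ord0)].
  by apply/seteqP; split => [w h i|w h i j]; [exact: h|rewrite ord1; exact: h].
rewrite !boxE.
have -> : P [set w | forall i, a i ord0 (Z1 w i ord0)] = (\prod_i gauss_law s (a i ord0))%E.
  by have := brownian_inc_box (lexx 0) s0 (fun i => ma i ord0); rewrite add0r.
rewrite (brownian_inc_box s0 r0 (fun i => mb i ord0)) -big_split /=.
pose E i := [set w | a i ord0 (B s w i ord0 - B 0 w i ord0)] `&`
  [set w | b i ord0 (B (s + r) w i ord0 - B s w i ord0)].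
rewrite (_ : _ `&` _ = \bigcap_i E i).
  rewrite brownian_coords_event.
    by apply: eq_bigr => i _; exact: (brownian1_incs_indep (hB1 i) s0 r0 (ma i ord0) (mb i ord0)).
  move=> i; have sI : setI_closed (sigma_of [set t : R | 0 <= t] (fun t w => B t w i ord0)).
    by apply: sigma_algebra_setI; exact: smallest_sigma_algebra.
  by apply: sI; apply: sub_event.
apply/seteqP; split => [w [h1 h2] i _|w h].
  by split => /=; [have := h1 i|have := h2 i]; rewrite !mxE.
by split => i; have [h1 h2] := h i I; rewrite !mxE.
Qed.

Lemma brownian_coord_L2 r i : 0 <= r -> L2 P (fun w => B r w i ord0).
Proof. exact: brownian1_L2 (hB1 i) _. Qed.

Lemma brownian_coord_mean r i : 0 <= r -> \int[P]_w (B r w i ord0) = 0.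
Proof. exact: brownian1_mean (hB1 i) _. Qed.

Lemma brownian_cov r i j : 0 <= r ->
  \int[P]_w (B r w i ord0 * B r w j ord0) = (i == j)%:R * r.
Proof.
move=> r0; have [<-|ij] := eqVneq i j.
  rewrite mul1r; under eq_Rintegral do rewrite -expr2.
  by rewrite /Rintegral (brownian1_moment2 (hB1 i) r0).
rewrite mul0r mean_mul_indep ?brownian_coord_mean ?mul0r//.
- exact: brownian_coord_L2.
- exact: brownian_coord_L2.
move=> A1 A2 mA1 mA2.
pose S (i : 'I_d) := sigma_of [set t : R | 0 <= t] (fun t w => B t w i ord0).
have sS k : [set: 'I_d] k -> sigma_algebra setT (S k).
  by move=> _; exact: smallest_sigma_algebra.
have mS k : [set: 'I_d] k -> S k `<=` measurable.
  by move=> _; apply: sub_sigma_of => t t0; exact: (brownian1_meas (hB1 k)).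
have d12 : [set i] `&` [set j] = set0.
  by apply/seteqP; split => // k [/= -> ij']; rewrite ij' eqxx in ij.
apply: (indep_groups sS mS (brownian_indep hB) (@subsetT _ _) (@subsetT _ _) d12).
  by apply: sub_sigma_algebra; exists i => //; exact: (sigma_of_preimage (Y := fun t w => B t w i ord0)).
by apply: sub_sigma_algebra; exists j => //; exact: (sigma_of_preimage (Y := fun t w => B t w j ord0)).
Qed.

(** Joint measurability in the time and in the randomness; the map [i] allows
    the randomness to be read over a finer sigma-algebra than that of [Omega]. *)
Lemma measurable_brownian_path (dE : measure_display) (E : measurableType dE)
   (i : E -> Omega) : measurable_fun setT i ->
  measurable_fun setT (fun z : R * E => B (Num.max z.1 0) (i z.2)).
Proof.
move=> mi; apply: measurable_mxP => k j; rewrite ord1.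
apply: (measurable_path (B := fun t w => B t (i w) k ord0)).
  by move=> t t0; apply: (measurableT_comp (brownian1_meas (hB1 k) t0) mi).
by move=> w; exact: (brownian1_cont (hB1 k)).
Qed.

End brownian_facts.

Section heat.
Context {R : realType} {d : nat}.
Local Open Scope ereal_scope.

Lemma brownian_law_eq {dO dO' : measure_display} {Omega : measurableType dO}
    {Omega' : measurableType dO'} (P : probability Omega R)
    (P' : probability Omega' R) W B (t : R) (v : 'cV[R]_d -> \bar R) :
  brownian P W -> brownian P' B -> (0 <= t)%R ->
  measurable_fun setT v -> (forall x, 0 <= v x) ->
  \int[P]_w v (W t w) = \int[P']_w v (B t w).
Proof.
move=> hW hB t0 mv v0; apply: mx_law_eq => //.
- exact: measurable_brownian hW _ t0.
- exact: measurable_brownian hB _ t0.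
- by move=> A mA; rewrite (brownian_val_box hW)// (brownian_val_box hB).
Qed.

(** The increments over [[0, s]] and [[s, s + r]] are independent, and the
    second one has the law of [B r]. *)
Lemma brownian_semigroup {dO : measure_display} {Omega : measurableType dO}
    (P : probability Omega R) B (s r : R) (v : 'cV[R]_d -> \bar R) :
  brownian P B -> (0 <= s)%R -> (0 <= r)%R ->
  measurable_fun setT v -> (forall x, 0 <= v x) ->
  \int[P]_w v (B (s + r) w)%R = \int[P]_w1 \int[P]_w2 v (B s w1 + B r w2)%R.
Proof.
move=> hB s0 r0 mv v0.
have sr0 : (0 <= s + r)%R by exact: addr_ge0.
have mB t : (0 <= t)%R -> measurable_fun setT (B t) by exact: (measurable_brownian hB).
have mI a b : (0 <= a)%R -> (0 <= b)%R -> measurable_fun setT (fun w => B a w - B b w)%R.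
  move=> a0 b0; apply: measurable_mxP => i j; under eq_fun do rewrite !mxE.
  by apply: measurable_funB; apply: measurable_mx_entry; exact: mB.
have incE a b : (0 <= a)%R -> (0 <= b)%R -> forall v : 'cV[R]_d -> \bar R,
    measurable_fun setT v -> (forall x, 0 <= v x) ->
    \int[P]_w v (B (a + b) w - B a w)%R = \int[P]_w v (B b w).
  move=> a0 b0; apply: mx_law_eq => //; [exact/mI/a0/addr_ge0|exact: mB|].
  by move=> A mA; rewrite (brownian_inc_box hB)// (brownian_val_box hB).
pose F (z : 'cV[R]_d) := \int[P]_w v (z + B r w)%R.
have mvz : measurable_fun setT (fun z : 'cV[R]_d * Omega => v (z.1 + B r z.2)%R).
  apply: (measurableT_comp mv); apply: measurable_addmx => //.
  exact: (measurableT_comp (mB r r0) measurable_snd).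
have mF : measurable_fun setT F.
  exact: (@measurable_fun_fubini_tonelli_F _ _ _ _ _ P _ mvz).
have F0 z : 0 <= F z by exact: integral_ge0.
transitivity (\int[P]_w v (B (0 + (s + r)) w - B 0 w)%R); first by rewrite incE.
transitivity (\int[P]_w v ((B s w - B 0 w) + (B (s + r) w - B s w))%R).
  by apply: eq_integral => w _; rewrite add0r; congr v; rewrite [RHS]addrC addrA subrK.
pose h (z : 'cV[R]_d * 'cV[R]_d) := v (z.1 + z.2)%R.
have mh : measurable_fun setT h.
  by apply: (measurableT_comp mv); exact: measurable_addmx.
have h0 z : 0 <= h z by exact: v0.
have -> := indep_integral (mI _ _ s0 (lexx 0%R)) (mI _ _ sr0 s0) (brownian_incs_indep hB s0 r0) mh h0.
transitivity (\int[P]_w F (B s w - B 0 w)%R).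
  apply: eq_integral => w _; rewrite /h /=.
  apply: (incE s r s0 r0 (fun x => v (B s w - B 0 w + x)%R)) => //.
  by apply: (measurableT_comp mv); exact: measurable_addmx.
by have := incE 0%R s (lexx 0%R) s0 F mF F0; rewrite add0r => ->.
Qed.

End heat.

(** * Taylor expansion on the slab *)

Section mx_norm_facts.
Context {R : realType} {m n : nat}.
Implicit Types x : 'M[R]_(m, n).

Lemma le_mx_norm_entry x i j : `|x i j| <= `|x|.
Proof.
rewrite [leRHS]/Num.norm /= mx_normrE.
by apply/bigmax_geP; right => /=; exists (i, j).
Qed.

Lemma mx_norm_le x (r : R) : 0 <= r -> (forall i j, `|x i j| <= r) -> `|x| <= r.
Proof.
move=> r0 h; rewrite [leLHS]/Num.norm /= mx_normrE.
by apply: bigmax_le => // -[i j] _; exact: h.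
Qed.

End mx_norm_facts.

Section line_derivatives.
Context {R : realType} {d : nat}.
Implicit Types (f : 'cV[R]_d -> R) (x z : 'cV[R]_d).
Local Notation e_ := (@bvec R d).

Lemma is_derive_line f x z (r : R) :
  derivable f (r *: z + x) z ->
  is_derive r 1 (fun h : R => f (h *: z + x)) ('D_z f (r *: z + x)).
Proof.
rewrite /derivable => df.
have e : (fun h : R => h^-1 *: (((fun h : R => f (h *: z + x)) \o shift r) (h *: (1 : R)) - f (r *: z + x))) =
   (fun h : R => h^-1 *: ((f \o shift (r *: z + x)) (h *: z) - f (r *: z + x))).
  apply/funext => h /=; congr (_ *: (f _ - _)).
  by rewrite [h *: 1]mulr1 scalerDl addrA.
apply: DeriveDef; first by rewrite /derivable e.
by rewrite /derive e.
Qed.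

Lemma derive1_continuous (g dg : R -> R) :
  (forall r : R, is_derive r (1 : R) g (dg r)) -> continuous g.
Proof.
move=> h r; apply: differentiable_continuous; apply/derivable1_diffP.
by have [] := h r.
Qed.

Lemma mvt_coord f y k (s : R) :
  (forall x, derivable f x (e_ k)) ->
  exists2 c, `|c| <= `|s| & f (s *: e_ k + y) - f y = s * 'D_(e_ k) f (c *: e_ k + y).
Proof.
move=> df.
have h r := @is_derive_line f y (e_ k) r (df _).
have ch := derive1_continuous h.
have [s0|s0] := leP 0 s.
  have [c cI E] := @MVT_segment _ _ _ 0 s s0 (fun r _ => h r) (continuous_subspaceT (fun r => ch r)).
  exists c; last by move: E; rewrite scale0r add0r subr0 mulrC.
  by move: cI; rewrite in_itv /= => /andP[c0 cs]; rewrite !ger0_norm.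
have [c cI E] := @MVT_segment _ _ _ s 0 (ltW s0) (fun r _ => h r) (continuous_subspaceT (fun r => ch r)).
exists c.
  move: cI; rewrite in_itv /= => /andP[c0 cs]; rewrite !ler0_norm ?lerN2//.
  exact: ltW.
move: E; rewrite scale0r add0r sub0r => E.
by rewrite -opprB E; ring.
Qed.

(** The increment is split along the coordinate axes. On each edge the mean
    value theorem applies, at a point where the partial derivative is close to
    its value at [x]. *)
Lemma frechet f x :
  (forall i y, derivable f y (e_ i)) ->
  (forall i, {for x, continuous (fun y => 'D_(e_ i) f y)}) ->
  forall e, 0 < e -> exists2 dl, 0 < dl & forall z, `|z| < dl ->
    `|f (z + x) - f x - \sum_i z i ord0 * 'D_(e_ i) f x| <= e * \sum_i `|z i ord0|.
Proof.
move=> df cf e e0.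
have : \forall y \near x, forall i, `|'D_(e_ i) f x - 'D_(e_ i) f y| < e.
  have hh i : \forall y \near x, `|'D_(e_ i) f x - 'D_(e_ i) f y| < e.
    by have /cvgrPdist_lt := cf i; exact.
  exact: filter_forall hh.
move=> /nbhs_ballP[dl /= dl0 h]; exists dl => // z zdl.
pose p (k : nat) : 'cV[R]_d := \col_i ((i < k)%:R * z i ord0) + x.
have pS (k : 'I_d) : p k.+1 = z k ord0 *: e_ k + p k.
  rewrite /p addrA; congr (_ + x); apply/colP => i; rewrite !mxE eqxx andbT ltnS leq_eqVlt.
  have [->|ik] := eqVneq i k; first by rewrite eqxx ltnn /= mul1r mulr1 mul0r addr0.
  by rewrite (negbTE (_ : val i != val k))//= mulr0 add0r.
have p0 : p 0%N = x.
  by rewrite /p (_ : \col_i _ = 0) ?add0r//; apply/colP => i; rewrite !mxE mul0r.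
have pd : p d = z + x.
  by rewrite /p; congr (_ + _); apply/colP => i; rewrite !mxE ltn_ord mul1r.
have -> : f (z + x) - f x = \sum_(k < d) (f (p k.+1) - f (p k)).
  by rewrite -pd -[X in _ - f X]p0 -(telescope_sumr (fun k => f (p k)) (leq0n d)) big_mkord.
rewrite -sumrB mulr_sumr; apply: le_trans (ler_norm_sum _ _ _) _.
apply: ler_sum => k _.
rewrite pS; have [c cz ->] := mvt_coord (p k) (z k ord0) (df k).
rewrite -mulrBr normrM mulrC ler_wpM2r// -normrN opprB ltW//; apply: h.
rewrite -ball_normE /=; apply: le_lt_trans zdl.
rewrite /p addrA opprD addrCA subrr addr0 normrN.
apply: mx_norm_le => // i j; rewrite (ord1 j) /bvec !mxE eqxx andbT.
have [->|ik] := eqVneq i k.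
  rewrite ltnn mul0r addr0 mulr1; apply: (le_trans cz).
  exact: le_mx_norm_entry.
rewrite mulr0 add0r normrM.
case: (i < k)%N; rewrite ?normr0 ?mul0r// normr1 mul1r; exact: le_mx_norm_entry.
Qed.

Lemma is_derive_dir f x z :
  (forall i y, derivable f y (e_ i)) ->
  (forall i, {for x, continuous (fun y => 'D_(e_ i) f y)}) ->
  is_derive x z f (\sum_i z i ord0 * 'D_(e_ i) f x).
Proof.
move=> df cf.
set l := \sum_i _.
have h : h^-1 *: ((f \o shift x) (h *: z) - f x) @[h --> 0^'] --> l.
  apply/cvgrPdist_le => e e0.
  pose S := 1 + \sum_i `|z i ord0|.
  have S0 : 0 < S by rewrite ltr_pwDl// sumr_ge0.
  have eS0 : 0 < e / S by rewrite divr_gt0.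
  have [dl dl0 H] := frechet df cf eS0.
  near=> h.
  have h0 : h != 0 by near: h; exact: nbhs_dnbhs_neq.
  have hz : `|h *: z| < dl.
    rewrite normrZ; apply: (@le_lt_trans _ _ (`|h| * (1 + `|z|))).
      by rewrite ler_wpM2l// lerDr.
    rewrite -ltr_pdivlMr ?ltr_pwDl//.
    near: h; apply: dnbhs0_lt; rewrite divr_gt0// ltr_pwDl//.
  have := H _ hz.
  have -> : \sum_i (h *: z) i ord0 * 'D_(e_ i) f x = h * l.
    by rewrite /l mulr_sumr; apply: eq_bigr => i _; rewrite mxE mulrA.
  have -> : \sum_i `|(h *: z) i ord0| = `|h| * \sum_i `|z i ord0|.
    by rewrite mulr_sumr; apply: eq_bigr => i _; rewrite mxE normrM.
  move=> {}H; rewrite /= /shift -normrN opprB.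
  have -> : h^-1 *: (f (h *: z + x) - f x) - l = h^-1 * (f (h *: z + x) - f x - h * l).
    by rewrite [_ *: _]/(_ * _) [RHS]mulrBr mulrA mulVf// mul1r.
  rewrite normrM normfV -ler_pdivlMl ?invr_gt0 ?normr_gt0// invrK.
  apply: (le_trans H); rewrite mulrCA ler_wpM2l// -mulrA ger_pMr// mulrC.
  by rewrite ler_pdivrMr// mul1r /S lerDr.
apply: DeriveDef; first by apply/cvg_ex; exists l.
exact: (cvg_lim _ h).
Unshelve. all: by end_near. Qed.

Lemma mvt_bound (g dg : R -> R) (C : R) :
  (forall r : R, is_derive r (1 : R) g (dg r)) ->
  (forall r, 0 <= r <= 1 -> `|dg r| <= C) ->
  forall r, 0 <= r <= 1 -> `|g r - g 0| <= C.
Proof.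
move=> hg hC r /andP[r0 r1].
have cg := derive1_continuous hg.
have [c cI ->] := @MVT_segment _ _ _ 0 r r0 (fun s _ => hg s) (continuous_subspaceT (fun s => cg s)).
move: cI; rewrite in_itv /= => /andP[c0 cr].
rewrite subr0 normrM (ger0_norm r0).
have c1 : 0 <= c <= 1 by rewrite c0 (le_trans cr).
by apply: le_trans (hC c c1); rewrite ler_piMr.
Qed.

(** On the segment from [x] to [z + x], [chi] is the error of the expansion with
    the quadratic term at [x], and [psi] is its derivative. The bound on the
    second derivatives passes to [psi], then to [chi]. *)
Lemma taylor2 f x z (E : R) :
  (forall i y, derivable f y (e_ i)) ->
  (forall i, continuous (fun y => 'D_(e_ i) f y)) ->
  (forall i j y, derivable ('D_(e_ i) f) y (e_ j)) ->
  (forall i j, continuous (fun y => 'D_(e_ j) ('D_(e_ i) f) y)) ->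
  (forall r, 0 <= r <= 1 -> forall i j,
    `|'D_(e_ j) ('D_(e_ i) f) (r *: z + x) - 'D_(e_ j) ('D_(e_ i) f) x| <= E) ->
  `|f (z + x) - f x - \sum_i z i ord0 * 'D_(e_ i) f x
    - 2^-1 * \sum_i \sum_j z i ord0 * (z j ord0 * 'D_(e_ j) ('D_(e_ i) f) x)|
  <= E * (\sum_i `|z i ord0|) ^+ 2.
Proof.
move=> df cf ddf cdf hE.
set a := \sum_i _ * _; set b := \sum_i \sum_j _.
pose D2 y := \sum_i z i ord0 * \sum_j z j ord0 * 'D_(e_ j) ('D_(e_ i) f) y.
have phi1 r : is_derive r (1 : R) (fun h : R => f (h *: z + x))
   (\sum_i z i ord0 * 'D_(e_ i) f (r *: z + x)).
  have [d1 <-] := is_derive_dir (x := r *: z + x) z df (fun i => cf i _).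
  exact: is_derive_line.
have phi2 r : is_derive r (1 : R) (fun h : R => \sum_i z i ord0 * 'D_(e_ i) f (h *: z + x))
   (D2 (r *: z + x)).
  rewrite [X in is_derive _ _ X _](_ : _ =
    \sum_i (fun h : R => z i ord0 * 'D_(e_ i) f (h *: z + x))); last first.
    by apply/funext => h; rewrite fct_sumE.
  apply: is_derive_sum => i.
  apply: is_deriveZ.
  have [d1 <-] := is_derive_dir (x := r *: z + x) z (ddf i) (fun j => cdf i j _).
  exact: is_derive_line.
have bE : b = D2 x by rewrite /b /D2; apply: eq_bigr => i _; rewrite mulr_sumr.
set S := \sum_i `|z i ord0|.
have D2E r : 0 <= r <= 1 -> `|D2 (r *: z + x) - b| <= E * S ^+ 2.
  move=> r01; rewrite bE /D2 -sumrB.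
  have -> : E * S ^+ 2 = \sum_i \sum_j `|z i ord0| * (`|z j ord0| * E).
    apply/esym; under eq_bigr => i _ do rewrite -mulr_sumr -mulr_suml -/S.
    by rewrite -mulr_suml -/S; ring.
  apply: le_trans (ler_norm_sum _ _ _) _; apply: ler_sum => i _.
  rewrite -mulrBr normrM -mulr_sumr ler_wpM2l// -sumrB.
  apply: le_trans (ler_norm_sum _ _ _) _; apply: ler_sum => j _.
  by rewrite -mulrBr normrM ler_wpM2l//; exact: hE.
pose psi (r : R) := \sum_i z i ord0 * 'D_(e_ i) f (r *: z + x) - a - b * r.
have dpsi r : is_derive r (1 : R) psi (D2 (r *: z + x) - b).
  rewrite /psi; have h2 := phi2 r.
  by apply: is_derive_eq; rewrite /GRing.scale /=; ring.
have psi0 : psi 0 = 0.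
  by rewrite /psi mulr0 subr0 scale0r add0r subrr.
have psiE r : 0 <= r <= 1 -> `|psi r| <= E * S ^+ 2.
  by move=> r01; have := mvt_bound dpsi D2E r01; rewrite psi0 subr0.
pose chi (r : R) := f (r *: z + x) - a * r - 2^-1 * b * r ^+ 2.
have dchi r : is_derive r (1 : R) chi (psi r).
  rewrite /chi; have h1 := phi1 r.
  by apply: is_derive_eq; rewrite /GRing.scale /= /psi; field.
have i1 : 0 <= (1 : R) <= 1 by rewrite ler01 lexx.
have := mvt_bound dchi psiE i1.
rewrite /chi scale1r scale0r add0r; apply: le_trans; rewrite le_eqVlt; apply/orP; left.
by apply/eqP; congr `| _ |; ring.
Qed.

End line_derivatives.

Section compact_slab.
Context {R : realType} {d : nat}.

Definition cyl (T r : R) : set (R * 'cV[R]_d) := [set z | 0 <= z.1 <= T /\ `|z.2| <= r].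

Lemma compact_cyl T r : compact (cyl T r).
Proof.
pose C := [set v : 'rV[R]_d | forall i, v ord0 i \in `[- r, r]].
have cC : compact C.
  apply: (@rV_compact R d (fun=> `[- r, r]%classic)).
  by move=> _; exact: segment_compact.
have ctr : continuous (fun v : 'rV[R]_d => v^T).
  move=> v A /nbhs_ballP[e /= e0 eA]; apply/nbhs_ballP; exists e => // w [_ vw].
  by apply: eA; split => // a b; rewrite !mxE; exact: vw.
have cD : compact ((fun v : 'rV[R]_d => v^T) @` C).
  by apply: continuous_compact => //; apply: continuous_subspaceT.
have [r0|r0] := leP 0 r; last first.
  rewrite (_ : cyl T r = set0); first exact: compact0.
  by apply/seteqP; split => // z [_ h]; have := le_lt_trans h r0; rewrite ltNge normr_ge0.
have -> : cyl T r = `[0, T] `*` ((fun v : 'rV[R]_d => v^T) @` C).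
  apply/seteqP; split => [[t x] [/= tT xr]|[t x] [/= tT [v vC <-]]].
    split => /=; first by rewrite in_itv.
    exists (x^T); last by rewrite trmxK.
    move=> i; rewrite mxE in_itv /= -ler_norml; apply: le_trans xr.
    exact: le_mx_norm_entry.
  split; first by move: tT; rewrite in_itv.
  apply: mx_norm_le => // i j; rewrite ord1 mxE ler_norml.
  by have := vC i; rewrite in_itv.
by apply: compact_setX => //; exact: segment_compact.
Qed.

(** Only one of the two points is confined to the compact cylinder, since a
    displaced point may leave it. *)
Lemma unif_continuous_cyl T (F : R * 'cV[R]_d -> R) r :
  {within slab T, continuous F} -> forall e, 0 < e ->
  exists2 eta, 0 < eta & forall z z', cyl T r z -> slab T z' ->
    ball z eta z' -> `|F z - F z'| < e.
Proof.
move=> cF e e0.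
have /compact_near_coveringP cK := @compact_cyl T r.
pose Q (eta : R) (z : R * 'cV[R]_d) := slab T z -> forall z', slab T z' ->
    ball z eta z' -> `|F z - F z'| < e.
have H : \forall eta \near (0 : R)^'+, cyl T r `<=` Q eta.
  apply: (cK R (0^'+) Q).
  move=> z0 [z0T z0r].
  have e20 : 0 < e / 2 by rewrite divr_gt0.
  have [dl dl0 h] := within_continuous_dist cF (z0T : slab T z0) e20.
  exists (ball z0 (dl / 2), [set eta | eta < dl / 2]).
    split => /=; first by apply: nbhsx_ballx; rewrite divr_gt0.
    by apply: nbhs_right_lt; rewrite divr_gt0.
  move=> [z eta] /= [z0z etadl] zT z' z'T zz'.
  have h1 : `|F z0 - F z| < e / 2.
    apply: h => //; apply: le_ball z0z; lra.
  have h2 : `|F z0 - F z'| < e / 2.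
    apply: h => //; rewrite (splitr dl); apply: ball_triangle z0z _.
    by apply: le_ball zz'; exact: ltW.
  rewrite (_ : F z - F z' = (F z0 - F z') - (F z0 - F z)); last by ring.
  apply: le_lt_trans (ler_normB _ _) _; lra.
near (0 : R)^'+ => eta.
exists eta => // z z' zr z'T zz'.
have Hz : cyl T r `<=` Q eta by near: eta.
by apply: (Hz z zr) => //; case: zr.
Unshelve. all: by end_near. Qed.

Lemma bounded_cyl T (F : R * 'cV[R]_d -> R) r :
  {within slab T, continuous F} ->
  exists2 M, 0 < M & forall z, cyl T r z -> `|F z| <= M.
Proof.
move=> cF.
have /compact_near_coveringP cK := @compact_cyl T r.
pose Q (M : R) (z : R * 'cV[R]_d) := slab T z -> `|F z| <= M.
have H : \forall M \near +oo, cyl T r `<=` Q M.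
  apply: (cK R (pinfty_nbhs R) Q).
  move=> z0 [z0T z0r].
  have [dl dl0 h] := within_continuous_dist cF (z0T : slab T z0) ltr01.
  exists (ball z0 dl, [set M | `|F z0| + 1 <= M]).
    split => /=; first exact: nbhsx_ballx.
    by apply: nbhs_pinfty_ge; rewrite num_real.
  move=> [z M] /= [z0z FM] zT.
  have h1 := h _ zT z0z; apply: le_trans FM.
  rewrite -[F z](subKr (F z0)); apply: le_trans (ler_normB _ _) _.
  by rewrite lerD2l ltW.
near (pinfty_nbhs R) => M.
exists M => // z zr.
have Hz : cyl T r `<=` Q M by near: M.
by apply: (Hz z zr) => //; case: zr.
Unshelve. all: by end_near. Qed.

End compact_slab.

Section taylor_C12.
Context {R : realType} {d : nat}.
Variables (T : R) (u : R -> 'cV[R]_d -> R).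
Hypotheses (hu : C12 T u) (hgrowth : quadratic_growth T u).
Local Notation e_ := (@bvec R d).

Let slice_continuous (F : R -> 'cV[R]_d -> R) t :
  {within slab T, continuous (fun z => F z.1 z.2)} -> 0 <= t <= T -> continuous (F t).
Proof.
move=> cF tT x A /nbhs_ballP[e /= e0 eA].
have [dl dl0 h] := within_continuous_dist cF (tT : slab T (t, x)) e0.
apply/nbhs_ballP; exists dl => // y xy; apply: eA.
by apply: (h (t, y)) => //; split => //; exact: ballxx.
Qed.

Lemma C12_is_derive_t x t : 0 < t < T -> is_derive t (1 : R) (u ^~ x) (dt T u t x).
Proof.
move=> /andP[t0 tT].
have tT' : 0 <= t <= T by rewrite !ltW.
have h : dt_quot T u t x = (fun h : R => h^-1 * (u (t + h) x - u t x)) @ 0^'.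
  rewrite /dt_quot; congr (_ @ _); apply/seteqP; split => A /=; last first.
    by apply: filterS => y Ay _.
  rewrite /within /= => hA.
  have : \forall h \near 0^', 0 <= t + h <= T.
    near=> h0; have : `|h0| < Num.min t (T - t).
      by near: h0; apply: dnbhs0_lt; rewrite lt_min t0 subr_gt0.
    by rewrite lt_min !ltr_norml => /andP[/andP[a1 a2] /andP[a3 a4]]; lra.
  by move: hA; apply: filterS2 => y; apply.
have e : (fun h : R => h^-1 *: ((u^~ x \o shift t) (h *: (1 : R)) - u t x)) =
   (fun h : R => h^-1 * (u (t + h) x - u t x)).
  by apply/funext => k /=; rewrite [k *: 1]mulr1 (addrC k).
have ex : cvg (dt_quot T u t x) by apply: (C12_dt_ex hu).
apply: DeriveDef; rewrite /derivable /derive e; first by move: ex; rewrite h.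
by rewrite /dt h.
Unshelve. all: by end_near. Qed.

Lemma C12_time_mvt x t dl : 0 <= t -> 0 < dl -> t + dl <= T ->
  exists2 s, t <= s <= t + dl & u (t + dl) x - u t x = dl * dt T u s x.
Proof.
move=> t0 dl0 tT.
have [|||c cI E] := @MVT_segment _ (u ^~ x) (fun s => dt T u s x) t (t + dl).
- by rewrite lerDl ltW.
- move=> s; rewrite in_itv /= => /andP[ts st]; apply: C12_is_derive_t.
  by rewrite (le_lt_trans t0 ts) (lt_le_trans st tT).
- apply/subspace_continuousP => s sI A /nbhs_ballP[e /= e0 eA].
  move: sI; rewrite /= in_itv /= => /andP[ts st].
  have sT : slab T (s, x) by rewrite /slab /= (le_trans t0 ts) (le_trans st tT).
  have [eta eta0 h] := within_continuous_dist (C12_cont hu) sT e0.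
  apply/nbhs_ballP; exists eta => // s' ss' /=; rewrite in_itv /= => /andP[ts' st'].
  apply: eA; apply: (h (s', x)); last by split => //; exact: ballxx.
  by rewrite /slab /= (le_trans t0 ts') (le_trans st' tT).
exists c; first by move: cI; rewrite in_itv.
by rewrite E; ring.
Qed.

Let l1_le (z : 'cV[R]_d) : \sum_i `|z i ord0| <= d%:R * `|z|.
Proof.
rewrite mulrC mulr_natr; apply: (@le_trans _ _ (\sum_(i < d) `|z|)).
  by apply: ler_sum => i _; exact: le_mx_norm_entry.
by rewrite sumr_const card_ord.
Qed.

Definition taylor_poly t x dl (z : 'cV[R]_d) : R :=
  u t x + dl * dt T u t x + \sum_i z i ord0 * dx i u t x
  + 2^-1 * \sum_i \sum_j z i ord0 * (z j ord0 * dxx i j u t x).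

(** The mean value theorem in time is used at the displaced point, then the
    expansion in space at the original time; the moduli of continuity are
    uniform on the cylinder. *)
Lemma taylor_near (r e : R) : 0 < e -> exists2 eta, 0 < eta & forall t x dl z,
  0 <= t -> 0 < dl -> dl <= eta -> t + dl <= T -> `|x| <= r -> `|z| <= eta ->
  `|u (t + dl) (z + x) - taylor_poly t x dl z| <= e * (dl + `|z| ^+ 2).
Proof.
move=> e0.
pose D := (d%:R : R) ^+ 2 + 1.
have D0 : 0 < D by rewrite ltr_wpDl// sqr_ge0.
pose e' := e / D.
have e'0 : 0 < e' by rewrite divr_gt0.
have [eta1 eta10 h1] := unif_continuous_cyl r (C12_dt_cont hu) e'0.
have : forall ij : 'I_d * 'I_d, \forall eta \near (0 : R)^'+,
    forall z z', cyl T r z -> slab T z' ->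
    ball z eta z' -> `|dxx ij.1 ij.2 u z.1 z.2 - dxx ij.1 ij.2 u z'.1 z'.2| < e'.
  move=> [i j] /=.
  have [eta eta0 h] := unif_continuous_cyl r (@C12_dxx_cont _ _ _ _ hu i j) e'0.
  near=> eta' => z z' zr z'T zz'; apply: h => //; apply: le_ball zz'.
  by near: eta'; exact: nbhs_right_le.
move=> /filter_forall H.
have [eta2 eta20 h2] : exists2 eta : R, 0 < eta & forall ij : 'I_d * 'I_d,
    forall z z', cyl T r z -> slab T z' ->
    ball z eta z' -> `|dxx ij.1 ij.2 u z.1 z.2 - dxx ij.1 ij.2 u z'.1 z'.2| < e'.
  by near (0 : R)^'+ => eta; exists eta => //; near: eta.
pose eta := Num.min eta1 eta2 / 2.
have m0 : 0 < Num.min eta1 eta2 by rewrite lt_min eta10 eta20.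
have eta0 : 0 < eta by rewrite divr_gt0.
have etam : eta < Num.min eta1 eta2 by rewrite /eta; lra.
have [eta1' eta2'] : eta < eta1 /\ eta < eta2 by move: etam; rewrite lt_min => /andP[].
exists eta => // t x dl z t0 dl0 dleta tT xr zeta.
have tT0 : 0 <= t <= T by rewrite t0 /=; lra.
have cx : cyl T r (t, x) by split.
have time : `|u (t + dl) (z + x) - u t (z + x) - dl * dt T u t x| <= e' * dl.
  have [s /andP[ts st] ->] := C12_time_mvt (z + x) t0 dl0 tT.
  rewrite -mulrBr normrM (gtr0_norm dl0) mulrC ler_wpM2r ?(ltW dl0)//.
  rewrite -normrN opprB ltW//; apply: (h1 (t, x) (s, z + x)) => //.
    by rewrite /slab /=; lra.
  split => /=.
    by rewrite /ball /= ltr_norml; apply/andP; split; lra.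
  by rewrite -ball_normE /= opprD addrCA subrr addr0 normrN; lra.
have space : `|u t (z + x) - u t x - \sum_i z i ord0 * dx i u t x
    - 2^-1 * \sum_i \sum_j z i ord0 * (z j ord0 * dxx i j u t x)|
    <= e' * (\sum_i `|z i ord0|) ^+ 2.
  apply: taylor2.
  - by move=> i y; exact: (C12_dx_ex hu).
  - by move=> i; exact: (slice_continuous (@C12_dx_cont _ _ _ _ hu i) tT0).
  - by move=> i j y; exact: (C12_dxx_ex hu).
  - by move=> i j; exact: (slice_continuous (@C12_dxx_cont _ _ _ _ hu i j) tT0).
  move=> q /andP[q0 q1] i j; rewrite -normrN opprB ltW//.
  apply: (h2 (i, j) (t, x) (t, q *: z + x)) => //.
  split => /=; first exact: ballxx.
  rewrite -ball_normE /= opprD addrCA subrr addr0 normrN normrZ (ger0_norm q0).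
  by apply: le_lt_trans eta2'; apply: le_trans zeta; rewrite ler_piMl.
have -> : u (t + dl) (z + x) - taylor_poly t x dl z =
   (u (t + dl) (z + x) - u t (z + x) - dl * dt T u t x) +
   (u t (z + x) - u t x - \sum_i z i ord0 * dx i u t x
    - 2^-1 * \sum_i \sum_j z i ord0 * (z j ord0 * dxx i j u t x)).
  by rewrite /taylor_poly; ring.
apply: le_trans (ler_normD _ _) _; apply: le_trans (lerD time space) _.
have -> : e = e' * D by rewrite /e' divfK// gt_eqF.
have hl := l1_le z.
have S0 : 0 <= \sum_i `|z i ord0| by rewrite sumr_ge0.
rewrite -mulrDr -mulrA ler_pM2l//.
have zz : 0 <= `|z| ^+ 2 by exact: sqr_ge0.
have hs : (\sum_i `|z i ord0|) ^+ 2 <= d%:R ^+ 2 * `|z| ^+ 2.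
  by rewrite -exprMn lerXn2r// nnegrE mulr_ge0.
apply: le_trans (lerD (lexx dl) hs) _; rewrite /D.
have d0 : 0 <= (d%:R : R) ^+ 2 by exact: sqr_ge0.
by nra.
Unshelve. all: by end_near. Qed.

(** Everything grows at most quadratically in [z], and [`|z| ^+ 2] is at most a
    multiple of [`|z| ^+ 4] once [`|z|] is bounded below. *)
Lemma taylor_far (r eta : R) : 0 < eta -> exists2 C, 0 <= C & forall t x dl z,
  0 <= t -> 0 < dl -> t + dl <= T -> `|x| <= r -> eta <= `|z| ->
  `|u (t + dl) (z + x) - taylor_poly t x dl z| <= C * `|z| ^+ 4.
Proof.
move=> eta0.
have [M0 M00 h0] := bounded_cyl r (C12_cont hu).
have [M1 M10 h1] := bounded_cyl r (C12_dt_cont hu).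
have [M2 M2p h2] := fin_all_exists2 (fun i => bounded_cyl r (@C12_dx_cont _ _ _ _ hu i)).
have [M3 M3p h3] := fin_all_exists2 (fun ij : 'I_d * 'I_d =>
  bounded_cyl r (@C12_dxx_cont _ _ _ _ hu ij.1 ij.2)).
pose m2 := \sum_i M2 i; pose m3 := \sum_ij M3 ij.
have m20 : 0 <= m2 by apply: sumr_ge0 => i _; rewrite ltW.
have m30 : 0 <= m3 by apply: sumr_ge0 => i _; rewrite ltW.
have M2m i : M2 i <= m2.
  by rewrite /m2 (bigD1 i)//= lerDl sumr_ge0// => j _; rewrite ltW.
have M3m ij : M3 ij <= m3.
  by rewrite /m3 (bigD1 ij)//= lerDl sumr_ge0// => j _; rewrite ltW.
have [C hC] := hgrowth.
pose Cg := `|C|.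
pose D : R := d%:R.
have D0 : 0 <= D by rewrite /D.
pose A := Cg * (1 + 2 * r ^+ 2) + M0 + `|T| * M1 + D * m2.
pose B := 2 * Cg + D * m2 + D ^+ 2 * m3.
have A0 : 0 <= A.
  have a1 : 0 <= Cg * (1 + 2 * r ^+ 2).
    apply: mulr_ge0; first exact: normr_ge0.
    apply: addr_ge0; first exact: ler01.
    apply: mulr_ge0; first exact: ler0n. exact: sqr_ge0.
  have a2 : 0 <= `|T| * M1 by rewrite mulr_ge0// ltW.
  have a3 : 0 <= D * m2 by exact: mulr_ge0.
  by rewrite /A; have := ltW M00; lra.
have B0 : 0 <= B.
  have Cg0 : 0 <= Cg by exact: normr_ge0.
  have b1 : 0 <= D * m2 by exact: mulr_ge0.
  have b2 : 0 <= D ^+ 2 * m3 by apply: mulr_ge0 => //; exact: exprn_ge0.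
  by rewrite /B; lra.
exists (A / eta ^+ 4 + B / eta ^+ 2).
  by rewrite addr_ge0// divr_ge0// exprn_ge0// ltW.
move=> t x dl z t0 dl0 tT xr zeta.
have tT0 : 0 <= t <= T by rewrite t0 /=; lra.
have cx : cyl T r (t, x) by split.
have T0 : 0 <= T by lra.
have hl := l1_le z.
set S := \sum_i `|z i ord0| in hl.
have S0 : 0 <= S by rewrite sumr_ge0.
have r0 : 0 <= r by apply: le_trans xr.
set qz := `|z| ^+ 2.
have q0 : 0 <= qz by exact: sqr_ge0.
have zq : `|z| <= 1 + qz.
  by rewrite /qz; have := sqr_ge0 (`|z| - 1); have := normr_ge0 z; nra.
have b1 : `|u (t + dl) (z + x)| <= Cg * (1 + 2 * r ^+ 2) + 2 * Cg * qz.
  have tdT : 0 <= t + dl <= T by rewrite tT andbT; lra.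
  apply: (le_trans (hC _ (z + x) tdT)).
  have g1 : `|z + x| ^+ 2 <= 2 * qz + 2 * r ^+ 2.
    have n1 : `|z + x| <= `|z| + r by apply: (le_trans (ler_normD _ _)); rewrite lerD2l.
    have n2 : `|z + x| ^+ 2 <= (`|z| + r) ^+ 2.
      by rewrite lerXn2r// nnegrE// addr_ge0.
    apply: (le_trans n2); rewrite /qz; have := sqr_ge0 (`|z| - r); nra.
  apply: (@le_trans _ _ (Cg * (1 + `|z + x| ^+ 2))).
    by rewrite ler_wpM2r ?ler_norm// addr_ge0// sqr_ge0.
  apply: (@le_trans _ _ (Cg * (1 + (2 * qz + 2 * r ^+ 2)))).
    by rewrite ler_wpM2l ?normr_ge0// lerD2l.
  by rewrite le_eqVlt; apply/orP; left; apply/eqP; ring.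
have b2 : `|taylor_poly t x dl z| <= M0 + `|T| * M1 + D * m2 + D * m2 * qz + D ^+ 2 * m3 * qz.
  have c0 : `|u t x| <= M0 by exact: (h0 (t, x)).
  have c1 : `|dl * dt T u t x| <= `|T| * M1.
    rewrite normrM ler_pM//; last by exact: (h1 (t, x)).
    by rewrite !ger0_norm//; lra.
  have c2 : `|\sum_i z i ord0 * dx i u t x| <= D * m2 + D * m2 * qz.
    apply: (@le_trans _ _ (S * m2)).
      rewrite /S mulr_suml; apply: le_trans (ler_norm_sum _ _ _) _; apply: ler_sum => i _.
      rewrite normrM ler_wpM2l//; apply: (le_trans _ (M2m i)).
      exact: (h2 i (t, x) cx).
    have : S * m2 <= D * (1 + qz) * m2.
      by rewrite ler_wpM2r//; apply: (le_trans hl); rewrite ler_wpM2l.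
    by move/le_trans; apply; rewrite le_eqVlt; apply/orP; left; apply/eqP; ring.
  have c3 : `|\sum_i \sum_j z i ord0 * (z j ord0 * dxx i j u t x)| <= D ^+ 2 * m3 * qz.
    apply: (@le_trans _ _ (S * (S * m3))).
      rewrite /S mulr_suml; apply: le_trans (ler_norm_sum _ _ _) _; apply: ler_sum => i _.
      rewrite -mulr_sumr normrM ler_wpM2l//.
      rewrite -/S /S mulr_suml; apply: le_trans (ler_norm_sum _ _ _) _; apply: ler_sum => j _.
      rewrite normrM ler_wpM2l//; apply: (le_trans _ (M3m (i, j))).
      exact: (h3 (i, j) (t, x) cx).
    have SS : S * S <= D ^+ 2 * qz.
      by rewrite /qz -exprMn expr2 ler_pM.
    have : (S * S) * m3 <= (D ^+ 2 * qz) * m3 by rewrite ler_wpM2r.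
    by rewrite mulrA => /le_trans; apply; rewrite mulrAC.
  have c4 : `|2^-1 * \sum_i \sum_j z i ord0 * (z j ord0 * dxx i j u t x)| <= D ^+ 2 * m3 * qz.
    rewrite normrM ger0_norm; last by rewrite invr_ge0.
    by apply: le_trans c3; rewrite ler_piMl// invf_le1// ler1n.
  rewrite /taylor_poly.
  apply: (le_trans (ler_normD _ _)); rewrite lerD//.
  apply: (@le_trans _ _ (M0 + `|T| * M1 + (D * m2 + D * m2 * qz))); last by rewrite addrA.
  apply: (le_trans (ler_normD _ _)); rewrite lerD//.
  by apply: (le_trans (ler_normD _ _)); rewrite lerD.
apply: (@le_trans _ _ (A + B * qz)).
  apply: (le_trans (ler_normB _ _)); apply: (le_trans (lerD b1 b2)).
  by rewrite le_eqVlt; apply/orP; left; apply/eqP; rewrite /A /B; ring.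
have e20 : 0 < eta ^+ 2 by rewrite exprn_gt0.
have e40 : 0 < eta ^+ 4 by rewrite exprn_gt0.
have qe : eta ^+ 2 <= qz by rewrite /qz; apply: lerXn2r; rewrite ?nnegrE ?normr_ge0 ?(ltW eta0).
have -> : `|z| ^+ 4 = qz * qz by rewrite /qz -exprD.
have qq : eta ^+ 4 <= qz * qz.
  by rewrite (exprM eta 2 2) expr2; apply: ler_pM => //; exact: ltW.
have f1 : A <= A / eta ^+ 4 * (qz * qz) by rewrite mulrAC ler_pdivlMr//; exact: ler_wpM2l.
have f2 : B * qz <= B / eta ^+ 2 * (qz * qz).
  by rewrite mulrAC ler_pdivlMr// -mulrA; apply: ler_wpM2l => //; exact: ler_wpM2l.
by rewrite [leRHS]mulrDl; exact: (lerD f1 f2).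
Qed.

(** The mesh condition is only on [dl]; large increments [z] are paid by the
    quartic term, whose Gaussian expectation is of order [dl ^+ 2]. *)
Lemma taylor_global (r e : R) : 0 < e -> exists eta C, [/\ 0 < eta, 0 <= C &
  forall t x dl z, 0 <= t -> 0 < dl -> dl <= eta -> t + dl <= T -> `|x| <= r ->
  `|u (t + dl) (z + x) - taylor_poly t x dl z|
    <= e * (dl + `|z| ^+ 2) + C * `|z| ^+ 4].
Proof.
move=> e0; have [eta eta0 h1] := taylor_near r e0.
have [C C0 h2] := taylor_far r eta0.
exists eta, C; split => // t x dl z t0 dl0 dleta tT xr.
have [zeta|zeta] := leP `|z| eta.
  apply: (le_trans (h1 _ _ _ _ t0 dl0 dleta tT xr zeta)).
  by rewrite lerDl mulr_ge0// exprn_ge0.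
apply: (le_trans (h2 _ _ _ _ t0 dl0 tT xr (ltW zeta))).
by rewrite lerDr mulr_ge0 ?(ltW e0)// addr_ge0 ?(ltW dl0)// sqr_ge0.
Qed.

End taylor_C12.

(** * Heat semigroup and Duhamel integral *)

Lemma measurable_slice {d1 d2 d3} {T1 : measurableType d1} {T2 : measurableType d2}
    {T3 : measurableType d3} (k : T1 -> T2 -> T3) s :
  measurable_fun setT (fun z : T1 * T2 => k z.1 z.2) -> measurable_fun setT (k s).
Proof. by move=> mk; exact: (measurableT_comp mk (pair1_measurable s)). Qed.

Section heat_operator.
Context {R : realType} {d : nat} {dO : measure_display} {Omega : measurableType dO}.
Variable P : probability Omega R.
Variable B : R -> Omega -> 'cV[R]_d.
Hypothesis hB : brownian P B.
Local Open Scope ereal_scope.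
Implicit Types (f g : 'cV[R]_d -> \bar R) (t s r : R) (w : 'cV[R]_d).

(** The heat semigroup. Negative times are clipped to make it jointly measurable
    on all of [R]. *)
Definition heat t f w : \bar R := \int[P]_om f (w + B (Num.max t 0%R) om)%R.

Let max0 t : (0 <= Num.max t 0)%R. Proof. by rewrite le_max lexx orbT. Qed.
Let mB t : measurable_fun setT (B (Num.max t 0%R)).
Proof. exact: (measurable_brownian hB). Qed.

Let mBw t w f : measurable_fun setT f ->
  measurable_fun setT (fun om => f (w + B (Num.max t 0%R) om)%R).
Proof. by move=> mf; apply: (measurableT_comp mf); exact: measurable_addmx. Qed.

Lemma heat_ge0 t f w : (forall x, 0 <= f x) -> 0 <= heat t f w.
Proof. by move=> f0; exact: integral_ge0. Qed.

Lemma measurable_heat_gen (dE : measure_display) (E : measurableType dE)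
    (a : E -> R) (x : E -> 'cV[R]_d) (k : E -> 'cV[R]_d -> \bar R) :
  measurable_fun setT a -> measurable_fun setT x ->
  measurable_fun setT (fun z : E * 'cV[R]_d => k z.1 z.2) ->
  (forall e y, 0 <= k e y) ->
  measurable_fun setT (fun e => heat (a e) (k e) (x e)).
Proof.
move=> ma mx mk k0.
pose F (z : E * Omega) := k z.1 (x z.1 + B (Num.max (a z.1) 0%R) z.2)%R.
have mF : measurable_fun setT F.
  have mp : measurable_fun setT
      (fun z : E * Omega => (z.1, (x z.1 + B (Num.max (a z.1) 0%R) z.2)%R)).
    apply: measurable_fun_pair => //.
    apply: measurable_addmx; first exact: (measurableT_comp mx measurable_fst).
    have mpath := measurable_brownian_path hB (@measurable_id _ Omega setT).
    have mz : measurable_fun setT (fun z : E * Omega => (a z.1, z.2)).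
      by apply: measurable_fun_pair => //; exact: (measurableT_comp ma measurable_fst).
    exact: (measurableT_comp mpath mz).
  exact: (measurableT_comp mk mp).
have F0 z : 0 <= F z by exact: k0.
exact: (@measurable_fun_fubini_tonelli_F _ _ _ _ _ P F mF F0).
Qed.

Lemma measurable_heat t f : measurable_fun setT f -> (forall x, 0 <= f x) ->
  measurable_fun setT (heat t f).
Proof.
move=> mf f0.
apply: (@measurable_heat_gen _ _ (fun=> t) id (fun _ => f)) => //.
exact: measurableT_comp.
Qed.

Lemma heat_semigroup s r f w : (0 <= s)%R -> (0 <= r)%R ->
  measurable_fun setT f -> (forall x, 0 <= f x) ->
  heat s (heat r f) w = heat (s + r) f w.
Proof.
move=> s0 r0 mf f0; rewrite /heat !max_l ?addr_ge0//.
have mfw : measurable_fun setT (fun x => f (w + x)%R).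
  by apply: (measurableT_comp mf); exact: measurable_addmx.
have -> := brownian_semigroup (v := fun x => f (w + x)%R) hB s0 r0 mfw (fun x => f0 _).
by apply: eq_integral => om _; apply: eq_integral => om' _; rewrite addrA.
Qed.

Lemma heat0 f w : measurable_fun setT f -> (forall x, 0 <= f x) -> heat 0 f w = f w.
Proof.
move=> mf f0; rewrite /heat max_l//.
transitivity (\int[P]_om f w); last first.
  by rewrite integral_cst//= probability_setT mule1.
apply: ge0_ae_eq_integral => //.
  by have := @mBw 0%R w f mf; rewrite max_l.
have : forall i, {ae P, forall om, B 0%R om i ord0 = 0%R}.
  by move=> i; exact: (brownian1_start (brownian_coord hB i)).
move=> /(filter_forall (F := almost_everywhere P)); apply: filterS => om h _.
by congr f; rewrite (_ : B 0%R om = 0%R) ?addr0//; apply/colP => i; rewrite h mxE.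
Qed.

Lemma le_heat t f g w : measurable_fun setT f -> measurable_fun setT g ->
  (forall x, 0 <= f x) -> (forall x, f x <= g x) -> heat t f w <= heat t g w.
Proof.
move=> mf mg f0 fg; apply: ge0_le_integral => //; [exact: mBw|exact: mBw].
Qed.

Lemma heatD t f g w : measurable_fun setT f -> measurable_fun setT g ->
  (forall x, 0 <= f x) -> (forall x, 0 <= g x) ->
  heat t (fun x => f x + g x) w = heat t f w + heat t g w.
Proof.
move=> mf mg f0 fg; rewrite /heat ge0_integralD//; exact: mBw.
Qed.

Lemma heatZ t (k : R) f w : (0 <= k)%R -> measurable_fun setT f -> (forall x, 0 <= f x) ->
  heat t (fun x => k%:E * f x) w = k%:E * heat t f w.
Proof.
by move=> k0 mf f0; rewrite /heat ge0_integralZl//; exact: mBw.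
Qed.

Lemma heat_cst t (k : \bar R) w : heat t (fun=> k) w = k.
Proof. by rewrite /heat integral_cst//= probability_setT mule1. Qed.

Section duhamel.
Variables (T0 : R) (k : R -> 'cV[R]_d -> \bar R).
Hypothesis mk : measurable_fun setT (fun z : R * 'cV[R]_d => k z.1 z.2).
Hypothesis k0 : forall t x, 0 <= k t x.

Definition duhamel t w : \bar R :=
  \int[lebesgue_measure]_(r in `[t, T0]) heat (r - t) (k r) w.

Lemma measurable_heat_time t w D : measurable_fun D (fun r => heat (r - t) (k r) w).
Proof.
apply: measurable_funTS.
apply: (@measurable_heat_gen _ _ (fun r : R => (r - t)%R) (fun=> w) k) => //.
exact: measurable_funB.
Qed.

Lemma duhamel_ge0 t w : 0 <= duhamel t w.
Proof. by apply: integral_ge0 => r _; exact: heat_ge0. Qed.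

Lemma measurable_duhamel t : measurable_fun setT (duhamel t).
Proof.
pose F (z : 'cV[R]_d * measurableTypeR R) :=
   heat (z.2 - t) (k z.2) z.1 * (\1_(`[t, T0]%classic) z.2)%:E.
have mF : measurable_fun setT F.
  apply: emeasurable_funM.
    apply: (@measurable_heat_gen _ _ (fun z : 'cV[R]_d * measurableTypeR R => (z.2 - t)%R) fst
      (fun z => k z.2)) => //.
      exact: measurable_funB.
    have mz : measurable_fun setT
       (fun z : ('cV[R]_d * measurableTypeR R) * 'cV[R]_d => (z.1.2, z.2)).
      by apply: measurable_fun_pair; [exact: (measurableT_comp measurable_snd measurable_fst)|exact: measurable_snd].
    exact: (measurableT_comp mk mz).
  apply/measurable_EFinP; apply: (measurableT_comp _ measurable_snd).
  exact: measurable_indic.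
have F0 z : 0 <= F z by rewrite /F mule_ge0 ?lee_fin//; exact: heat_ge0.
have := @measurable_fun_fubini_tonelli_F _ _ _ _ _ (@lebesgue_measure R) F mF F0.
apply: eq_measurable_fun => w _; rewrite /fubini_F /F /duhamel [RHS]integral_mkcond.
apply: eq_integral => r _ /=; rewrite epatch_indic//.
Qed.

(** Markov property at time [t + dl]: beyond that time the source is first
    averaged over the position at [t + dl], by the semigroup property and
    Tonelli. *)
Lemma duhamel_split t dl w : (0 <= dl)%R -> (t + dl <= T0)%R ->
  duhamel t w = \int[lebesgue_measure]_(r in `[t, (t + dl)%R[) heat (r - t) (k r) w
    + heat dl (duhamel (t + dl)%R) w.
Proof.
move=> dl0 tT.
rewrite /duhamel.
have -> : [set` `[t, T0]] = [set` `[t, (t + dl)%R[] `|` [set` `[(t + dl)%R, T0]] :> set R.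
  by rewrite -itv_bndbnd_setU// bnd_simp// lerDl.
rewrite ge0_integral_setU//=; last 3 first.
- exact: measurable_heat_time.
- by move=> r _; exact: heat_ge0.
- by rewrite disj_set2E; apply/eqP/seteqP; split => // x [] /=; rewrite !in_itv /= => /andP[_ h1] /andP[h2 _]; have := le_lt_trans h2 h1; rewrite ltxx.
congr (_ + _).
set D := [set` `[(t + dl)%R, T0]].
pose F (z : Omega * measurableTypeR R) :=
  heat (z.2 - (t + dl)) (k z.2) (w + B (Num.max dl 0%R) z.1)%R * (\1_D z.2)%:E.
have mD : measurable D by exact: measurable_itv.
have mF : measurable_fun setT F.
  apply: emeasurable_funM.
    apply: (@measurable_heat_gen _ _ (fun z : Omega * measurableTypeR R => (z.2 - (t + dl))%R)
       (fun z => (w + B (Num.max dl 0%R) z.1)%R) (fun z => k z.2)) => //.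
    - exact: measurable_funB.
    - by apply: measurable_addmx => //; exact: (measurableT_comp (@mB dl) measurable_fst).
    have mz : measurable_fun setT
       (fun z : (Omega * measurableTypeR R) * 'cV[R]_d => (z.1.2, z.2)).
      by apply: measurable_fun_pair; [exact: (measurableT_comp measurable_snd measurable_fst)|exact: measurable_snd].
    exact: (measurableT_comp mk mz).
  apply/measurable_EFinP; apply: (measurableT_comp _ measurable_snd).
  exact: measurable_indic.
have F0 z : 0 <= F z by rewrite /F mule_ge0 ?lee_fin//; exact: heat_ge0.
transitivity (\int[lebesgue_measure]_r \int[P]_om F (om, r)).
  rewrite integral_mkcond; apply: eq_integral => r _; rewrite /patch.
  case: ifPn => rD; last first.
    by rewrite integral0_eq// => om _; rewrite /F indicE (negbTE rD) mule0.
  have rt : (t + dl <= r)%R by move: rD; rewrite inE /D /= in_itv /= => /andP[].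
  transitivity (heat dl (heat (r - (t + dl)) (k r)) w).
    rewrite heat_semigroup ?subr_ge0//.
      by have -> : (r - t = dl + (r - (t + dl)))%R by ring.
    exact: (@measurable_slice _ _ _ _ _ _ k _ mk).
  by apply: eq_integral => om _; rewrite /F indicE rD mule1.
have <- := @fubini_tonelli _ _ _ _ _ P (@lebesgue_measure R) F mF F0.
apply: eq_integral => om _; rewrite /fubini_F [RHS]integral_mkcond.
by apply: eq_integral => r _ /=; rewrite epatch_indic.
Qed.

End duhamel.

Lemma le_duhamel T0 (k k' : R -> 'cV[R]_d -> \bar R) t w :
  measurable_fun setT (fun z : R * 'cV[R]_d => k z.1 z.2) ->
  measurable_fun setT (fun z : R * 'cV[R]_d => k' z.1 z.2) ->
  (forall t x, 0 <= k t x) ->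
  (forall s x, (t <= s <= T0)%R -> k s x <= k' s x) ->
  duhamel T0 k t w <= duhamel T0 k' t w.
Proof.
move=> mk mk' k0 kk'.
have k0' s x : (t <= s <= T0)%R -> 0 <= k' s x by move=> sT; apply: le_trans (kk' s x sT).
have mk1 s : measurable_fun setT (k s).
  exact: (@measurable_slice _ _ _ _ _ _ k _ mk).
have mk1' s : measurable_fun setT (k' s).
  exact: (@measurable_slice _ _ _ _ _ _ k' _ mk').
rewrite /duhamel.
have hk' : forall r, r \in [set` `[t, T0]] ->
   heat (r - t) (k' r) w = heat (r - t) (fun x => maxe (k' r x) 0) w.
  move=> r; rewrite inE /= in_itv /= => rT; apply: eq_integral => om _.
  by apply/esym; apply: max_l; exact: k0'.
suff : \int[lebesgue_measure]_(r in `[t, T0]) heat (r - t) (k r) w <=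
    \int[lebesgue_measure]_(r in `[t, T0]) heat (r - t) (fun x => maxe (k' r x) 0) w.
  by move=> /le_trans; apply; rewrite le_eqVlt; apply/orP; left; apply/eqP/esym/eq_integral => r; exact: hk'.
apply: ge0_le_integral => //.
- by move=> r _; exact: heat_ge0.
- exact: measurable_heat_time.
- apply: (@measurable_heat_time (fun r x => maxe (k' r x) 0)).
    by apply: measurable_maxe.
  by move=> s x; rewrite le_max lexx orbT.
- move=> r; rewrite /= in_itv /= => rT; apply: le_heat => //.
  + by apply: measurable_maxe.
  + by move=> x; rewrite le_max kk'.
Qed.

Lemma duhamelD T0 (k k' : R -> 'cV[R]_d -> \bar R) t w :
  measurable_fun setT (fun z : R * 'cV[R]_d => k z.1 z.2) ->
  measurable_fun setT (fun z : R * 'cV[R]_d => k' z.1 z.2) ->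
  (forall t x, 0 <= k t x) -> (forall t x, 0 <= k' t x) ->
  duhamel T0 (fun s x => k s x + k' s x) t w = duhamel T0 k t w + duhamel T0 k' t w.
Proof.
move=> mk mk' k0 k0'.
have mk1 s : measurable_fun setT (k s).
  exact: (@measurable_slice _ _ _ _ _ _ k _ mk).
have mk1' s : measurable_fun setT (k' s).
  exact: (@measurable_slice _ _ _ _ _ _ k' _ mk').
rewrite /duhamel -ge0_integralD//.
- by apply: eq_integral => r _; rewrite heatD.
- by move=> r _; exact: heat_ge0.
- exact: measurable_heat_time.
- by move=> r _; exact: heat_ge0.
- exact: measurable_heat_time.
Qed.

Lemma duhamelZ T0 (k : R -> 'cV[R]_d -> \bar R) (c : R) t w : (0 <= c)%R ->
  measurable_fun setT (fun z : R * 'cV[R]_d => k z.1 z.2) ->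
  (forall t x, 0 <= k t x) ->
  duhamel T0 (fun s x => c%:E * k s x) t w = c%:E * duhamel T0 k t w.
Proof.
move=> c0 mk k0.
have mk1 s : measurable_fun setT (k s).
  exact: (@measurable_slice _ _ _ _ _ _ k _ mk).
rewrite /duhamel -ge0_integralZl//.
- by apply: eq_integral => r _; rewrite heatZ.
- exact: measurable_heat_time.
- by move=> r _; exact: heat_ge0.
Qed.

Lemma duhamel_cst T0 (c : R) t w : (t <= T0)%R ->
  duhamel T0 (fun _ _ => c%:E) t w = (c * (T0 - t))%:E.
Proof.
move=> tT; rewrite /duhamel; under eq_integral do rewrite heat_cst.
rewrite integral_cst//= lebesgue_measure_itv/= lte_fin.
have [tT'|] := ltP t T0; first by rewrite -EFinB.
by move=> Tt; rewrite (le_anti (introT andP (conj tT Tt))) subrr mulr0 mule0.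
Qed.

End heat_operator.

(** * Quadratic and quartic functions under the heat flow *)

Section moments.
Context {R : realType} {d : nat}.
Implicit Types w z : 'cV[R]_d.

Definition sqsum w : R := \sum_i w i ord0 ^+ 2.
Definition quart w : R := \sum_i w i ord0 ^+ 4.

Lemma sqsum_ge0 w : 0 <= sqsum w.
Proof. by apply: sumr_ge0 => i _; exact: sqr_ge0. Qed.

Lemma quart_ge0 w : 0 <= quart w.
Proof. by apply: sumr_ge0 => i _; rewrite (exprM _ 2 2) sqr_ge0. Qed.

Lemma measurable_sqsum : measurable_fun setT sqsum.
Proof.
by apply: measurable_sum => i; apply: measurable_funX; exact: measurable_mx_coord.
Qed.

Lemma measurable_quart : measurable_fun setT quart.
Proof.
by apply: measurable_sum => i; apply: measurable_funX; exact: measurable_mx_coord.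
Qed.

Lemma norm_sqsum w : `|w| ^+ 2 <= sqsum w.
Proof.
rewrite -[leRHS]sqr_sqrtr ?sqsum_ge0// ler_sqr ?nnegrE ?sqrtr_ge0//.
apply: mx_norm_le => [|i j]; first exact: sqrtr_ge0.
rewrite -sqrtr_sqr ler_wsqrtr// ord1 /sqsum (bigD1 i)//= lerDl.
by apply: sumr_ge0 => k _; exact: sqr_ge0.
Qed.

(** Outside the ball of radius [r >= 1] quadratic growth is dominated by
    quartic growth, with a constant that vanishes as [r] increases. *)
Lemma sqsum_far w (r : R) : 1 <= r -> r < `|w| ->
  1 + sqsum w <= (d%:R + 2) / r ^+ 2 * quart w.
Proof.
move=> r1 rw; have r0 : 0 < r by exact: lt_le_trans r1.
have r20 : 0 < r ^+ 2 by exact: exprn_gt0.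
have [i ri] : exists i, r < `|w i ord0|.
  apply: contrapT => /forallNP h; move: rw; apply/negP; rewrite -leNgt.
  apply: mx_norm_le; first exact: ltW.
  by move=> i j; rewrite ord1 leNgt; apply/negP; exact: h.
have r4 : r ^+ 4 <= quart w.
  rewrite /quart (bigD1 i)//=; apply: ler_wpDr.
    by apply: sumr_ge0 => k _; rewrite (exprM _ 2 2) sqr_ge0.
  rewrite (exprM _ 2 2) (exprM (w i ord0) 2 2) -(real_normK (num_real (w i ord0))) -!exprM.
  by apply: lerXn2r; rewrite ?nnegrE ?normr_ge0 ?(ltW r0) ?(ltW ri).
have r22 : r ^+ 4 = r ^+ 2 * r ^+ 2 by rewrite -exprD.
rewrite mulrAC ler_pdivlMr//.
have h1 : r ^+ 2 * sqsum w <= quart w + d%:R * r ^+ 4.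
  rewrite /sqsum /quart mulr_sumr -[d in d%:R]card_ord -sum1_card natr_sum mulr_suml -big_split /=.
  apply: ler_sum => k _; rewrite mul1r.
  have : 0 <= (r ^+ 2 - w k ord0 ^+ 2) ^+ 2 by exact: sqr_ge0.
  have : 0 <= (r ^+ 2 * w k ord0 ^+ 2) by rewrite mulr_ge0 ?sqr_ge0.
  by rewrite r22 (_ : w k ord0 ^+ 4 = w k ord0 ^+ 2 * w k ord0 ^+ 2) -?exprD//; nra.
have h2 : r ^+ 2 <= r ^+ 4 by rewrite r22 ler_peMr ?(ltW r20)// exprn_ege1.
have h3 : d%:R * r ^+ 4 <= d%:R * quart w by rewrite ler_wpM2l.
by rewrite mulrDl mul1r mulrDl; lra.
Qed.

Context {dO : measure_display} {Omega : measurableType dO}.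
Variables (P : probability Omega R) (B : R -> Omega -> 'cV[R]_d).
Hypothesis hB : brownian P B.
Let hB1 i := brownian_coord hB i.

Lemma brownian1_shift2 (s a : R) i : 0 <= s ->
  (\int[P]_om ((a + B s om i ord0) ^+ 2)%:E = (a ^+ 2 + s)%:E)%E.
Proof.
move=> s0; set b := fun om => B s om i ord0.
have lb : L2 P b by exact: brownian1_L2 (hB1 i) _ s0.
have lab : L2 P (fun om => a + b om) by apply: L2D => //; exact: L2_cst.
rewrite -[LHS](Rintegral_EFin (L2_sqr_integrable lab)); congr EFin.
have -> : (fun om => (a + b om) ^+ 2) = (fun om => (a ^+ 2 + (2 * a) * b om) + b om ^+ 2).
  by apply/funext => om; ring.
have i1 : P.-integrable setT (fun om => ((2 * a) * b om)%:E) by exact: L2_integrable (L2Z _ lb).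
have i2 : P.-integrable setT (fun om => (a ^+ 2 + (2 * a) * b om)%:E).
  by apply: L2_integrable; apply: L2D; [exact: L2_cst|exact: L2Z].
rewrite RintegralD//; last exact: L2_sqr_integrable.
rewrite RintegralD//; last exact: prob_integrable_cst.
rewrite Rintegral_prob_cst RintegralZl//; last exact: L2_integrable.
rewrite (brownian1_mean (hB1 i) s0) mulr0 addr0.
by rewrite /Rintegral (brownian1_moment2 (hB1 i) s0).
Qed.

(** In other words [sqsum w + d%:R * (T - t)] solves the backward heat equation. *)
Lemma heat_sqsum (s c c' : R) w : 0 <= s -> 0 <= c -> 0 <= c' ->
  heat P B s (fun x => (c + c' * sqsum x)%:E) w = (c + c' * (sqsum w + d%:R * s))%:E.
Proof.
move=> s0 c0 c'0; rewrite /heat max_l//.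
have mB i : measurable_fun setT (fun om => (w i ord0 + B s om i ord0)).
  by apply: measurable_funD => //; exact: (brownian1_meas (hB1 i)).
have mS : measurable_fun setT (fun om => (sqsum (w + B s om))%:E).
  apply/measurable_EFinP; apply: (measurableT_comp measurable_sqsum).
  by apply: measurable_addmx => //; exact: (measurable_brownian hB).
have hs : (\int[P]_om (sqsum (w + B s om))%:E = (sqsum w + d%:R * s)%:E)%E.
  under eq_integral do (rewrite /sqsum -sumEFin; under eq_bigr do rewrite mxE).
  rewrite ge0_integral_sum//; last 2 first.
  - by move=> i; apply/measurable_EFinP/measurable_funX.
  - by move=> i om _; rewrite lee_fin sqr_ge0.
  under eq_bigr do rewrite (brownian1_shift2 _ _ s0).
  by rewrite sumEFin big_split /= sumr_const card_ord (mulr_natl _ d).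
under eq_integral do rewrite EFinD EFinM.
rewrite ge0_integralD//=; last 2 first.
- by move=> om _; rewrite -EFinM lee_fin mulr_ge0 ?sqsum_ge0.
- exact: measurable_funeM.
rewrite integral_cst//= probability_setT mule1 ge0_integralZl//; last first.
  by move=> om _; rewrite lee_fin sqsum_ge0.
by rewrite hs.
Qed.

Lemma brownian_sqsum (s c c' : R) : 0 <= s -> 0 <= c -> 0 <= c' ->
  (\int[P]_om (c + c' * sqsum (B s om))%:E = (c + c' * (d%:R * s))%:E)%E.
Proof.
move=> s0 c0 c'0; have := heat_sqsum 0 s0 c0 c'0; rewrite /heat max_l//.
under eq_integral do rewrite add0r.
move=> ->; rewrite (_ : sqsum 0 = 0) ?add0r//.
by rewrite /sqsum big1// => i _; rewrite mxE expr0n.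
Qed.

Lemma brownian_quart s : 0 <= s ->
  (heat P B s (EFin \o quart) 0 = (d%:R * (3 * s ^+ 2))%:E)%E.
Proof.
move=> s0; rewrite /heat max_l//; under eq_integral do rewrite add0r /= -sumEFin.
rewrite ge0_integral_sum//; last 2 first.
- by move=> i; apply/measurable_EFinP/measurable_funX; exact: (brownian1_meas (hB1 i)).
- by move=> i om _; rewrite lee_fin (exprM _ 2 2) sqr_ge0.
under eq_bigr do rewrite (brownian1_moment4 (hB1 _) s0).
by rewrite sumEFin sumr_const card_ord (mulr_natl _ d).
Qed.

(** The fourth power is convex and the increments are centred. This makes the
    quartic barrier subcaloric. *)
Lemma le_heat_quart s w : 0 <= s -> ((quart w)%:E <= heat P B s (EFin \o quart) w)%E.
Proof.
move=> s0; rewrite /heat max_l//.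
under eq_integral do rewrite /= /quart -sumEFin.
rewrite ge0_integral_sum//; last 2 first.
- move=> i; apply/measurable_EFinP/measurable_funX.
  by under eq_fun do rewrite mxE; apply: measurable_funD => //; exact: (brownian1_meas (hB1 i)).
- by move=> i om _; rewrite lee_fin (exprM _ 2 2) sqr_ge0.
rewrite /quart -sumEFin; apply: lee_sum => i _.
under eq_integral do rewrite mxE.
set b := fun om => B s om i ord0; set a := w i ord0.
have lb : L2 P b by exact: brownian1_L2 (hB1 i) _ s0.
have lb2 : L2 P (fun om => b om ^+ 2) by exact: brownian1_sqr_L2 (hB1 i) _ s0.
have lab : L2 P (fun om => a + b om) by apply: L2D => //; exact: L2_cst.
have lab2 : L2 P (fun om => (a + b om) ^+ 2).
  have := L2D (L2D (L2_cst P (a ^+ 2)) (L2Z (2 * a) lb)) lb2.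
  by congr (L2 P); apply/funext => om; ring.
have m0 : \int[P]_om (a + b om) = a.
  rewrite RintegralD//; [|exact: prob_integrable_cst|exact: L2_integrable].
  by rewrite Rintegral_prob_cst (brownian1_mean (hB1 i) s0) addr0.
have h1 := sqr_mean_le lab; have h2 := sqr_mean_le lab2.
have -> : (\int[P]_om ((a + b om) ^+ 4)%:E = (\int[P]_om (((a + b om) ^+ 2) ^+ 2))%:E)%E.
  rewrite Rintegral_EFin; last exact: L2_sqr_integrable.
  by apply: eq_integral => om _; rewrite -exprM.
rewrite lee_fin; apply: le_trans h2; rewrite (exprM _ 2 2) ler_sqr ?nnegrE ?sqr_ge0//.
  by rewrite -{1}m0.
by apply: le_trans h1; exact: sqr_ge0.
Qed.

End moments.

(** * Comparison principle *)

Lemma EFin_sub_le (R : realType) (x y : R) (c : \bar R) :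
  (x%:E <= c + y%:E -> (x - y)%:E <= c)%E.
Proof. by case: c => [c|//|//]; rewrite ?leey// -EFinD !lee_fin lerBlDr. Qed.

Lemma trunc_pos_neg (R : realType) (M x : R) : `|x| <= M ->
  Num.min M (Num.max x 0) - Num.min M (Num.max (- x) 0) = x.
Proof.
rewrite ler_norml => /andP[h1 h2]; have M0 : 0 <= M by lra.
rewrite !min_r ?ge_max ?M0 ?andbT//; last lra.
by case: (leP x 0) => ?; case: (leP (- x) 0) => ?; lra.
Qed.

Section comparison.
Context {R : realType} {d : nat} {dO : measure_display} {Omega : measurableType dO}.
Variables (P : probability Omega R) (B : R -> Omega -> 'cV[R]_d).
Hypothesis hB : brownian P B.
Local Notation heat := (heat P B).
Local Notation duhamel := (duhamel P B).
Implicit Types (t r s : R) (w z : 'cV[R]_d).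
Variable T0 : R.
Hypothesis T0_gt0 : 0 < T0.

Definition cyl_unif_cont (k : R -> 'cV[R]_d -> R) := forall r e : R, 0 < e ->
  exists2 rh : R, 0 < rh & forall t t' w z, 0 <= t <= T0 -> 0 <= t' <= T0 ->
    `|w| <= r -> `|t' - t| <= rh -> `|z| <= rh -> `|k t' (w + z) - k t w| <= e.

(** Increments smaller than the modulus of continuity [rh] change [k] by at most
    [e / 2]; larger ones cost at most [M], hence at most [q * sqsum z] with [q =
    M / rh ^+ 2], and this has mean at most [q * d%:R * dl]. *)
Lemma cell_estimate (k : R -> 'cV[R]_d -> R) (M r e : R) :
  measurable_fun setT (fun z : R * 'cV[R]_d => k z.1 z.2) ->
  (forall t w, 0 <= k t w <= M) -> cyl_unif_cont k -> 0 < e ->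
  exists2 eta, 0 < eta & forall (t dl : R) w, 0 <= t -> 0 < dl -> dl <= eta -> t + dl <= T0 ->
    `|w| <= r ->
    (\int[lebesgue_measure]_(s in `[t, (t + dl)%R[) heat (s - t) (EFin \o k s) w
       <= (dl * (k t w + e))%:E)%E /\
    ((dl * k t w)%:E <= \int[lebesgue_measure]_(s in `[t, (t + dl)%R[)
       heat (s - t) (EFin \o k s) w + (dl * e)%:E)%E.
Proof.
move=> mk kM kc e0.
have k0 t w : 0 <= k t w by have /andP[] := kM t w.
have M0 : 0 <= M by have /andP[k0' kM'] := kM 0 0; exact: le_trans kM'.
have e20 : 0 < e / 2 by rewrite divr_gt0.
have [rh rh0 kr] := kc r (e / 2) e20.
pose q := M / rh ^+ 2.
have q0 : 0 <= q by rewrite divr_ge0// sqr_ge0.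
have rh20 : 0 < rh ^+ 2 by exact: exprn_gt0.
pose eta := Num.min rh (e / 2 / (q * d%:R + 1)).
have qd1 : 0 < q * d%:R + 1 by rewrite ltr_wpDl// mulr_ge0.
exists eta; first by rewrite lt_min rh0 divr_gt0.
move=> t dl w t0 dl0 dle tT wr.
have dlrh : dl <= rh by apply: le_trans dle _; rewrite ge_min lexx.
have dlq : q * (d%:R * dl) <= e / 2.
  have : dl <= e / 2 / (q * d%:R + 1) by apply: le_trans dle _; rewrite ge_min lexx orbT.
  rewrite ler_pdivlMr// => h; apply: le_trans h.
  have -> : dl * (q * d%:R + 1) = q * (d%:R * dl) + dl by ring.
  by rewrite lerDl ltW.
have mk1 s : measurable_fun setT (k s) by exact: (@measurable_slice _ _ _ _ _ _ k s mk).
have mk1E s : measurable_fun setT (EFin \o k s) by apply/measurable_EFinP.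
have dist s z : t <= s -> s <= t + dl ->
    `|k s (w + z) - k t w| <= e / 2 + q * sqsum z.
  move=> ts sdl.
  have [zr|zr] := leP `|z| rh.
    apply: le_trans (_ : e / 2 <= _); last by rewrite lerDl mulr_ge0 ?sqsum_ge0.
    apply: kr => //.
    - by rewrite t0 (le_trans _ tT)// lerDl ltW.
    - by rewrite (le_trans t0 ts) (le_trans sdl tT).
    - by rewrite ger0_norm ?subr_ge0//; apply: le_trans dlrh; rewrite lerBlDl.
  apply: le_trans (_ : M <= _).
    have := kM s (w + z); have := kM t w => /andP[a1 a2] /andP[a3 a4].
    by rewrite ler_norml; apply/andP; split; lra.
  apply: le_trans (_ : q * rh ^+ 2 <= _); first by rewrite /q divfK ?gt_eqF.
  rewrite ler_wpDl ?(ltW e20)//; apply: ler_wpM2l => //; apply: le_trans (norm_sqsum z).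
  by apply: lerXn2r; rewrite ?nnegrE ?normr_ge0 ?(ltW rh0) ?(ltW zr).
have mcost s c : 0 <= s -> measurable_fun setT (fun om => (c + q * sqsum (B s om))%:E).
  move=> s0; apply/measurable_EFinP; apply: measurable_funD => //.
  apply: measurable_funM => //; apply: (measurableT_comp measurable_sqsum).
  exact: (measurable_brownian hB).
have mkB s s' : 0 <= s' -> measurable_fun setT (fun om => (k s (w + B s' om))%:E).
  move=> s0; apply: (measurableT_comp (mk1E s)); apply: measurable_addmx => //.
  exact: (measurable_brownian hB).
have cost s c : t <= s -> s <= t + dl -> 0 <= c ->
    (\int[P]_om (c + e / 2 + q * sqsum (B (s - t) om))%:E <= (c + e)%:E)%E.
  move=> ts sdl c0; rewrite (brownian_sqsum hB) ?subr_ge0//; last by rewrite addr_ge0// ltW.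
  rewrite lee_fin.
  have : q * (d%:R * (s - t)) <= q * (d%:R * dl).
    by rewrite ler_wpM2l// ler_wpM2l// lerBlDl.
  lra.
have up s : t <= s -> s <= t + dl -> (heat (s - t) (EFin \o k s) w <= (k t w + e)%:E)%E.
  move=> ts sdl; apply: le_trans (cost s (k t w) ts sdl (k0 _ _)).
  rewrite /heat max_l ?subr_ge0//; apply: ge0_le_integral => //.
  - by move=> om _; rewrite lee_fin.
  - by apply: mkB; rewrite subr_ge0.
  - by apply: mcost; rewrite subr_ge0.
  - move=> om _; rewrite lee_fin.
    by have := dist s (B (s - t) om) ts sdl; rewrite ler_norml => /andP[_]; lra.
have down s : t <= s -> s <= t + dl -> ((k t w)%:E <= heat (s - t) (EFin \o k s) w + e%:E)%E.
  move=> ts sdl.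
  have -> : ((k t w)%:E = \int[P]_om (k t w)%:E)%E.
    by rewrite integral_cst//= probability_setT mule1.
  apply: le_trans (_ : _ <= \int[P]_om ((k s (w + B (s - t) om))%:E
      + (0 + e / 2 + q * sqsum (B (s - t) om))%:E))%E _.
    apply: ge0_le_integral => //.
    - by move=> om _; rewrite lee_fin.
    - apply: emeasurable_funD; first by apply: mkB; rewrite subr_ge0.
      by apply: mcost; rewrite subr_ge0.
    - move=> om _; rewrite lee_fin.
      by have := dist s (B (s - t) om) ts sdl; rewrite ler_norml => /andP[]; lra.
  rewrite ge0_integralD//=; last 4 first.
  - by move=> om _; rewrite lee_fin.
  - by apply: mkB; rewrite subr_ge0.
  - by move=> om _; rewrite lee_fin add0r addr_ge0 ?(ltW e20)// mulr_ge0 ?sqsum_ge0.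
  - by apply: mcost; rewrite subr_ge0.
  rewrite /heat max_l ?subr_ge0//; apply: leeD2l.
  by have := cost s 0 ts sdl (lexx _); rewrite [(0 + e)%R]add0r.
have int_cst (c : R) : (\int[lebesgue_measure]_(s in `[t, (t + dl)%R[) c%:E = (dl * c)%:E)%E.
  rewrite integral_cst//= lebesgue_measure_itv/= lte_fin ltrDl dl0 -EFinB -EFinM.
  by congr EFin; ring.
have mh : measurable_fun `[t, t + dl[ (fun s => heat (s - t) (EFin \o k s) w).
  apply: (measurable_heat_time hB (k := fun s x => (k s x)%:E)).
    exact/measurable_EFinP.
  by move=> s x; rewrite lee_fin.
have h0 s : (0 <= heat (s - t) (EFin \o k s) w)%E.
  by apply: heat_ge0 => x; rewrite lee_fin.
split.
  rewrite -int_cst; apply: ge0_le_integral => //.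
  by move=> s /=; rewrite in_itv /= => /andP[ts /ltW sdl]; exact: up.
rewrite -!int_cst -ge0_integralD//; last by move=> s _; rewrite lee_fin ltW.
apply: ge0_le_integral => //.
- by move=> s _; rewrite lee_fin.
- by apply: emeasurable_funD.
by move=> s /=; rewrite in_itv /= => /andP[ts /ltW sdl]; exact: down.
Qed.

Section one_sided.
Variables (V h : R -> 'cV[R]_d -> R) (D : R).
Hypothesis mV : forall t, 0 <= t <= T0 -> measurable_fun setT (V t).
Hypothesis V0 : forall t w, 0 <= t <= T0 -> 0 <= V t w.
Hypothesis VD : forall t w, 0 <= t <= T0 -> V t w <= D * (1 + sqsum w).
Hypothesis mh : measurable_fun setT (fun z : R * 'cV[R]_d => h z.1 z.2).
Hypothesis hc : cyl_unif_cont h.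
Hypothesis hstep : forall r e : R, 0 < e -> exists2 eta, 0 < eta &
  forall (t dl : R) w, 0 <= t -> 0 < dl -> dl <= eta -> t + dl <= T0 -> `|w| <= r ->
  ((V t w)%:E <= heat dl (EFin \o V (t + dl)%R) w + (dl * h t w + dl * e)%:E)%E.

Let D0 : 0 <= D.
Proof.
have T00 : 0 <= T0 <= T0 by rewrite lexx ltW.
have := VD 0 T00; have := V0 0 T00 => /le_trans h1 /h1.
by rewrite pmulr_lge0// ltr_pwDl// sqsum_ge0.
Qed.

Section truncated.
Variables (r e q M : R).
Hypotheses (r1 : 1 <= r) (e0 : 0 < e) (q0 : 0 < q) (M0 : 0 <= M).
Hypothesis hM : forall t w, 0 <= t <= T0 -> `|w| <= r -> `|h t w| <= M.

(** [a] and [b] are the positive and the negative part of [h], cut at [M] so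
    that [cell_estimate] applies to them; in [a], the term [3 * e] pays for the
    three errors of size [e] made in one time step. *)
Let a t w : R := Num.min M (Num.max (h t w) 0) + 3 * e.
Let b t w : R := Num.min M (Num.max (- h t w) 0).
(** The barrier [al * quart w] dominates [V] and the constants outside the ball
    of radius [r], and its coefficient vanishes as [r] grows. *)
Let al : R := (D + T0 / q) * ((d%:R + 2) / r ^+ 2).
Let F w : \bar R := (V T0 w + al * quart w)%:E.
(** The penalty [q * h ^+ 2] controls [h] up to a constant, since
    [`|h| <= q^-1 + q * h ^+ 2]. *)
Let kk t w : \bar R := (a t w + q * h t w ^+ 2)%:E.

Let TT : 0 <= T0 <= T0. Proof. by rewrite lexx ltW. Qed.
Let r0 : 0 < r. Proof. exact: lt_le_trans r1. Qed.

Let al0 : 0 <= al.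
Proof.
by rewrite /al mulr_ge0// ?addr_ge0// ?divr_ge0// ?addr_ge0// ?sqr_ge0// ltW.
Qed.

Let mF : measurable_fun setT F.
Proof.
apply/measurable_EFinP; apply: measurable_funD; first exact: mV.
by apply: measurable_funM => //; exact: measurable_quart.
Qed.

Let F0 w : (0 <= F w)%E.
Proof. by rewrite lee_fin addr_ge0 ?V0// mulr_ge0// quart_ge0. Qed.

Let ma : measurable_fun setT (fun z : R * 'cV[R]_d => a z.1 z.2).
Proof.
apply: measurable_funD => //; apply: measurable_minr => //.
exact: measurable_maxr.
Qed.

Let mb : measurable_fun setT (fun z : R * 'cV[R]_d => b z.1 z.2).
Proof.
apply: measurable_minr => //; apply: measurable_maxr => //.
exact: measurableT_comp.
Qed.

Let mkk : measurable_fun setT (fun z : R * 'cV[R]_d => kk z.1 z.2).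
Proof.
apply/measurable_EFinP; apply: measurable_funD => //.
by apply: measurable_funM => //; exact: measurable_funX.
Qed.

Let aM t w : 0 <= a t w <= M + 3 * e.
Proof.
rewrite /a lerD2r ge_min lexx andbT addr_ge0 ?le_min ?M0 ?le_max ?lexx ?orbT//.
by rewrite mulr_ge0// ltW.
Qed.

Let bM t w : 0 <= b t w <= M.
Proof. by rewrite /b ge_min lexx andbT le_min M0 le_max lexx orbT. Qed.

Let a0 t w : 0 <= a t w. Proof. by have /andP[] := aM t w. Qed.
Let b0 t w : 0 <= b t w. Proof. by have /andP[] := bM t w. Qed.
Let kk0 t w : (0 <= kk t w)%E.
Proof. by rewrite lee_fin addr_ge0// mulr_ge0 ?sqr_ge0// ltW. Qed.

Let trunc_lip (x y : R) : `|Num.min M (Num.max x 0) - Num.min M (Num.max y 0)| <= `|x - y|.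
Proof.
wlog xy : x y / x <= y.
  by move=> H; have [/H//|/ltW/H] := leP x y; rewrite distrC (distrC y).
rewrite (ler0_norm (_ : x - y <= 0)) ?subr_le0// ler0_norm ?subr_le0; last first.
  by rewrite le_min !ge_min !le_max !ge_max lexx /=; lra.
by case: (leP x 0) => ?; case: (leP y 0) => ?; case: (leP M 0) => ?;
  case: (leP M x) => ?; case: (leP M y) => ?; lra.
Qed.

Let ac : cyl_unif_cont a.
Proof.
move=> r' e' e'0; have [rh rh0 H] := hc r' e'0; exists rh => // t t' w z tT t'T wr tt zr.
apply: le_trans (H t t' w z tT t'T wr tt zr).
by rewrite /a opprD addrACA subrr addr0; exact: trunc_lip.
Qed.

Let bc : cyl_unif_cont b.
Proof.
move=> r' e' e'0; have [rh rh0 H] := hc r' e'0; exists rh => // t t' w z tT t'T wr tt zr.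
apply: le_trans (H t t' w z tT t'T wr tt zr).
rewrite -[leRHS]normrN opprB -[h t w in leRHS]opprK [X in _ <= `|X|]addrC.
exact: trunc_lip.
Qed.

Let C t := forall w, ((V t w)%:E + duhamel T0 (fun s => EFin \o b s) t w
  <= heat (T0 - t) F w + duhamel T0 kk t w)%E.

Let mbE : measurable_fun setT (fun z : R * 'cV[R]_d => (b z.1 z.2)%:E).
Proof. exact/measurable_EFinP. Qed.
Let b0E t w : (0 <= (EFin \o b t) w)%E. Proof. by rewrite lee_fin. Qed.

Let C_T0 : C T0.
Proof.
move=> w; rewrite /duhamel set_itv1 !integral_set1 !adde0 subrr.
by rewrite (heat0 hB)// lee_fin lerDl mulr_ge0// quart_ge0.
Qed.

(** Outside the ball there is nothing to propagate: convexity keeps the barrier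
    below its mean at the final time, and the barrier alone exceeds the left-hand
    side up to the penalty. *)
Let C_far t w : 0 <= t <= T0 -> r < `|w| ->
  ((V t w)%:E + duhamel T0 (fun s => EFin \o b s) t w
  <= heat (T0 - t) F w + duhamel T0 kk t w)%E.
Proof.
move=> /andP[t0 tT] rw.
have qi0 : 0 <= q^-1 by rewrite invr_ge0 ltW.
have hq := sqsum_far r1 rw.
have h1 : (duhamel T0 (fun s => EFin \o b s) t w <=
    duhamel T0 kk t w + (q^-1 * (T0 - t))%:E)%E.
  rewrite -(duhamel_cst P B (q^-1) w tT) -(duhamelD hB)//.
  apply: (le_duhamel hB) => //.
    by apply: emeasurable_funD.
  move=> s x _; rewrite lee_fin /kk -addrA; apply: ler_wpDl => //.
  apply: le_trans (_ : `|h s x| <= _).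
    rewrite /b ge_min; apply/orP; right; rewrite ge_max normr_ge0 andbT.
    by rewrite -normrN ler_norm.
  rewrite -real_normK ?num_real//; set y : R := `|h s x|.
  rewrite -(ler_pM2l q0) mulrDr mulfV ?gt_eqF//.
  have : 0 <= (q * y - 1) ^+ 2 by exact: sqr_ge0.
  have : 0 <= q * y by rewrite mulr_ge0 ?(ltW q0) ?normr_ge0.
  rewrite (_ : q * (q * y ^+ 2) = (q * y) ^+ 2); last by ring.
  move: (q * y) => p; nra.
apply: le_trans (leeD2l _ h1) _; rewrite addeC -addeA addeC.
apply: leeD2r; rewrite -EFinD.
apply: le_trans (_ : (al * quart w)%:E <= _)%E.
  rewrite lee_fin.
  have v1 := VD w (introT andP (conj t0 tT)).
  have : q^-1 * (T0 - t) <= T0 / q * (1 + sqsum w).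
    rewrite [T0 / q]mulrC -mulrA ler_wpM2l//.
    rewrite -[leLHS]mulr1 ler_pM//; rewrite ?subr_ge0// ?gerBl//.
    by rewrite lerDl sqsum_ge0.
  have : (D + T0 / q) * (1 + sqsum w) <= al * quart w.
    by rewrite /al -mulrA ler_wpM2l// addr_ge0// divr_ge0// ltW.
  lra.
have sT : 0 <= T0 - t by rewrite subr_ge0.
apply: le_trans (_ : _ <= heat (T0 - t) (fun x => al%:E * (quart x)%:E) w)%E _.
  rewrite heatZ//; last 2 first.
  - by apply/measurable_EFinP; exact: measurable_quart.
  - by move=> x; rewrite lee_fin quart_ge0.
  by rewrite EFinM lee_wpmul2l ?lee_fin//; exact: (le_heat_quart hB).
apply: (le_heat hB) => //.
- by apply: measurable_funeM; apply/measurable_EFinP; exact: measurable_quart.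
- by move=> x; rewrite -EFinM lee_fin mulr_ge0 ?quart_ge0.
- by move=> x; rewrite -EFinM lee_fin lerDr V0.
Qed.

(** Inside the ball, the comparison at [t + dl] is averaged over one increment
    and the increments of [V] and of the two sources are compared on the cell
    [[t, t + dl]]. *)
Let C_step : exists2 eta, 0 < eta & forall (t dl : R), 0 <= t -> 0 < dl -> dl <= eta ->
  t + dl <= T0 -> C (t + dl) -> C t.
Proof.
have [eta1 eta10 H1] := hstep r e0.
have [eta2 eta20 H2] := cell_estimate r ma aM ac e0.
have [eta3 eta30 H3] := cell_estimate r mb bM bc e0.
exists (Num.min eta1 (Num.min eta2 eta3)); first by rewrite !lt_min eta10 eta20.
move=> t dl t0 dl0; rewrite !le_min => /and3P[d1 d2 d3] tT IH w.
have tdl0 : 0 <= t + dl by rewrite addr_ge0// ltW.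
have tT0 : 0 <= t <= T0 by rewrite t0 (le_trans _ tT)// lerDl ltW.
have tdT : 0 <= t + dl <= T0 by rewrite tdl0.
have [wr|] := leP `|w| r; last exact: C_far.
have {H1}H1 := H1 t dl w t0 dl0 d1 tT wr.
have {H2}[_ H2] := H2 t dl w t0 dl0 d2 tT wr.
have {H3}[H3 _] := H3 t dl w t0 dl0 d3 tT wr.
have IHdl : (heat dl (EFin \o V (t + dl)%R) w
      + heat dl (duhamel T0 (fun s => EFin \o b s) (t + dl)) w
    <= heat (T0 - t) F w + heat dl (duhamel T0 kk (t + dl)) w)%E.
  have -> : heat (T0 - t) F w = heat dl (heat (T0 - (t + dl)) F) w.
    rewrite (heat_semigroup hB (s := dl) w (ltW dl0) _ mF F0) ?subr_ge0//.
    by have -> : dl + (T0 - (t + dl)) = T0 - t by ring.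
  have m1 : measurable_fun setT (EFin \o V (t + dl)%R) by apply/measurable_EFinP; exact: mV.
  have m2 := measurable_duhamel hB T0 mbE b0E (t + dl).
  have m3 := measurable_heat hB (T0 - (t + dl)) mF F0.
  have m4 := measurable_duhamel hB T0 mkk kk0 (t + dl).
  have p1 y : (0 <= (EFin \o V (t + dl)%R) y)%E by rewrite lee_fin V0.
  have p2 := duhamel_ge0 P B T0 b0E (t + dl).
  have p3 y : (0 <= heat (T0 - (t + dl)) F y)%E by exact: heat_ge0.
  have p4 := duhamel_ge0 P B T0 kk0 (t + dl).
  rewrite -(heatD hB dl w m1 m2 p1 p2) -(heatD hB dl w m3 m4 p3 p4).
  apply: (le_heat hB _ _ _ _ _ IH).
  - exact: (emeasurable_funD m1 m2).
  - exact: (emeasurable_funD m3 m4).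
  - by move=> y; apply: adde_ge0; [exact: p1|exact: p2].
rewrite (duhamel_split hB mbE b0E w (ltW dl0) tT) (duhamel_split hB mkk kk0 w (ltW dl0) tT).
set cb := (X in ((V t w)%:E + (X + _) <= _)%E).
set ck := (X in (_ <= _ + (X + _))%E).
set A := heat dl (duhamel _ _ _) w in IHdl *.
set A2 := heat dl (duhamel _ _ _) w in IHdl *.
set HV := heat dl _ w in IHdl H1.
set HF := heat (T0 - t) F w in IHdl *.
suff hv : ((V t w)%:E + cb <= HV + ck)%E.
  apply: (@le_trans _ _ (HV + ck + A)%E).
    by rewrite (addeA _ cb); exact: leeD2r.
  by rewrite (addeAC HV) (addeC ck) (addeA HF); exact: leeD2r.
have hk : ((dl * a t w - dl * e)%:E <= ck)%E.
  apply: EFin_sub_le; apply: (le_trans H2).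
  suff cak : (\int[lebesgue_measure]_(s in `[t, (t + dl)%R[)
      heat (s - t) (EFin \o a s) w <= ck)%E by exact: (leeD2r _ cak).
  have mt k : measurable_fun setT (fun z : R * 'cV[R]_d => (k z.1 z.2)%:E) ->
      (forall t w, 0 <= k t w)%R ->
      measurable_fun `[t, t + dl[ (fun s => heat (s - t) (EFin \o k s) w).
    move=> m1 k0; apply: (measurable_heat_time hB (k := fun s x => (k s x)%:E)) => //.
  have mk1 (k : R -> 'cV[R]_d -> \bar R) s :
      measurable_fun setT (fun z : R * 'cV[R]_d => k z.1 z.2) -> measurable_fun setT (k s).
    exact: measurable_slice.
  have maE : measurable_fun setT (fun z : R * 'cV[R]_d => (a z.1 z.2)%:E) by exact/measurable_EFinP.
  apply: ge0_le_integral => //.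
  - by move=> s _; apply: heat_ge0 => x; rewrite lee_fin.
  - exact: (mt a).
  - exact: (measurable_heat_time hB).
  - move=> s _; apply: (le_heat hB).
    + exact: (mk1 (fun s x => (a s x)%:E)).
    + exact: mk1.
    + by move=> x; rewrite lee_fin.
    + by move=> x; rewrite lee_fin lerDl mulr_ge0 ?sqr_ge0// ltW.
have hab : h t w + b t w + 3 * e = a t w.
  by rewrite -{1}(trunc_pos_neg (hM tT0 wr)) /a /b subrK.
apply: (@le_trans _ _ (HV + (dl * h t w + dl * e)%:E + (dl * (b t w + e))%:E)%E).
  exact: leeD.
rewrite -addeA; suff hk' : ((dl * h t w + dl * e)%:E + (dl * (b t w + e))%:E <= ck)%E.
  exact: (leeD2l _ hk').
apply: (le_trans _ hk); rewrite -EFinD lee_fin -hab.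
by rewrite le_eqVlt; apply/orP; left; apply/eqP; ring.
Qed.

(** Discrete maximum principle: [V] satisfies the backward heat inequality with
    source [h] only up to [o(dl)] and locally uniformly, and this suffices for
    the integrated inequality. The parameters are chosen in this order: [q] from
    the integral [H] of [h ^+ 2], the slack [e] from the horizon, the radius [r]
    from [q], and the cut [M] from the size of [h] on the ball of radius [r]. *)
Lemma comparison_truncated : ((V 0 0)%:E + duhamel T0 (fun s => EFin \o b s) 0 0
  <= heat T0 F 0 + duhamel T0 kk 0 0)%E.
Proof.
have [eta eta0 H] := C_step.
pose n := (Num.truncn (T0 / eta)).+1.
have n0 : 0 < n%:R :> R by rewrite ltr0n.
pose dl := T0 / n%:R.
have dl0 : 0 < dl by rewrite divr_gt0.
have dle : dl <= eta.
  rewrite ler_pdivrMr// mulrC -ler_pdivrMr// ltW//.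
  by rewrite /n; exact: truncnS_gt.
have ndl : n%:R * dl = T0 by rewrite mulrC divfK ?gt_eqF.
suff : forall k, (k <= n)%N -> C (T0 - k%:R * dl).
  by move=> /(_ n (leqnn _)); rewrite ndl subrr => /(_ 0); rewrite subr0.
elim=> [_|k IH kn]; first by rewrite mul0r subr0; exact: C_T0.
have e1 : T0 - k.+1%:R * dl + dl = T0 - k%:R * dl by rewrite -natr1; ring.
refine (H _ dl _ dl0 dle _ _).
- by rewrite subr_ge0 -ndl ler_pM2r// ler_nat.
- by rewrite e1 gerBl mulr_ge0// ltW.
- by rewrite e1; apply: IH; exact: ltnW.
Qed.

End truncated.

Hypothesis hb : forall r : R, exists M : R, forall t w, 0 <= t <= T0 -> `|w| <= r -> `|h t w| <= M.
Hypothesis h2_fin : (duhamel T0 (fun t w => (h t w ^+ 2)%:E) 0 0 < +oo)%E.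

(** Discrete maximum principle: [V] satisfies the backward heat inequality with
    source [h] only up to [o(dl)] and locally uniformly, and this suffices for
    the integrated inequality. The parameters are chosen in this order: [q] from
    the integral [H] of [h ^+ 2], the slack [e] from the horizon, the radius [r]
    from [q], and the cut [M] from the size of [h] on the ball of radius [r]. *)
Lemma comparison : ((V 0 0)%:E + duhamel T0 (fun t w => (Num.max (- h t w) 0)%:E) 0 0
  <= heat T0 (EFin \o V T0) 0 + duhamel T0 (fun t w => (Num.max (h t w) 0)%:E) 0 0)%E.
Proof.
have T00 : 0 <= T0 by exact: ltW.
have TT : 0 <= T0 <= T0 by rewrite T00 lexx.
have mh2 : measurable_fun setT (fun z : R * 'cV[R]_d => (h z.1 z.2 ^+ 2)%:E).
  by apply/measurable_EFinP; exact: measurable_funX.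
have h20 t w : (0 <= (h t w ^+ 2)%:E)%E by rewrite lee_fin sqr_ge0.
have mhp : measurable_fun setT (fun z : R * 'cV[R]_d => (Num.max (h z.1 z.2) 0)%:E).
  by apply/measurable_EFinP; exact: measurable_maxr.
have hp0 t w : (0 <= (Num.max (h t w) 0)%:E)%E by rewrite lee_fin le_max lexx orbT.
have mhm : measurable_fun setT (fun z : R * 'cV[R]_d => (Num.max (- h z.1 z.2) 0)%:E).
  by apply/measurable_EFinP; apply: measurable_maxr => //; exact: measurableT_comp.
have hm0 t w : (0 <= (Num.max (- h t w) 0)%:E)%E by rewrite lee_fin le_max lexx orbT.
have [H HE] : exists H, duhamel T0 (fun t w => (h t w ^+ 2)%:E) 0 0 = H%:E.
  have := duhamel_ge0 P B T0 h20 0 0; move: h2_fin; case: (duhamel _ _ _ _) => // H _ _.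
  by exists H.
have H0 : 0 <= H by have := duhamel_ge0 P B T0 h20 0 0; rewrite HE lee_fin.
apply/lee_addgt0Pr => eps eps0.
pose q := eps / (8 * (H + 1)).
have H10 : 0 < 8 * (H + 1) by rewrite mulr_gt0// ltr_wpDl.
have q0 : 0 < q by rewrite divr_gt0.
have qH : 2 * (q * H) <= eps / 4.
  rewrite /q mulrAC mulrA ler_pdivrMr//; have : 0 <= eps * H by rewrite mulr_ge0// ltW.
  by lra.
pose e := eps / (12 * T0).
have e0 : 0 < e by rewrite divr_gt0// mulr_gt0.
have eT : 3 * e * T0 = eps / 4.
  by rewrite /e; field; rewrite gt_eqF.
pose A := (D + T0 / q) * (d%:R + 2) * (d%:R * (3 * T0 ^+ 2)).
have A0 : 0 <= A.
  by rewrite /A !mulr_ge0 ?addr_ge0// ?sqr_ge0// divr_ge0// ltW.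
pose r := Num.max 1 (4 * A / eps).
have r1 : 1 <= r by rewrite le_max lexx.
have r0 : 0 < r by exact: lt_le_trans r1.
have Ar : A / r ^+ 2 <= eps / 4.
  rewrite ler_pdivrMr ?exprn_gt0//; apply: le_trans (_ : eps / 4 * r <= _); last first.
    by rewrite ler_pM2l ?divr_gt0// expr2 ler_peMr// ltW.
  have : 4 * A / eps <= r by rewrite le_max lexx orbT.
  by rewrite ler_pdivrMr//; lra.
have [M0 hM0] := hb r.
(* Where [- h] exceeds [M >= q^-1] it is at most [q * h ^+ 2]: the cut costs at
   most [q * H]. *)
pose M := Num.max M0 q^-1.
have MM : q^-1 <= M by rewrite le_max lexx orbT.
have M0' : 0 <= M by apply: le_trans MM; rewrite invr_ge0 ltW.
have hM t w : 0 <= t <= T0 -> `|w| <= r -> `|h t w| <= M.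
  by move=> tT wr; rewrite le_max hM0.
have main := comparison_truncated r1 e0 q0 M0' hM.
set b := (X in duhamel T0 (fun s => EFin \o X s)) in main.
set F := (X in heat T0 X 0) in main.
set kk := (X in (_ <= _ + duhamel T0 X 0 0)%E) in main.
have mb : measurable_fun setT (fun z : R * 'cV[R]_d => (b z.1 z.2)%:E).
  apply/measurable_EFinP; apply: measurable_minr => //; apply: measurable_maxr => //.
  exact: measurableT_comp.
have b0 t w : (0 <= (b t w)%:E)%E by rewrite lee_fin le_min M0' le_max lexx orbT.
have s1 : (duhamel T0 (fun t w => (Num.max (- h t w) 0)%:E) 0 0 <=
    duhamel T0 (fun s => EFin \o b s) 0 0 + (q * H)%:E)%E.
  rewrite EFinM -HE -(duhamelZ hB T0 0 0 (ltW q0) mh2 h20) -(duhamelD hB T0 0 0 mb _ b0); last 2 first.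
  - exact: measurable_funeM.
  - by move=> t w; rewrite mule_ge0 ?lee_fin ?(ltW q0) ?sqr_ge0.
  apply: (le_duhamel hB) => //.
    by apply: emeasurable_funD => //; exact: measurable_funeM.
  move=> s x _; rewrite -EFinM -EFinD lee_fin /b.
  have [hh|hh] := leP M (Num.max (- h s x) 0); last first.
    by rewrite lerDl mulr_ge0 ?sqr_ge0// ltW.
  have : q^-1 <= Num.max (- h s x) 0 by exact: le_trans hh.
  have qi : 0 < q^-1 by rewrite invr_gt0.
  case: (leP (- h s x) 0) => [hh0|hh0 h1]; first by lra.
  apply: ler_wpDl => //; rewrite -sqrrN; set y := - h s x in h1 *.
  have : 1 <= q * y by rewrite -(@mulfV _ q) ?ler_pM2l// gt_eqF.
  rewrite expr2 mulrA => h2; by rewrite ler_peMl// (le_trans _ h1)// ltW.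
have s2 : (heat T0 F 0 = heat T0 (EFin \o V T0) 0 + (A / r ^+ 2)%:E)%E.
  have m1 : measurable_fun setT (EFin \o V T0) by apply/measurable_EFinP; exact: mV.
  have m2 : measurable_fun setT (EFin \o (@quart R d)) by apply/measurable_EFinP; exact: measurable_quart.
  pose al := (D + T0 / q) * ((d%:R + 2) / r ^+ 2).
  have al0 : 0 <= al.
    by rewrite /al mulr_ge0// ?addr_ge0// ?divr_ge0// ?addr_ge0// ?sqr_ge0// ltW.
  have q4 y : (0 <= (EFin \o (@quart R d)) y)%E by rewrite lee_fin quart_ge0.
  have -> : F = (fun y => (EFin \o V T0) y + al%:E * (EFin \o (@quart R d)) y)%E.
    by apply/funext => y; rewrite /F /= -EFinM -EFinD.
  rewrite (heatD hB T0 0 m1 _ _ _); last 3 first.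
  - exact: measurable_funeM.
  - by move=> y; rewrite lee_fin V0.
  - by move=> y; rewrite mule_ge0 ?lee_fin// quart_ge0.
  rewrite (heatZ hB T0 0 al0 m2 q4) (brownian_quart hB)//; congr (_ + _)%E.
  by rewrite -EFinM; congr EFin; rewrite /al /A; ring.
have s3 : (duhamel T0 kk 0 0 <= duhamel T0 (fun t w => (Num.max (h t w) 0)%:E) 0 0
    + (3 * e * T0 + q * H)%:E)%E.
  have -> : (3 * e * T0 + q * H)%:E = ((3 * e * (T0 - 0))%:E + q%:E * H%:E)%E.
    by rewrite subr0.
  rewrite -HE -(duhamelZ hB T0 0 0 (ltW q0) mh2 h20) -(duhamel_cst P B (3 * e) 0 T00).
  have mq : measurable_fun setT (fun z : R * 'cV[R]_d => q%:E * (h z.1 z.2 ^+ 2)%:E)%E.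
    exact: measurable_funeM.
  have q20 t w : (0 <= q%:E * (h t w ^+ 2)%:E)%E.
    by rewrite mule_ge0 ?lee_fin ?(ltW q0) ?sqr_ge0.
  have me : measurable_fun setT (fun z : R * 'cV[R]_d => (3 * e)%:E) by exact: measurable_cst.
  have e30 : (0 <= (3 * e)%:E)%E by rewrite lee_fin mulr_ge0// ltW.
  rewrite -(duhamelD hB T0 0 0 me mq (fun _ _ => e30) q20).
  have mE : measurable_fun setT
      (fun z : R * 'cV[R]_d => (3 * e)%:E + q%:E * (h z.1 z.2 ^+ 2)%:E)%E.
    exact: emeasurable_funD.
  have E0 t w : (0 <= (3 * e)%:E + q%:E * (h t w ^+ 2)%:E)%E by exact: adde_ge0.
  rewrite -(duhamelD hB T0 0 0 mhp mE hp0 E0).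
  apply: (le_duhamel hB).
  - apply/measurable_EFinP; apply: measurable_funD.
      apply: measurable_funD => //; apply: measurable_minr => //.
      exact: measurable_maxr.
    by apply: measurable_funM => //; exact: measurable_funX.
  - exact: (emeasurable_funD mhp mE).
  - move=> s x; rewrite lee_fin; apply: addr_ge0; last first.
      by apply: mulr_ge0; [exact: ltW|exact: sqr_ge0].
    apply: addr_ge0; last by apply: mulr_ge0; [|exact: ltW].
    by rewrite le_min M0' le_max lexx orbT.
  - move=> s x _; rewrite -EFinM -!EFinD lee_fin -addrA; apply: lerD => //.
    by rewrite ge_min lexx orbT.
apply: le_trans (leeD2l _ s1) _; rewrite addeA.
apply: le_trans (leeD2r _ main) _; rewrite s2.
apply: le_trans (leeD2r _ (leeD2l _ s3)) _.
set X1 := heat T0 _ 0; set D1 := duhamel T0 _ 0 0.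
rewrite (addeACA X1) -(addeA (X1 + D1)%E).
suff le_eps : ((A / r ^+ 2)%:E + (3 * e * T0 + q * H)%:E + (q * H)%:E <= eps%:E)%E.
  exact: (leeD2l _ le_eps).
by rewrite -!EFinD lee_fin; lra.
Qed.

End one_sided.
End comparison.

(** * Feynman-Kac formula along a Brownian motion *)

Section feynman_kac_abstract.
Context {R : realType} {d : nat} {dO : measure_display} {Omega : measurableType dO}.
Variables (P : probability Omega R) (B : R -> Omega -> 'cV[R]_d).
Hypothesis hB : brownian P B.
Local Notation heat := (heat P B).
Local Notation duhamel := (duhamel P B).
Implicit Types (t r s : R) (w z : 'cV[R]_d).
Variable T0 : R.
Hypothesis T0_gt0 : 0 < T0.
Let hB1 i := brownian_coord hB i.

Lemma sqsum_shift_L2 s w : 0 <= s -> L2 P (fun om => sqsum (w + B s om)).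
Proof.
move=> s0; rewrite /sqsum; apply: L2_sum => i.
set b := fun om => B s om i ord0; set a := w i ord0.
have lb : L2 P b by exact: brownian1_L2 (hB1 i) _ s0.
have lb2 : L2 P (fun om => b om ^+ 2) by exact: brownian1_sqr_L2 (hB1 i) _ s0.
have := L2D (L2D (L2_cst P (a ^+ 2)) (L2Z (2 * a) lb)) lb2.
by congr (L2 P); apply/funext => om; rewrite !mxE -/a -/(b om); ring.
Qed.

Lemma quadratic_shift_L2 (v : 'cV[R]_d -> R) (C : R) s w : 0 <= s ->
  measurable_fun setT v -> (forall x, `|v x| <= C * (1 + sqsum x)) ->
  L2 P (fun om => v (w + B s om)).
Proof.
move=> s0 mv vC.
have lq : L2 P (fun om => C * (1 + sqsum (w + B s om))).
  by apply: L2Z; apply: L2D; [exact: L2_cst|exact: sqsum_shift_L2].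
apply: (le_L2 _ lq).
  apply: (measurableT_comp mv); apply: measurable_addmx => //.
  exact: (measurable_brownian hB).
move=> om; rewrite -(real_normK (num_real (v _))).
have := vC (w + B s om) => h.
by rewrite ler_sqr ?nnegrE// (le_trans _ h).
Qed.

Section one_sided.
Variables (v h : R -> 'cV[R]_d -> R) (C : R).
Hypothesis mv : forall t, 0 <= t <= T0 -> measurable_fun setT (v t).
Hypothesis vC : forall t w, 0 <= t <= T0 -> `|v t w| <= C * (1 + sqsum w).
Hypothesis mh : measurable_fun setT (fun z : R * 'cV[R]_d => h z.1 z.2).
Hypothesis hc : cyl_unif_cont T0 h.
Hypothesis hb : forall r : R, exists M : R, forall t w, 0 <= t <= T0 ->
  `|w| <= r -> `|h t w| <= M.
Hypothesis hstep : forall r e : R, 0 < e -> exists2 eta, 0 < eta &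
  forall (t dl : R) w, 0 <= t -> 0 < dl -> dl <= eta -> t + dl <= T0 -> `|w| <= r ->
  `|\int[P]_om v (t + dl)%R (w + B dl om) - v t w + dl * h t w| <= dl * e.
Hypothesis h2_fin : (duhamel T0 (fun t w => (h t w ^+ 2)%:E) 0 0 < +oo)%E.

Let T00 : 0 <= T0. Proof. exact: ltW. Qed.
Let TT : 0 <= T0 <= T0. Proof. by rewrite T00 lexx. Qed.

Let C0 : 0 <= C.
Proof.
have := vC 0 TT; move=> /(le_trans (normr_ge0 _)).
by rewrite pmulr_lge0// ltr_pwDl// sqsum_ge0.
Qed.

(** The added term makes [V] nonnegative without changing the source, since it
    solves the backward heat equation. *)
Let V t w : R := v t w + C * (1 + sqsum w + d%:R * (T0 - t)).

Let heat_V t s w : 0 <= t <= T0 -> 0 <= s -> heat s (EFin \o V t) w =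
  (\int[P]_om v t (w + B s om) + C * (1 + sqsum w + d%:R * (T0 - t + s)))%:E.
Proof.
move=> tT s0.
have lv := quadratic_shift_L2 w s0 (mv tT) (fun x => vC x tT).
have lq := sqsum_shift_L2 w s0.
have c0 : 0 <= C * (1 + d%:R * (T0 - t)).
  by rewrite mulr_ge0// addr_ge0// mulr_ge0// subr_ge0; have /andP[] := tT.
have E : heat s (fun x => (C * (1 + d%:R * (T0 - t)) + C * sqsum x)%:E) w =
    (C * (1 + sqsum w + d%:R * (T0 - t + s)))%:E.
  by rewrite (heat_sqsum hB w s0 c0 C0); congr EFin; ring.
rewrite EFinD -E (Rintegral_EFin (L2_integrable lv)) /heat !max_l//.
rewrite -integralD//; last 2 first.
- exact: L2_integrable.
- by apply: L2_integrable; apply: L2D; [exact: L2_cst|exact: L2Z].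
apply: eq_integral => om _; rewrite /V /= -EFinD; congr EFin; ring.
Qed.

Let mV t : 0 <= t <= T0 -> measurable_fun setT (V t).
Proof.
move=> tT; apply: measurable_funD; first exact: mv.
apply: measurable_funM => //; apply: measurable_funD => //.
by apply: measurable_funD => //; exact: measurable_sqsum.
Qed.

Let V0 t w : 0 <= t <= T0 -> 0 <= V t w.
Proof.
move=> tT; have := vC w tT; rewrite ler_norml => /andP[h1 _].
have : 0 <= C * (d%:R * (T0 - t)).
  by rewrite !mulr_ge0// subr_ge0; have /andP[] := tT.
by rewrite /V; lra.
Qed.

Let VD t w : 0 <= t <= T0 -> V t w <= (C * (2 + d%:R * T0)) * (1 + sqsum w).
Proof.
move=> tT; have := vC w tT; rewrite ler_norml => /andP[_ h1].
have h2 : d%:R * (T0 - t) <= d%:R * T0 * (1 + sqsum w).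
  rewrite -[leLHS]mulr1; apply: ler_pM => //.
  - by rewrite mulr_ge0// subr_ge0; have /andP[] := tT.
  - by apply: ler_wpM2l => //; rewrite gerBl; have /andP[] := tT.
  - by rewrite lerDl sqsum_ge0.
have : C * (d%:R * (T0 - t)) <= C * (d%:R * T0 * (1 + sqsum w)) by exact: ler_wpM2l.
by rewrite /V; lra.
Qed.

Let step (r e : R) : 0 < e -> exists2 eta, 0 < eta &
  forall (t dl : R) w, 0 <= t -> 0 < dl -> dl <= eta -> t + dl <= T0 -> `|w| <= r ->
  ((V t w)%:E <= heat dl (EFin \o V (t + dl)%R) w + (dl * h t w + dl * e)%:E)%E.
Proof.
move=> e0; have [eta eta0 H] := hstep r e0; exists eta => // t dl w t0 dl0 dle tT wr.
have := H t dl w t0 dl0 dle tT wr; rewrite ler_norml => /andP[h1 _].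
have tdT : 0 <= t + dl <= T0 by rewrite tT addr_ge0// ltW.
rewrite (heat_V w tdT (ltW dl0)) -EFinD lee_fin /V.
have -> : T0 - (t + dl) + dl = T0 - t by ring.
lra.
Qed.

Lemma feynman_kac_le :
  ((v 0 0)%:E + duhamel T0 (fun t w => (Num.max (- h t w) 0)%:E) 0 0
  <= (\int[P]_om v T0 (B T0 om))%:E + duhamel T0 (fun t w => (Num.max (h t w) 0)%:E) 0 0)%E.
Proof.
have := comparison hB T0_gt0 mV V0 VD mh hc step hb h2_fin.
rewrite (heat_V 0 TT T00) /V !subr0 subrr add0r.
set k := C * _; rewrite EFinD (EFinD (\int[P]_om _)).
under eq_Rintegral do rewrite add0r.
rewrite -!addeA !(addeC k%:E) !addeA leeD2rE//.
Qed.

End one_sided.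

(** The comparison applies to [v] and to [- v]. The means of the positive and
    the negative part of the source stay on separate sides, so that every
    integrand is nonnegative. *)
Lemma feynman_kac_abstract (v h : R -> 'cV[R]_d -> R) (C : R) :
  (forall t, 0 <= t <= T0 -> measurable_fun setT (v t)) ->
  (forall t w, 0 <= t <= T0 -> `|v t w| <= C * (1 + sqsum w)) ->
  measurable_fun setT (fun z : R * 'cV[R]_d => h z.1 z.2) ->
  cyl_unif_cont T0 h ->
  (forall r : R, exists M : R, forall t w, 0 <= t <= T0 ->
    `|w| <= r -> `|h t w| <= M) ->
  (forall r e : R, 0 < e -> exists2 eta, 0 < eta &
    forall (t dl : R) w, 0 <= t -> 0 < dl -> dl <= eta -> t + dl <= T0 -> `|w| <= r ->
    `|\int[P]_om v (t + dl)%R (w + B dl om) - v t w + dl * h t w| <= dl * e) ->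
  (duhamel T0 (fun t w => (h t w ^+ 2)%:E) 0 0 < +oo)%E ->
  ((v 0 0)%:E + duhamel T0 (fun t w => (Num.max (- h t w) 0)%:E) 0 0
  = (\int[P]_om v T0 (B T0 om))%:E + duhamel T0 (fun t w => (Num.max (h t w) 0)%:E) 0 0)%E.
Proof.
move=> mv vC mh hc hb hstep h2_fin; apply/le_anti/andP; split.
  exact: (feynman_kac_le mv vC mh hc hb hstep h2_fin).
have T00 : 0 <= T0 by exact: ltW.
have TT : 0 <= T0 <= T0 by rewrite T00 lexx.
have iv t s w : 0 <= t <= T0 -> 0 <= s -> P.-integrable setT (fun om => (v t (w + B s om))%:E).
  move=> tT s0; apply: L2_integrable.
  exact: (quadratic_shift_L2 w s0 (mv _ tT) (fun x => vC _ x tT)).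
have intN t s w : 0 <= t <= T0 -> 0 <= s ->
    \int[P]_om (- v t (w + B s om)) = - \int[P]_om (v t (w + B s om)).
  move=> tT s0; rewrite -mulN1r -RintegralZl//; last exact: iv.
  by apply: eq_Rintegral => om _; rewrite mulN1r.
have a1 t : 0 <= t <= T0 -> measurable_fun setT (fun w => - v t w).
  by move=> tT; apply: measurableT_comp => //; exact: mv.
have a2 t w : 0 <= t <= T0 -> `|- v t w| <= C * (1 + sqsum w).
  by move=> tT; rewrite normrN; exact: vC.
have a3 : measurable_fun setT (fun z : R * 'cV[R]_d => - h z.1 z.2).
  exact: measurableT_comp.
have a4 : cyl_unif_cont T0 (fun t w => - h t w).
  move=> r e e0; have [rh rh0 H] := hc r e e0; exists rh => // t t' w z h1 h2 h3 h4 h5.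
  by rewrite -normrN opprD !opprK; exact: H.
have a5 r : exists M : R, forall t w, 0 <= t <= T0 -> `|w| <= r -> `|- h t w| <= M.
  by have [M HM] := hb r; exists M => t w tT wr; rewrite normrN HM.
have a6 (r e : R) : 0 < e -> exists2 eta, 0 < eta &
    forall (t dl : R) w, 0 <= t -> 0 < dl -> dl <= eta -> t + dl <= T0 -> `|w| <= r ->
    `|\int[P]_om (- v (t + dl)%R (w + B dl om)) - - v t w + dl * - h t w| <= dl * e.
  move=> e0; have [eta eta0 H] := hstep r e e0; exists eta => // t dl w t0 dl0 dle tT wr.
  rewrite intN ?(ltW dl0)//; last by rewrite tT addr_ge0// ltW.
  by rewrite -normrN mulrN !opprD !opprK; exact: H.
have a7 : (duhamel T0 (fun t w => ((- h t w) ^+ 2)%:E) 0 0 < +oo)%E.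
  by under eq_fun do under eq_fun do rewrite sqrrN.
have := feynman_kac_le a1 a2 a3 a4 a5 a6 a7.
have -> : \int[P]_om (- v T0 (B T0 om)) = - \int[P]_om (v T0 (B T0 om)).
  have := intN T0 T0 0 TT T00; under eq_Rintegral do rewrite add0r.
  by under [X in _ = - X]eq_Rintegral do rewrite add0r.
have -> : (fun t w => (Num.max (- - h t w) 0)%:E) = (fun t w => (Num.max (h t w) 0)%:E).
  by apply/funext => t; apply/funext => w; rewrite opprK.
set X := duhamel _ _ _ _; set Y := duhamel _ _ _ _; set I := \int[P]_om _.
move=> hh.
have : ((v 0 0)%:E + ((- v 0 0)%:E + X) + I%:E <= (v 0 0)%:E + ((- I)%:E + Y) + I%:E)%E.
  by apply: leeD2r; exact: leeD2l.
rewrite addeA -EFinD subrr add0e addeC => /le_trans; apply.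
by rewrite -addeA (addeAC (- I)%:E) -EFinD addNr add0e.
Qed.

End feynman_kac_abstract.

(** * Feynman-Kac formula for the diffusion *)

Section has_mean.
Context {R : realType} {dO : measure_display} {Omega : measurableType dO}.
Variable P : probability Omega R.
Implicit Types X Y : Omega -> R.

(** Integrability and the value of the mean are carried together, so that both
    propagate through sums by a single lemma. *)
Definition has_mean X (m : R) :=
  P.-integrable setT (fun w => (X w)%:E) /\ \int[P]_w X w = m.

Lemma has_mean_cst (c : R) : has_mean (fun=> c) c.
Proof. by split; [exact: prob_integrable_cst|exact: Rintegral_prob_cst]. Qed.

Lemma has_meanD X Y (m n : R) : has_mean X m -> has_mean Y n ->
  has_mean (fun w => X w + Y w) (m + n).
Proof.
move=> [iX <-] [iY <-]; split; last by rewrite RintegralD.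
by under eq_fun do rewrite EFinD; exact: integrableD.
Qed.

Lemma has_meanZ X (c m : R) : has_mean X m -> has_mean (fun w => c * X w) (c * m).
Proof.
move=> [iX <-]; split; last by rewrite RintegralZl.
by under eq_fun do rewrite EFinM; exact: integrableZl.
Qed.

Lemma has_mean_sum (I : Type) (r : seq I) (F : I -> Omega -> R) (m : I -> R) :
  (forall i, has_mean (F i) (m i)) ->
  has_mean (fun w => \sum_(i <- r) F i w) (\sum_(i <- r) m i).
Proof.
move=> FE; elim: r => [|i r IH].
  by rewrite big_nil; under eq_fun do rewrite big_nil; exact: has_mean_cst.
by rewrite big_cons; under eq_fun do rewrite big_cons; exact: has_meanD.
Qed.

Lemma has_mean_EFin X (m : R) : measurable_fun setT X -> (forall w, 0 <= X w) ->
  (\int[P]_w (X w)%:E = m%:E)%E -> has_mean X m.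
Proof.
move=> mX X0 XE; split; last by rewrite /Rintegral XE.
apply/integrableP; split; first exact/measurable_EFinP.
under eq_integral do rewrite abse_EFin ger0_norm//.
by rewrite XE ltry.
Qed.

Lemma has_mean_dist X Y Z (m n k : R) : has_mean X m -> has_mean Y n -> has_mean Z k ->
  (forall w, `|X w - Y w| <= Z w) -> `|m - n| <= k.
Proof.
move=> hX hY hZ XYZ.
have [iD _] := has_meanD hX (has_meanZ (-1) hY); have [iZ <-] := hZ.
have XY w : X w + -1 * Y w = X w - Y w by rewrite mulN1r.
have -> : m - n = \int[P]_w (X w + -1 * Y w).
  by have [_ ->] := has_meanD hX (has_meanZ (-1) hY); rewrite mulN1r.
apply: le_trans (le_normr_Rintegral measurableT iD) _.
apply: le_Rintegral => //; first exact: (integrable_norm iD).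
by move=> w _; rewrite XY.
Qed.

End has_mean.

Section feynman_kac.
Context {R : realType} {d : nat}.
Variables (T : R) (mu : 'cV[R]_d) (sigma : 'M[R]_d) (u : R -> 'cV[R]_d -> R).
Hypotheses (hu : C12 T u) (hgrowth : quadratic_growth T u).
Implicit Types (t s r : R) (w x y : 'cV[R]_d).
Local Notation A := (sigma *m sigma^T).

Definition position y t w : 'cV[R]_d := y + t *: mu + sigma *m w.

Lemma positionD y t dl w z : position y (t + dl) (w + z) = (dl *: mu + sigma *m z) + position y t w.
Proof.
rewrite /position scalerDl mulmxDr; apply/colP => i; rewrite !mxE.
by move: (\sum_j _) (\sum_j _) => a b; ring.
Qed.

Lemma mulmx_norm_le w : `|sigma *m w| <= d%:R * `|sigma| * `|w|.
Proof.
apply: mx_norm_le => [|i j]; first by rewrite !mulr_ge0.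
rewrite mxE; apply: le_trans (ler_norm_sum _ _ _) _.
apply: (@le_trans _ _ (\sum_(k < d) `|sigma| * `|w|)); last first.
  by rewrite sumr_const card_ord -mulrA mulr_natl.
by apply: ler_sum => k _; rewrite normrM ler_pM// le_mx_norm_entry.
Qed.

Lemma generatorE t x : generator mu sigma u t x =
  \sum_i mu i ord0 * dx i u t x + 2^-1 * \sum_i \sum_j A i j * dxx i j u t x.
Proof.
rewrite /generator; congr (_ + 2^-1 * _).
have As i j : A i j = A j i.
  by rewrite -[in LHS](trmxK sigma) -{1}trmx_mul trmxK mxE.
rewrite /mxtrace exchange_big; apply: eq_bigr => i _ /=; rewrite mxE.
by apply: eq_bigr => j _; rewrite [hessian _ _ _ _ _]mxE As.
Qed.

(** By the equation this is [f t x (u t x)] before [T]. Written with the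
    derivatives of [u] it is continuous on the slab, whereas the driver is only
    measurable. *)
Definition source t x : R :=
  if 0 <= t <= T then - dt T u t x - generator mu sigma u t x else 0.

Let op t x := - dt T u t x - generator mu sigma u t x.

Let within_sum (I : Type) (r : seq I) (F : I -> R * 'cV[R]_d -> R) :
  (forall i, {within slab T, continuous (F i)}) ->
  {within slab T, continuous (fun z => \sum_(i <- r) F i z)}.
Proof.
move=> cF; elim: r => [|i r IH].
  by under eq_fun do rewrite big_nil; move=> z; exact: cvg_cst.
under eq_fun do rewrite big_cons; exact: within_continuousD.
Qed.

Let within_Z (c : R) (F : R * 'cV[R]_d -> R) :
  {within slab T, continuous F} -> {within slab T, continuous (fun z => c * F z)}.
Proof. by move=> cF z; apply: cvgM; [exact: cvg_cst|exact: cF]. Qed.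

Lemma source_continuous : {within slab T, continuous (fun z => op z.1 z.2)}.
Proof.
rewrite (_ : (fun z => op z.1 z.2) = (fun z => -1 * (dt T u z.1 z.2 +
   (\sum_i mu i ord0 * dx i u z.1 z.2 + 2^-1 * \sum_i \sum_j A i j * dxx i j u z.1 z.2)))).
  apply: within_Z; apply: within_continuousD; first exact: (C12_dt_cont hu).
  apply: within_continuousD.
    by apply: within_sum => i; apply: within_Z; exact: (C12_dx_cont hu).
  apply: within_Z; apply: within_sum => i; apply: within_sum => j; apply: within_Z.
  exact: (C12_dxx_cont hu).
by apply/funext => z; rewrite /op generatorE; ring.
Qed.

Let measurable_on_slab (F : R -> 'cV[R]_d -> R) :
  {within slab T, continuous (fun z => F z.1 z.2)} ->
  measurable_fun setT (fun z : R * 'cV[R]_d => if 0 <= z.1 <= T then F z.1 z.2 else 0).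
Proof.
move=> cF.
have mS : measurable (slab T : set (R * 'cV[R]_d)).
  rewrite (_ : slab T = `[0, T]%classic `*` setT).
    by apply: measurableX => //; exact: measurable_itv.
  by apply/seteqP; split=> z; rewrite /slab /= in_itv /=; [move=> ?; split|case].
have := within_continuous_measurable (i := @idfun (R * 'cV[R]_d)%type)
  (fun O oO => open_measurable_prod oO) mS cF.
move=> /(measurable_restrictT _ mS).
apply: eq_measurable_fun => z _; rewrite /patch /=; case: ifPn => [|/negP] zT; case: ifPn => //.
  by move: zT; rewrite inE /slab /= => ->.
by move=> z0; case: zT; rewrite inE.
Qed.

Lemma measurable_source : measurable_fun setT (fun z : R * 'cV[R]_d => source z.1 z.2).
Proof. exact: (@measurable_on_slab op source_continuous). Qed.

Lemma measurable_solution :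
  measurable_fun setT (fun z : R * 'cV[R]_d => if 0 <= z.1 <= T then u z.1 z.2 else 0).
Proof. exact: (@measurable_on_slab u (C12_cont hu)). Qed.

Context {dO : measure_display} {Omega : measurableType dO}.
Variables (P : probability Omega R) (B : R -> Omega -> 'cV[R]_d).
Hypothesis hB : brownian P B.
Let hB1 i := brownian_coord hB i.

Let inc dl om : 'cV[R]_d := dl *: mu + sigma *m B dl om.

Let coord_mean dl i : 0 <= dl -> has_mean P (fun om => B dl om i ord0) 0.
Proof.
move=> dl0; split; last exact: (brownian_coord_mean hB).
by apply: L2_integrable; exact: (brownian_coord_L2 hB).
Qed.

Let coord_cov dl i j : 0 <= dl ->
  has_mean P (fun om => B dl om i ord0 * B dl om j ord0) ((i == j)%:R * dl).
Proof.
move=> dl0; split; last exact: (brownian_cov hB).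
by apply: L2_mul_integrable; exact: (brownian_coord_L2 hB).
Qed.

Let incE dl om i : inc dl om i ord0 = dl * mu i ord0 + \sum_k sigma i k * B dl om k ord0.
Proof. by rewrite /inc !mxE. Qed.

Let inc_mean dl i : 0 <= dl -> has_mean P (fun om => inc dl om i ord0) (dl * mu i ord0).
Proof.
move=> dl0; under eq_fun do rewrite incE.
rewrite -[X in has_mean _ _ X]addr0; apply: has_meanD; first exact: has_mean_cst.
have := has_mean_sum (index_enum _) (fun k => has_meanZ (sigma i k) (coord_mean k dl0)).
by rewrite big1// => k _; rewrite mulr0.
Qed.

Let inc_cov dl i j : 0 <= dl ->
  has_mean P (fun om => inc dl om i ord0 * inc dl om j ord0)
    (dl ^+ 2 * (mu i ord0 * mu j ord0) + dl * A i j).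
Proof.
move=> dl0.
have -> : (fun om => inc dl om i ord0 * inc dl om j ord0) = (fun om =>
   - (dl ^+ 2 * (mu i ord0 * mu j ord0)) +
   (dl * mu i ord0 * inc dl om j ord0 + dl * mu j ord0 * inc dl om i ord0) +
   \sum_k \sum_l sigma i k * sigma j l * (B dl om k ord0 * B dl om l ord0)).
  apply/funext => om; rewrite !incE.
  have -> : \sum_k \sum_l sigma i k * sigma j l * (B dl om k ord0 * B dl om l ord0) =
     (\sum_k sigma i k * B dl om k ord0) * (\sum_k sigma j k * B dl om k ord0).
    rewrite mulr_suml; apply: eq_bigr => k _; rewrite mulr_sumr; apply: eq_bigr => l _.
    by ring.
  by ring.
have -> : dl ^+ 2 * (mu i ord0 * mu j ord0) + dl * A i j =
   - (dl ^+ 2 * (mu i ord0 * mu j ord0)) +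
   (dl * mu i ord0 * (dl * mu j ord0) + dl * mu j ord0 * (dl * mu i ord0)) +
   \sum_k \sum_l sigma i k * sigma j l * ((k == l)%:R * dl).
  have -> : \sum_k \sum_l sigma i k * sigma j l * ((k == l)%:R * dl) = dl * A i j.
    rewrite !mxE mulr_sumr; apply: eq_bigr => k _; rewrite (bigD1 k)//= eqxx mxE.
    rewrite mulr1n big1 => [|l /negPf lk]; first by ring.
    by rewrite eq_sym lk mul0r mulr0.
  by ring.
apply: has_meanD; first apply: has_meanD.
- exact: has_mean_cst.
- by apply: has_meanD; apply: has_meanZ; exact: inc_mean.
- by apply: has_mean_sum => k; apply: has_mean_sum => l; apply: has_meanZ; exact: coord_cov.
Qed.

(** The first two moments of the increment turn the Taylor polynomial into
    [u - dl * op], the drift leaving a correction of order [dl ^+ 2]. *)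
Let taylor_mean t x dl : 0 <= dl -> has_mean P (fun om => taylor_poly T u t x dl (inc dl om))
  (u t x - dl * op t x
    + dl ^+ 2 * (2^-1 * \sum_i \sum_j mu i ord0 * mu j ord0 * dxx i j u t x)).
Proof.
move=> dl0.
have -> : u t x - dl * op t x
    + dl ^+ 2 * (2^-1 * \sum_i \sum_j mu i ord0 * mu j ord0 * dxx i j u t x) =
  u t x + dl * dt T u t x + \sum_i dx i u t x * (dl * mu i ord0)
  + 2^-1 * \sum_i \sum_j dxx i j u t x * (dl ^+ 2 * (mu i ord0 * mu j ord0) + dl * A i j).
  have -> : \sum_i dx i u t x * (dl * mu i ord0) = dl * \sum_i mu i ord0 * dx i u t x.
    by rewrite mulr_sumr; apply: eq_bigr => i _; ring.
  have -> : \sum_i \sum_j dxx i j u t x * (dl ^+ 2 * (mu i ord0 * mu j ord0) + dl * A i j)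
     = dl ^+ 2 * (\sum_i \sum_j mu i ord0 * mu j ord0 * dxx i j u t x)
     + dl * (\sum_i \sum_j A i j * dxx i j u t x).
    rewrite !mulr_sumr -big_split; apply: eq_bigr => i _ /=.
    by rewrite !mulr_sumr -big_split; apply: eq_bigr => j _ /=; ring.
  by rewrite /op generatorE; ring.
apply: has_meanD; first apply: has_meanD; first exact: has_mean_cst.
  apply: has_mean_sum => i; under eq_fun do rewrite mulrC.
  by apply: has_meanZ; exact: inc_mean.
apply: has_meanZ; apply: has_mean_sum => i; apply: has_mean_sum => j.
under eq_fun do rewrite mulrA mulrC.
by apply: has_meanZ; exact: inc_cov.
Qed.

Let norm_quart w : `|w| ^+ 4 <= quart w.
Proof.
have q0 := quart_ge0 w; have sq0 : 0 <= Num.sqrt (quart w) by exact: sqrtr_ge0.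
have wq : `|w| <= Num.sqrt (Num.sqrt (quart w)).
  apply: mx_norm_le => [|i j]; first exact: sqrtr_ge0.
  rewrite -sqrtr_sqr ler_wsqrtr// -[leLHS]ger0_norm ?sqr_ge0// -sqrtr_sqr ler_wsqrtr//.
  rewrite -exprM ord1 /quart (bigD1 i)//= lerDl.
  by apply: sumr_ge0 => k _; rewrite (exprM _ 2 2) sqr_ge0.
have -> : quart w = Num.sqrt (Num.sqrt (quart w)) ^+ 4.
  by rewrite (exprM _ 2 2) sqr_sqrtr// sqr_sqrtr.
by apply: lerXn2r; rewrite ?nnegrE ?sqrtr_ge0 ?normr_ge0.
Qed.

(** The error committed by the Taylor polynomial over a step [dl], integrated
    against the increment, is negligible with respect to [dl]. *)
Lemma one_step (r e : R) : 0 < e -> exists2 eta, 0 < eta & forall t (dl : R) x,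
  0 <= t -> 0 < dl -> dl <= eta -> t + dl <= T -> `|x| <= r ->
  L2 P (fun om => u (t + dl) (inc dl om + x)) ->
  `|\int[P]_om u (t + dl) (inc dl om + x) - u t x + dl * op t x| <= dl * e.
Proof.
move=> e0; pose m := `|mu|; have m0 : 0 <= m by exact: normr_ge0.
have [c c0 mulmx_le] : exists2 c : R, 0 <= c & forall w, `|sigma *m w| <= c * `|w|.
  by exists (d%:R * `|sigma|); [rewrite mulr_ge0|exact: mulmx_norm_le].
pose k1 : R := 1 + 2 * m ^+ 2 + 2 * c ^+ 2 * d%:R.
have k10 : 0 < k1.
  have : 0 <= m ^+ 2 by exact: sqr_ge0.
  have : 0 <= c ^+ 2 * d%:R by rewrite mulr_ge0// sqr_ge0.
  by rewrite /k1; lra.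
have e10 : 0 < e / 2 / k1 by rewrite !divr_gt0.
have [eta1 [C [eta10 C0 H]]] := taylor_global hu hgrowth r e10.
pose Th (z : R * 'cV[R]_d) := 2^-1 * \sum_i \sum_j mu i ord0 * mu j ord0 * dxx i j u z.1 z.2.
have cTh : {within slab T, continuous Th}.
  apply: within_Z; apply: within_sum => i; apply: within_sum => j; apply: within_Z.
  exact: (C12_dxx_cont hu).
have [M M0 HM] := bounded_cyl r cTh.
pose k2 : R := 8 * C * m ^+ 4 + 24 * C * c ^+ 4 * d%:R + M.
have k20 : 0 <= k2.
  have : 0 <= C * m ^+ 4 by rewrite mulr_ge0// exprn_ge0.
  have : 0 <= C * c ^+ 4 * d%:R by rewrite mulr_ge0// mulr_ge0// exprn_ge0.
  by rewrite /k2; move: M0; lra.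
pose eta := Num.min eta1 (Num.min 1 (e / 2 / (k2 + 1))).
exists eta; first by rewrite !lt_min eta10 ltr01 !divr_gt0// ltr_wpDl.
move=> t dl x t0 dl0; rewrite !le_min => /and3P[d1 d2 d3] tT xr lu.
have dl0' := ltW dl0.
have tT' : 0 <= t <= T by rewrite t0 (le_trans _ tT)// lerDl.
pose Err om := (e / 2 / k1) * (dl + (2 * dl ^+ 2 * m ^+ 2 + 2 * c ^+ 2 * sqsum (B dl om)))
   + C * (8 * dl ^+ 4 * m ^+ 4 + 8 * c ^+ 4 * quart (B dl om)).
have mB : measurable_fun setT (B dl) by exact: (measurable_brownian hB).
have hsq : has_mean P (fun om => sqsum (B dl om)) (d%:R * dl).
  apply: has_mean_EFin.
  - exact: (measurableT_comp measurable_sqsum mB).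
  - by move=> om; exact: sqsum_ge0.
  have := brownian_sqsum hB dl0' (lexx 0) ler01.
  by rewrite add0r mul1r; under eq_integral do rewrite add0r mul1r.
have hqu : has_mean P (fun om => quart (B dl om)) (d%:R * (3 * dl ^+ 2)).
  apply: has_mean_EFin.
  - exact: (measurableT_comp measurable_quart mB).
  - by move=> om; exact: quart_ge0.
  have := brownian_quart hB dl0'; rewrite /heat max_l//.
  by under eq_integral do rewrite add0r.
have hE : has_mean P Err ((e / 2 / k1) * (dl + (2 * dl ^+ 2 * m ^+ 2 + 2 * c ^+ 2 * (d%:R * dl)))
   + C * (8 * dl ^+ 4 * m ^+ 4 + 8 * c ^+ 4 * (d%:R * (3 * dl ^+ 2)))).
  apply: has_meanD; apply: has_meanZ; apply: has_meanD; first exact: has_mean_cst.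
  - by apply: has_meanD; [exact: has_mean_cst|exact: has_meanZ].
  - exact: has_mean_cst.
  - exact: has_meanZ.
have hU : has_mean P (fun om => u (t + dl) (inc dl om + x))
    (\int[P]_om u (t + dl) (inc dl om + x)).
  by split => //; exact: L2_integrable.
have hT := taylor_mean t x dl0'.
have dist om : `|u (t + dl) (inc dl om + x) - taylor_poly T u t x dl (inc dl om)| <= Err om.
  apply: le_trans (H t x dl (inc dl om) t0 dl0 d1 tT xr) _.
  have n1 : `|inc dl om| <= dl * m + c * `|B dl om|.
    apply: le_trans (ler_normD _ _) _; apply: lerD; last exact: mulmx_le.
    by rewrite normrZ ger0_norm.
  set b := `|B dl om| in n1; have b0 : 0 <= b by exact: normr_ge0.
  set z := `|inc dl om| in n1 *; have z0 : 0 <= z by exact: normr_ge0.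
  have p0 : 0 <= dl * m by rewrite mulr_ge0.
  have q0 : 0 <= c * b by rewrite mulr_ge0.
  have n2 : z ^+ 2 <= 2 * (dl * m) ^+ 2 + 2 * (c * b) ^+ 2.
    have : 0 <= (dl * m - c * b) ^+ 2 by exact: sqr_ge0.
    have : z ^+ 2 <= (dl * m + c * b) ^+ 2 by rewrite ler_sqr ?nnegrE// addr_ge0.
    by move: (dl * m) (c * b) => p q; nra.
  have n4 : z ^+ 4 <= 8 * (dl * m) ^+ 4 + 8 * (c * b) ^+ 4.
    have : z ^+ 2 * z ^+ 2 <= (2 * (dl * m) ^+ 2 + 2 * (c * b) ^+ 2) ^+ 2.
      by rewrite [leRHS]expr2 ler_pM ?sqr_ge0.
    rewrite -exprD; have : 0 <= ((dl * m) ^+ 2 - (c * b) ^+ 2) ^+ 2 by exact: sqr_ge0.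
    rewrite !(exprM _ 2 2); move: ((dl * m) ^+ 2) ((c * b) ^+ 2) (z ^+ 2 ^+ 2) => p q y; nra.
  have b2 : b ^+ 2 <= sqsum (B dl om) by exact: norm_sqsum.
  have b4 : b ^+ 4 <= quart (B dl om) by exact: norm_quart.
  apply: lerD; apply: ler_wpM2l => //; first exact: ltW.
    apply: lerD => //; apply: le_trans n2 _; rewrite !exprMn (mulrA 2 (c ^+ 2)) (mulrA 2 (dl ^+ 2)) lerD2l.
    by apply: ler_wpM2l => //; rewrite mulr_ge0// sqr_ge0.
  apply: le_trans n4 _; rewrite !exprMn (mulrA 8 (c ^+ 4)) (mulrA 8 (dl ^+ 4)) lerD2l.
  by apply: ler_wpM2l => //; rewrite mulr_ge0// exprn_ge0.
have := has_mean_dist hU hT hE dist.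
set I := \int[P]_om _ => hI.
have hM : `|dl ^+ 2 * Th (t, x)| <= dl ^+ 2 * M.
  rewrite normrM ger0_norm ?sqr_ge0// ler_wpM2l ?sqr_ge0//.
  by apply: HM; split.
have bnd : (e / 2 / k1) * (dl + (2 * dl ^+ 2 * m ^+ 2 + 2 * c ^+ 2 * (d%:R * dl)))
   <= dl * (e / 2).
  have : dl + (2 * dl ^+ 2 * m ^+ 2 + 2 * c ^+ 2 * (d%:R * dl)) <= dl * k1.
    have : dl * (dl * m ^+ 2) <= dl * m ^+ 2.
      by rewrite ler_wpM2l//; rewrite -[leRHS]mul1r ler_wpM2r// sqr_ge0.
    by rewrite /k1 expr2; lra.
  move=> /(ler_wpM2l (ltW e10)) /le_trans; apply.
  suff -> : e / 2 / k1 * (dl * k1) = dl * (e / 2) by [].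
  by field; rewrite gt_eqF.
have bnd2 : C * (8 * dl ^+ 4 * m ^+ 4 + 8 * c ^+ 4 * (d%:R * (3 * dl ^+ 2))) + dl ^+ 2 * M
   <= dl * (e / 2).
  have s1 : dl ^+ 4 <= dl ^+ 2.
    by rewrite (exprD _ 2 2) -[leRHS]mulr1 ler_wpM2l ?sqr_ge0// exprn_ile1.
  have s2 : C * (8 * dl ^+ 4 * m ^+ 4) <= C * (8 * dl ^+ 2 * m ^+ 4).
    by rewrite ler_wpM2l// ler_wpM2r ?exprn_ge0// ler_wpM2l.
  have s3 : dl * k2 <= e / 2.
    have : dl * (k2 + 1) <= e / 2 by rewrite -ler_pdivlMr// ltr_wpDl.
    by rewrite mulrDr; lra.
  have := ler_wpM2l dl0' s3; apply: le_trans; move: s2; rewrite /k2.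
  have -> : dl ^+ 2 = dl * dl by rewrite expr2.
  by lra.
have -> : I - u t x + dl * op t x = (I - (u t x - dl * op t x + dl ^+ 2 * Th (t, x)))
   + dl ^+ 2 * Th (t, x) by ring.
apply: le_trans (ler_normD _ _) _.
apply: le_trans (lerD hI hM) _; lra.
Qed.

Lemma measurable_position (dE : measure_display) (E : measurableType dE)
    (y t' : E -> _) (w : E -> 'cV[R]_d) :
  measurable_fun setT y -> measurable_fun setT t' -> measurable_fun setT w ->
  measurable_fun setT (fun z => position (y z) (t' z) (w z)).
Proof.
move=> my mt mw; apply: measurable_addmx; last exact: measurable_mulmxl.
by apply: measurable_addmx => //; exact: measurable_scalemx.
Qed.

Section started_at.
Variables (s : R) (y : 'cV[R]_d).
Hypothesis sT : 0 <= s < T.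
Let T0 : R := T - s.
(** Along the diffusion, the solution is a function of the time and of the
    driving Brownian motion. *)
Let v t w := u (s + t) (position y t w).
Let h t w := source (s + t) (position y t w).

Let T0_gt0 : 0 < T0. Proof. by rewrite subr_gt0; have /andP[] := sT. Qed.

Let in_slab t : 0 <= t <= T0 -> 0 <= s + t <= T.
Proof. by rewrite /T0; have /andP[] := sT; lra. Qed.

Let shift_bound : exists a c : R, [/\ 0 <= a, 0 <= c &
  forall t w, 0 <= t <= T0 -> `|position y t w| <= a + c * `|w|].
Proof.
exists (`|y| + T0 * `|mu|), (d%:R * `|sigma|); split.
- by rewrite addr_ge0// mulr_ge0// ltW.
- by rewrite mulr_ge0.
move=> t w /andP[t0 tT]; apply: le_trans (ler_normD _ _) _; apply: lerD; last exact: mulmx_norm_le.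
apply: le_trans (ler_normD _ _) _; rewrite lerD2l normrZ ger0_norm//.
exact: ler_wpM2r.
Qed.

Let mv t : 0 <= t <= T0 -> measurable_fun setT (v t).
Proof.
move=> tT; have := @measurable_slice _ _ _ _ _ _
  (fun t x => if 0 <= t <= T then u t x else 0) (s + t) measurable_solution.
rewrite in_slab// => mu1; apply: (measurableT_comp mu1).
exact: (@measurable_position _ _ (fun=> y) (fun=> t) id).
Qed.

Let mh : measurable_fun setT (fun z : R * 'cV[R]_d => h z.1 z.2).
Proof.
have mp : measurable_fun setT (fun z : R * 'cV[R]_d => (s + z.1, position y z.1 z.2)).
  apply: measurable_fun_pair; first exact: measurable_funD.
  exact: (@measurable_position _ _ (fun=> y) fst snd).
exact: (measurableT_comp measurable_source mp).
Qed.

Let vC : exists C : R, forall t w, 0 <= t <= T0 -> `|v t w| <= C * (1 + sqsum w).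
Proof.
have [C HC] := hgrowth; have [a [c [a0 c0 H]]] := shift_bound.
exists (`|C| * (1 + 2 * a ^+ 2 + 2 * c ^+ 2)) => t w tT.
apply: le_trans (HC _ _ (in_slab tT)) _.
apply: (@le_trans _ _ (`|C| * (1 + `|position y t w| ^+ 2))).
  by rewrite ler_wpM2r ?ler_norm// addr_ge0// sqr_ge0.
rewrite -mulrA; apply: ler_wpM2l => //.
have h1 : `|position y t w| ^+ 2 <= (a + c * `|w|) ^+ 2.
  by rewrite ler_sqr ?nnegrE ?H// addr_ge0// mulr_ge0.
have h2 : 0 <= (a - c * `|w|) ^+ 2 by exact: sqr_ge0.
have h3 : c ^+ 2 * `|w| ^+ 2 <= c ^+ 2 * sqsum w.
  by rewrite ler_wpM2l ?sqr_ge0// norm_sqsum.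
have h4 : 0 <= a ^+ 2 * sqsum w by rewrite mulr_ge0 ?sqr_ge0 ?sqsum_ge0.
have h5 : 0 <= sqsum w by exact: sqsum_ge0.
have h6 : 0 <= c ^+ 2 by exact: sqr_ge0.
by move: h1 h2 h3; move: (`|position _ _ _| ^+ 2) (`|w|) => p q; nra.
Qed.

Let source_in t w : 0 <= t <= T0 -> h t w = op (s + t) (position y t w).
Proof. by move=> tT; rewrite /h /source in_slab. Qed.

Let hc : cyl_unif_cont T0 h.
Proof.
move=> r e e0; have [a [c [a0 c0 H]]] := shift_bound.
have [eta eta0 U] := unif_continuous_cyl (a + c * r) source_continuous e0.
have m0 : 0 <= `|mu| by exact: normr_ge0.
pose c' := d%:R * `|sigma|; have c'0 : 0 <= c' by rewrite mulr_ge0.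
pose k := 1 + `|mu| + c'; have k0 : 0 < k by rewrite /k; lra.
pose rh := eta / 2 / k.
have rh0 : 0 < rh by rewrite !divr_gt0.
have rk : rh * k < eta by rewrite divfK ?gt_eqF//; lra.
have rk1 : rh < eta.
  have : rh * 1 <= rh * k by rewrite ler_wpM2l ?(ltW rh0)// /k; lra.
  by move: rk; rewrite mulr1; lra.
exists rh => // t t' w z tT t'T wr tt zr; rewrite !source_in// distrC ltW//.
apply: (U (s + t, position y t w) (s + t', position y t' (w + z))).
- split; first exact: in_slab.
  by apply: le_trans (H _ _ tT) _; rewrite lerD2l; exact: ler_wpM2l.
- exact: in_slab.
split; first by rewrite /ball /= opprD addrACA subrr add0r distrC (le_lt_trans tt).
have sd : `|position y t w - position y t' (w + z)| < eta.
  rewrite -normrN opprB (_ : t' = t + (t' - t)); last by ring.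
  rewrite positionD addrK; apply: le_lt_trans rk; apply: le_trans (ler_normD _ _) _.
  rewrite normrZ.
  have i1 : `|t' - t| * `|mu| <= rh * `|mu| by rewrite ler_wpM2r.
  have i2 : `|sigma *m z| <= rh * c'.
    by apply: le_trans (mulmx_norm_le _) _; rewrite mulrC; exact: ler_wpM2r.
  by apply: le_trans (lerD i1 i2) _; rewrite /k; lra.
split => // i j; rewrite /ball /=; apply: le_lt_trans sd.
by have := le_mx_norm_entry (position y t w - position y t' (w + z)) i j; rewrite !mxE.
Qed.

Let hb r : exists M : R, forall t w, 0 <= t <= T0 -> `|w| <= r -> `|h t w| <= M.
Proof.
have [a [c [a0 c0 H]]] := shift_bound.
have [M M0 HM] := bounded_cyl (a + c * r) source_continuous.
exists M => t w tT wr; rewrite source_in//.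
apply: (HM (s + t, position y t w)); split; first exact: in_slab.
by apply: le_trans (H _ _ tT) _; rewrite lerD2l; exact: ler_wpM2l.
Qed.

Let hstep (r e : R) : 0 < e -> exists2 eta, 0 < eta &
  forall (t dl : R) w, 0 <= t -> 0 < dl -> dl <= eta -> t + dl <= T0 -> `|w| <= r ->
  `|\int[P]_om v (t + dl)%R (w + B dl om) - v t w + dl * h t w| <= dl * e.
Proof.
move=> e0; have [a [c [a0 c0 H]]] := shift_bound.
have [eta eta0 U] := one_step (a + c * r) e0.
exists eta => // t dl w t0 dl0 dle tT wr.
have tdT : 0 <= t + dl <= T0 by rewrite tT addr_ge0// ltW.
have tT' : 0 <= t <= T0 by rewrite t0 (le_trans _ tT)// lerDl ltW.
have vE om : v (t + dl) (w + B dl om) = u (s + t + dl) (inc dl om + position y t w).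
  by rewrite /v positionD addrA.
have := U (s + t) dl (position y t w).
have -> : \int[P]_om v (t + dl) (w + B dl om) =
    \int[P]_om u (s + t + dl) (inc dl om + position y t w).
  by apply: eq_Rintegral => om _; exact: vE.
rewrite source_in//; apply => //.
- by have /andP[] := in_slab tT'.
- by have /andP[_] := in_slab tdT; rewrite addrA.
- by apply: le_trans (H _ _ tT') _; rewrite lerD2l; exact: ler_wpM2l.
have [C HC] := vC.
have := quadratic_shift_L2 hB w (ltW dl0) (mv tdT) (fun x => HC _ x tdT).
by under eq_fun do rewrite vE.
Qed.

(** The two parts of the source stay on separate sides, as in the abstract
    formula. Its second moment along the path is finite as soon as the payoff of
    a particle has a finite second moment. *)
Lemma feynman_kac :
  (\int[lebesgue_measure]_(r in `[0%R, T0])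
     \int[P]_om (source (s + r) (position y r (B r om)) ^+ 2)%:E < +oo)%E ->
  ((u s y)%:E + \int[lebesgue_measure]_(r in `[0%R, T0])
     \int[P]_om (Num.max (- source (s + r) (position y r (B r om))) 0)%:E =
  (\int[P]_om u T (position y T0 (B T0 om)))%:E + \int[lebesgue_measure]_(r in `[0%R, T0])
     \int[P]_om (Num.max (source (s + r) (position y r (B r om))) 0)%:E)%E.
Proof.
have dE (F : R -> R) : duhamel P B T0 (fun t w => (F (h t w))%:E) 0 0 =
    (\int[lebesgue_measure]_(r in `[0%R, T0])
     \int[P]_om (F (source (s + r) (position y r (B r om))))%:E)%E.
  rewrite /duhamel; apply: eq_integral => r; rewrite inE /= in_itv /= => /andP[r0 _].
  rewrite subr0 /heat (max_l r0); apply: eq_integral => om _.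
  by have -> : 0 + B r om = B r om by rewrite add0r.
have /= <- := dE (fun a => a ^+ 2).
have /= <- := dE (fun a => Num.max (- a) 0).
have /= <- := dE (fun a => Num.max a 0).
move=> h2; have [C HC] := vC.
have := feynman_kac_abstract hB T0_gt0 mv HC mh hc hb hstep h2.
rewrite /v addr0 (_ : position y 0 0 = y); last by rewrite /position scale0r mulmx0 !addr0.
by rewrite (_ : s + T0 = T)//; rewrite /T0; ring.
Qed.

Lemma solution_L2 : L2 P (fun om => u T (position y T0 (B T0 om))).
Proof.
have TT : 0 <= T0 <= T0 by rewrite lexx ltW.
have [C HC] := vC.
have := quadratic_shift_L2 hB 0 (ltW T0_gt0) (mv TT) (fun x => HC _ x TT).
under eq_fun do rewrite add0r /v.
by rewrite (_ : s + T0 = T)//; rewrite /T0; ring.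
Qed.

End started_at.
End feynman_kac.

(** * Sigma-algebras carried by the particles *)

Section node_sigma.
Context {R : realType} {d : nat} {dO : measure_display} {Omega : measurableType dO}.
Variables (P : probability Omega R) (lambda : R) (Q : set (seq nat)).
Variables (tau : seq nat -> Omega -> R) (W : seq nat -> R -> Omega -> 'cV[R]_d).
Hypothesis htau : switching_times P lambda Q tau.
Hypothesis hW : brownian_motions P Q W.
Hypothesis htauW : times_motions_indep P Q tau W.

(** The clock of a particle carries the flag [true], its motion [false]. *)
Definition node_sigma (i : seq nat * bool) : set (set Omega) :=
  if i.2 then sigma_of [set: unit] (fun _ => tau i.1) else sigma_process (W i.1).

Let QB : set (seq nat * bool) := [set i | Q i.1].

Lemma node_sigma_algebra i : QB i -> sigma_algebra setT (node_sigma i).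
Proof. by case: i => k [] _; exact: smallest_sigma_algebra. Qed.

Lemma node_sigma_measurable i : QB i -> node_sigma i `<=` measurable.
Proof.
case: i => k [] /= Qk; apply: sub_sigma_of.
  by move=> _ _; exact: (switching_meas htau).
by move=> ti /= t0; exact: (brownian1_meas (brownian_coord (motions_law hW Qk) ti.2)).
Qed.

Let bigcap_sub (J : {fset seq nat}) (A : seq nat -> set Omega) (S : set (set Omega)) :
  sigma_algebra setT S -> (forall k, k \in J -> S (A k)) -> S (\bigcap_(k in [set` J]) A k).
Proof.
move=> sS SA; rewrite -(sigma_algebra_id sS).
apply: (@fin_bigcap_measurable _ (g_sigma_algebraType S)) => //.
by move=> k /SA; rewrite -{1}(sigma_algebra_id sS).
Qed.

(** A finite intersection splits into its clock events and its motion events;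
    the two families are independent of each other, and each of them satisfies
    its own product rule. *)
Lemma node_independent : independent_family P QB node_sigma.
Proof.
move=> J A JQ SA.
pose part b : {fset seq nat} := seq_fset tt [seq i.1 | i <- J & i.2 == b].
have partE b k : (k \in part b) = ((k, b) \in J).
  rewrite /part seq_fsetE; apply/mapP/idP => [[[k' b'] + /= ->]|kJ].
    by rewrite mem_filter => /andP[/eqP <-].
  by exists (k, b) => //; rewrite mem_filter eqxx.
have capE : \bigcap_(i in [set` J]) A i =
    (\bigcap_(k in [set` part true]) A (k, true)) `&`
    (\bigcap_(k in [set` part false]) A (k, false)).
  apply/seteqP; split => [w h|w [h1 h2] [k b] /= kJ].
    by split => k /=; rewrite partE => kJ; exact: h.
  by case: b kJ => kJ; [apply: h1|apply: h2]; rewrite /= partE.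
have prodE : (\prod_(i <- J) P (A i) =
    (\prod_(k <- part true) P (A (k, true))) * (\prod_(k <- part false) P (A (k, false))))%E.
  rewrite -(big_map (fun k => (k, true)) xpredT (fun i => P (A i))).
  rewrite -(big_map (fun k => (k, false)) xpredT (fun i => P (A i))) -big_cat /=.
  apply: perm_big; apply: uniq_perm; first exact: fset_uniq.
    rewrite cat_uniq !map_inj_uniq; try by move=> ? ? [].
    rewrite !(fset_uniq (part _)) andbT /=.
    by apply/hasPn => -[k b] /mapP[k' _ [-> ->]]; apply/mapP => -[? _ []].
  move=> [k b]; rewrite mem_cat; apply/idP/orP => [kJ|[/mapP[k' + [-> ->]]|/mapP[k' + [-> ->]]]].
  - by case: b kJ => kJ; [left|right]; apply/mapP; exists k => //; rewrite partE.
  - by rewrite partE.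
  - by rewrite partE.
have QT k : k \in part true -> Q k by rewrite partE => /JQ.
have QF k : k \in part false -> Q k by rewrite partE => /JQ.
rewrite capE prodE.
rewrite -(switching_indep htau (A := fun k => A (k, true)) QT); last first.
  by move=> k; rewrite partE => /SA.
rewrite -(motions_indep hW (A := fun k => A (k, false)) QF); last first.
  by move=> k; rewrite partE => /SA.
apply: htauW.
- apply: bigcap_sub; first exact: smallest_sigma_algebra.
  move=> k kt; have Qk := QT _ kt; move: kt; rewrite partE => /SA /=.
  rewrite /node_sigma /=; apply: smallest_sub; first exact: smallest_sigma_algebra.
  by move=> _ [_ _ [B mB <-]]; rewrite setTI; exact: sigma_of_preimage.
- apply: bigcap_sub; first exact: smallest_sigma_algebra.
  move=> k kt; have Qk := QF _ kt; move: kt; rewrite partE => /SA /=.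
  rewrite /node_sigma /=; apply: smallest_sub; first exact: smallest_sigma_algebra.
  move=> _ [[t i] /= t0 [B mB <-]]; rewrite setTI.
  exact: (sigma_of_preimage (Y := fun kti w => W kti.1.1 kti.1.2 w kti.2 ord0)
    (i := ((k, t), i))).
Qed.

(** Measurability over this type says that a variable depends only on the clocks
    and motions listed in [D]. *)
Definition node_type (D : set (seq nat * bool)) :=
  g_sigma_algebraType (\bigcup_(i in D) node_sigma i).

Lemma measurable_node_type D : D `<=` QB ->
  measurable_fun setT (fun w : Omega => w : node_type D).
Proof.
move=> DQ _ A mA; rewrite setTI.
suff : <<s \bigcup_(i in D) node_sigma i >> `<=` (measurable : set (set Omega)).
  by move=> /(_ A mA).
apply: smallest_sub; first exact: sigma_algebra_measurable.
by move=> B [i Di]; apply: node_sigma_measurable; exact: DQ.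
Qed.

Lemma measurable_clock (D : set (seq nat * bool)) k : D (k, true) ->
  measurable_fun [set: node_type D] (tau k).
Proof.
move=> Dk _ A mA; rewrite setTI; apply: sub_sigma_algebra; exists (k, true) => //.
exact: (sigma_of_preimage (Y := fun _ : unit => tau k) (i := tt)).
Qed.

Lemma measurable_motion (D : set (seq nat * bool)) k t i : D (k, false) -> 0 <= t ->
  measurable_fun [set: node_type D] (fun w => W k t w i ord0).
Proof.
move=> Dk t0 _ A mA; rewrite setTI; apply: sub_sigma_algebra; exists (k, false) => //.
exact: (sigma_of_preimage (Y := fun ti w => W k ti.1 w ti.2 ord0) (i := (t, i))).
Qed.

Lemma node_indep2 (D1 D2 : set (seq nat * bool)) :
  D1 `<=` QB -> D2 `<=` QB -> D1 `&` D2 = set0 ->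
  independent2 P <<s \bigcup_(i in D1) node_sigma i >> <<s \bigcup_(i in D2) node_sigma i >>.
Proof.
exact: (indep_groups node_sigma_algebra node_sigma_measurable node_independent).
Qed.

(** The variables of one set of nodes are frozen while those of a disjoint set
    are integrated. *)
Lemma decouple (D1 D2 : set (seq nat * bool)) (h : node_type D1 * node_type D2 -> \bar R) :
  D1 `<=` QB -> D2 `<=` QB -> D1 `&` D2 = set0 ->
  measurable_fun setT h -> (forall z, 0 <= h z)%E ->
  (\int[P]_w h (w, w) = \int[P]_w1 \int[P]_w2 h (w1, w2))%E.
Proof.
move=> D1Q D2Q D12 mh h0.
apply: (indep_integral (Z1 := fun w : Omega => w : node_type D1)
   (Z2 := fun w : Omega => w : node_type D2)) => //.
- exact: measurable_node_type.
- exact: measurable_node_type.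
- by move=> A B mA mB; exact: (node_indep2 D1Q D2Q D12).
Qed.

Lemma mean_mul_nodes (D1 D2 : set (seq nat * bool)) (X Y : Omega -> R) :
  D1 `<=` QB -> D2 `<=` QB -> D1 `&` D2 = set0 ->
  measurable_fun [set: node_type D1] X -> measurable_fun [set: node_type D2] Y ->
  L2 P X -> L2 P Y ->
  \int[P]_w (X w * Y w) = (\int[P]_w X w) * (\int[P]_w Y w).
Proof.
move=> D1Q D2Q D12 mX mY lX lY; apply: mean_mul_indep => // A B mA mB.
apply: (node_indep2 D1Q D2Q D12).
  by have := mX measurableT A mA; rewrite setTI.
by have := mY measurableT B mB; rewrite setTI.
Qed.

End node_sigma.

(** * Exponential clocks and the transition semigroup *)

Section clock.
Context {R : realType} {dO : measure_display} {Omega : measurableType dO}.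
Variables (P : probability Omega R) (lambda : R) (ta : Omega -> R).
Hypotheses (lambda0 : 0 < lambda) (mta : measurable_fun setT ta).
Hypothesis law : forall A, measurable A -> P (ta @^-1` A) = exponential_prob lambda A.
Local Open Scope ereal_scope.

Lemma exponential_tail (t : R) : (0 <= t)%R ->
  \int[lebesgue_measure]_(x in `[t, +oo[) (exponential_pdf lambda x)%:E =
  (expR (- lambda * t))%:E.
Proof.
move=> t0.
have cexp : continuous (fun z : R => expR (- lambda * z)).
  move=> z; apply: continuous_comp; last exact: continuous_expR.
  by apply: cvgM; [exact: cvg_cst|exact: cvg_id].
rewrite (@ge0_continuous_FTC2y _ _ (fun x => - (expR (- lambda * x)))%R _ 0%R)//.
- by rewrite sub0e EFinN oppeK.
- by move=> x _; apply: exponential_pdf_ge0; exact: ltW.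
- apply: (@continuous_subspaceW R^o _ _ [set` `[0%R, +oo[%R]).
    by move=> x /=; rewrite !in_itv /= !andbT; exact: le_trans.
  exact: within_continuous_exponential_pdf.
- rewrite -oppr0; apply: cvgN.
  rewrite (_ : (fun x => expR (- lambda * x)) =
               (fun z => expR (- z)) \o (fun z => lambda * z)%R); last first.
    by apply: eq_fun => x; rewrite mulNr.
  apply: (@cvg_comp _ _ _ _ _ _ (pinfty_nbhs R)); last exact: cvgr_expR.
  exact: gt0_cvgMry.
- by apply: cvgN; apply/cvg_at_right_filter; exact: cexp.
- move=> z; rewrite in_itv/= andbT => tz; apply: derive1_exponential_pdf.
  by rewrite in_itv/= andbT; exact: le_lt_trans tz.
Qed.

Lemma clock_law (H : R -> \bar R) : measurable_fun setT H -> (forall r, 0 <= H r) ->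
  \int[P]_w H (ta w) = \int[lebesgue_measure]_(r in `[0%R, +oo[) (H r * (exponential_pdf lambda r)%:E).
Proof.
move=> mH H0.
have mta' : measurable_fun setT (ta : Omega -> measurableTypeR R) by exact: mta.
pose f : {mfun Omega >-> measurableTypeR R} := HB.pack ta (isMeasurableFun.Build _ _ _ _ _ mta').
have p0 (x : R) : (0 <= exponential_pdf lambda x)%R by apply: exponential_pdf_ge0; exact: ltW.
have mp : measurable_fun setT (exponential_pdf lambda) by exact: measurable_exponential_pdf.
transitivity (\int[pushforward P f]_r H r).
  by rewrite ge0_integral_pushforward//.
rewrite (@integral_density _ _ (measurableTypeR R) (@lebesgue_measure R) (pushforward P f)
   (exponential_pdf lambda))//.
rewrite [RHS]integral_mkcond; apply: eq_integral => r _.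
rewrite /patch mem_setE in_itv /= andbT; case: ifPn => //; rewrite -ltNge => r0.
by rewrite lt0_exponential_pdf// mule0.
Qed.

Lemma clock_nonneg : {ae P, forall w, (0 <= ta w)%R}.
Proof.
exists (ta @^-1` `]-oo, 0%R[); split.
- by rewrite -[X in measurable X]setTI; exact: mta.
- rewrite law// /exponential_prob; apply: integral0_eq => x.
  by rewrite /= in_itv /= => x0; rewrite lt0_exponential_pdf.
- by move=> w /= /negP; rewrite in_itv /= -ltNge.
Qed.

(** Either the clock outlives the horizon [t], or it rings before with its
    exponential density. Clipping the clock at [0] changes it on a null set. *)
Lemma clock_integral (t : R) (c : \bar R) (G : R -> \bar R) : (0 <= t)%R ->
  0 <= c -> measurable_fun setT G -> (forall r, 0 <= G r) ->
  \int[P]_w (if (t <= Num.max (ta w) 0)%R then c else G (Num.max (ta w) 0%R)) =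
  c * (expR (- lambda * t))%:E +
  \int[lebesgue_measure]_(r in `[0%R, t[) (G r * (lambda * expR (- lambda * r))%:E).
Proof.
move=> t0 c0 mG G0.
pose H (r : R) := if (t <= Num.max r 0)%R then c else G (Num.max r 0%R).
have mm : measurable_fun setT (fun r : R => Num.max r 0%R) by exact: measurable_maxr.
have mH : measurable_fun setT H.
  apply: measurable_fun_ifT => //.
    exact: measurable_fun_ler.
  exact: (measurableT_comp mG mm).
have H0 r : 0 <= H r by rewrite /H; case: ifP.
rewrite (clock_law mH H0).
have -> : [set` `[0%R, +oo[] = [set` `[0%R, t[] `|` [set` `[t, +oo[] :> set R.
  by rewrite -itv_bndbnd_setU.
have mp : measurable_fun setT (fun r => H r * (exponential_pdf lambda r)%:E).
  by apply: emeasurable_funM => //; apply/measurable_EFinP; exact: measurable_exponential_pdf.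
rewrite ge0_integral_setU//=; last 3 first.
- exact: measurable_funTS.
- move=> r _; rewrite mule_ge0// lee_fin; apply: exponential_pdf_ge0; exact: ltW.
- rewrite disj_set2E; apply/eqP/seteqP; split => // r [] /=; rewrite !in_itv /= andbT => /andP[_ h1] h2.
  by have := le_lt_trans h2 h1; rewrite ltxx.
rewrite addeC; congr (_ + _).
  transitivity (\int[lebesgue_measure]_(r in `[t, +oo[) (c * (exponential_pdf lambda r)%:E)).
    apply: eq_integral => r; rewrite inE /= in_itv /= andbT => tr.
    by rewrite /H max_l ?tr// (le_trans t0).
  rewrite ge0_integralZl//.
  - by rewrite exponential_tail.
  - apply/measurable_EFinP; apply: measurable_funTS; exact: measurable_exponential_pdf.
  - by move=> r _; rewrite lee_fin; apply: exponential_pdf_ge0; exact: ltW.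
apply: eq_integral => r; rewrite inE /= in_itv /= => /andP[r0 rt].
by rewrite /H max_l// leNgt rt /= exponential_pdfE.
Qed.

End clock.

Section flow.
Context {R : realType} {d : nat} {dO : measure_display} {Omega : measurableType dO}.
Variables (P : probability Omega R) (B : R -> Omega -> 'cV[R]_d).
Hypothesis hB : brownian P B.
Variables (mu : 'cV[R]_d) (sigma : 'M[R]_d) (T lambda : R).
Local Notation position := (position mu sigma).
Implicit Types (phi : 'cV[R]_d -> \bar R) (s r : R) (x y : 'cV[R]_d).
Local Open Scope ereal_scope.

(** The transition semigroup of the diffusion. *)
Definition flow r phi y : \bar R := \int[P]_om phi (position y r (B (Num.max r 0%R) om)).

Lemma flow_heat r phi y : flow r phi y = heat P B r (fun w => phi (position y r w)) 0%R.
Proof.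
apply: eq_integral => om _.
by have -> : (0 + B (Num.max r 0) om = B (Num.max r 0) om)%R by rewrite add0r.
Qed.

Lemma flow_ge0 r phi y : (forall x, 0 <= phi x) -> 0 <= flow r phi y.
Proof. by move=> phi0; exact: integral_ge0. Qed.

Let mshift r y phi : measurable_fun setT phi -> measurable_fun setT (fun w => phi (position y r w)).
Proof.
move=> mphi; apply: (measurableT_comp mphi).
exact: (@measurable_position _ _ _ _ _ _ (fun=> y) (fun=> r) id).
Qed.

Lemma measurable_flow_gen (dE : measure_display) (E : measurableType dE)
    (a : E -> R) (x : E -> 'cV[R]_d) (k : E -> 'cV[R]_d -> \bar R) :
  measurable_fun setT a -> measurable_fun setT x ->
  measurable_fun setT (fun z : E * 'cV[R]_d => k z.1 z.2) ->
  (forall e y, 0 <= k e y) ->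
  measurable_fun setT (fun e => flow (a e) (k e) (x e)).
Proof.
move=> ma mx mk k0; under eq_fun do rewrite flow_heat.
apply: (measurable_heat_gen hB (k := fun e w => k e (position (x e) (a e) w))) => //.
have m1 : measurable_fun setT (fun z : E * 'cV[R]_d => (z.1, position (x z.1) (a z.1) z.2)).
  apply: measurable_fun_pair => //.
  apply: (@measurable_position _ _ _ _ _ _ (fun z : E * 'cV[R]_d => x z.1)
    (fun z : E * 'cV[R]_d => a z.1) snd) => //.
    exact: (measurableT_comp mx measurable_fst).
  exact: (measurableT_comp ma measurable_fst).
exact: (measurableT_comp mk m1).
Qed.

Lemma measurable_flow r phi : measurable_fun setT phi -> (forall x, 0 <= phi x) ->
  measurable_fun setT (flow r phi).
Proof.
move=> mphi phi0.
apply: (@measurable_flow_gen _ _ (fun=> r) id (fun _ => phi)) => //.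
exact: (measurableT_comp mphi measurable_snd).
Qed.

Lemma flow_semigroup s r phi y : (0 <= s)%R -> (0 <= r)%R ->
  measurable_fun setT phi -> (forall x, 0 <= phi x) ->
  flow s (flow r phi) y = flow (s + r) phi y.
Proof.
move=> s0 r0 mphi phi0; rewrite /flow !max_l ?addr_ge0//.
have -> := brownian_semigroup (v := fun w => phi (position y (s + r) w)) hB s0 r0
  (mshift _ _ mphi) (fun x => phi0 _).
apply: eq_integral => om _; apply: eq_integral => om' _; congr phi.
by rewrite /position scalerDl mulmxDr; apply/colP => i; rewrite !mxE; ring.
Qed.

Lemma flowD r phi psi y : measurable_fun setT phi -> measurable_fun setT psi ->
  (forall x, 0 <= phi x) -> (forall x, 0 <= psi x) ->
  flow r (fun x => phi x + psi x) y = flow r phi y + flow r psi y.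
Proof. by move=> m1 m2 h0 h; rewrite !flow_heat; apply: (heatD hB) => //; exact: mshift. Qed.

Lemma flowZ r (c : R) phi y : (0 <= c)%R -> measurable_fun setT phi -> (forall x, 0 <= phi x) ->
  flow r (fun x => c%:E * phi x) y = c%:E * flow r phi y.
Proof. by move=> c0 m1 h0; rewrite !flow_heat; apply: (heatZ hB) => //; exact: mshift. Qed.

Lemma flow_cst r c y : flow r (fun=> c) y = c.
Proof. by rewrite flow_heat heat_cst. Qed.

Lemma flow_law (dO' : measure_display) (Omega' : measurableType dO')
   (P' : probability Omega' R) W r phi y : brownian P' W -> (0 <= r)%R ->
  measurable_fun setT phi -> (forall x, 0 <= phi x) ->
  \int[P']_w phi (position y r (W r w)) = flow r phi y.
Proof.
move=> hW r0 mphi phi0; rewrite /flow max_l//.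
exact: (brownian_law_eq (v := fun w => phi (position y r w)) hW hB r0 (mshift _ _ mphi)).
Qed.

Section discounted.
Variable k : R -> 'cV[R]_d -> \bar R.
Hypothesis mk : measurable_fun setT (fun z : R * 'cV[R]_d => k z.1 z.2).
Hypothesis k0 : forall t x, 0 <= k t x.

(** The weight [exp (lambda r)] is what is left of the inverse square of the
    exponential density after integration against that density. *)
Definition weighted s y : \bar R := \int[lebesgue_measure]_(r in `[0%R, (T - s)%R[)
  ((expR (lambda * r))%:E * flow r (k (s + r)%R) y).

Lemma measurable_weighted_integrand (dE : measure_display) (E : measurableType dE)
    (a b : E -> R) (x : E -> 'cV[R]_d) :
  measurable_fun setT a -> measurable_fun setT b -> measurable_fun setT x ->
  measurable_fun setT (fun e => (expR (lambda * b e))%:E * flow (b e) (k (a e)) (x e)).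
Proof.
move=> ma mb mx; apply: emeasurable_funM.
  apply/measurable_EFinP; apply: (measurableT_comp (@measurable_expR R)).
  exact: measurable_funM.
apply: (@measurable_flow_gen _ _ b x (fun e => k (a e))) => //.
have m1 : measurable_fun setT (fun z : E * 'cV[R]_d => (a z.1, z.2)).
  by apply: measurable_fun_pair => //; exact: (measurableT_comp ma measurable_fst).
exact: (measurableT_comp mk m1).
Qed.

Lemma measurable_flow_time s y : measurable_fun setT (fun r : R => flow r (k (s + r)%R) y).
Proof.
have m1 : measurable_fun setT (fun z : R * 'cV[R]_d => (s + z.1, z.2)%R).
  by apply: measurable_fun_pair => //; exact: measurable_funD.
exact: (measurable_flow_gen (k := fun r => k (s + r)%R) (@measurable_id _ R setT)
  (measurable_cst y) (measurableT_comp mk m1) (fun r => k0 _)).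
Qed.

Lemma weighted_ge0 s y : 0 <= weighted s y.
Proof.
apply: integral_ge0 => r _; apply: mule_ge0; first by rewrite lee_fin expR_ge0.
exact: flow_ge0.
Qed.

Lemma measurable_weighted :
  measurable_fun setT (fun z : R * 'cV[R]_d => weighted z.1 z.2).
Proof.
pose F (z : (R * 'cV[R]_d) * measurableTypeR R) : \bar R :=
  if (0 <= z.2)%R && (z.2 < T - z.1.1)%R then
    (expR (lambda * z.2))%:E * flow z.2 (k (z.1.1 + z.2)%R) z.1.2 else 0.
have m11 : measurable_fun setT (fun z : (R * 'cV[R]_d) * measurableTypeR R => z.1.1).
  exact: (measurableT_comp measurable_fst measurable_fst).
have m12 : measurable_fun setT (fun z : (R * 'cV[R]_d) * measurableTypeR R => z.1.2).
  exact: (measurableT_comp measurable_snd measurable_fst).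
have mF : measurable_fun setT F.
  apply: measurable_fun_ifT => //.
    apply: measurable_and; first exact: measurable_fun_ler.
    by apply: measurable_fun_ltr => //; exact: measurable_funB.
  apply: (@measurable_weighted_integrand _ _ (fun z : (R * 'cV[R]_d) * measurableTypeR R =>
    (z.1.1 + z.2)%R) snd (fun z => z.1.2)) => //.
  exact: measurable_funD.
have F0 z : 0 <= F z.
  rewrite /F; case: ifP => // _; apply: mule_ge0; first by rewrite lee_fin expR_ge0.
  exact: flow_ge0.
have := @measurable_fun_fubini_tonelli_F _ _ _ _ _ (@lebesgue_measure R) F mF F0.
apply: eq_measurable_fun => z _; rewrite /fubini_F /F /weighted [RHS]integral_mkcond.
by apply: eq_integral => r _ /=; rewrite /patch mem_setE in_itv.
Qed.

(** Averaging over the position at time [s] only shifts the time in the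
    integrand, by Tonelli and the semigroup property. *)
Lemma flow_weighted s x : (0 <= s)%R ->
  flow s (weighted s) x = \int[lebesgue_measure]_(r in `[0%R, (T - s)%R[)
    ((expR (lambda * r))%:E * flow (s + r)%R (k (s + r)%R) x).
Proof.
move=> s0.
pose F (z : Omega * measurableTypeR R) : \bar R :=
  if (0 <= z.2)%R && (z.2 < T - s)%R then
    (expR (lambda * z.2))%:E * flow z.2 (k (s + z.2)%R) (position x s (B s z.1)) else 0.
have mF : measurable_fun setT F.
  apply: measurable_fun_ifT => //.
    apply: measurable_and; first exact: measurable_fun_ler.
    exact: measurable_fun_ltr.
  apply: (@measurable_weighted_integrand _ _ (fun z : Omega * measurableTypeR R => (s + z.2)%R) snd
    (fun z => position x s (B s z.1))) => //.
    exact: measurable_funD.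
  apply: (@measurable_position _ _ _ _ _ _ (fun=> x) (fun=> s) (fun z => B s z.1)) => //.
  exact: (measurableT_comp (measurable_brownian hB s0) measurable_fst).
have F0 z : 0 <= F z.
  rewrite /F; case: ifP => // _; apply: mule_ge0; first by rewrite lee_fin expR_ge0.
  exact: flow_ge0.
transitivity (\int[lebesgue_measure]_r \int[P]_om F (om, r)).
  rewrite -(@fubini_tonelli _ _ _ _ _ P (@lebesgue_measure R) F mF F0).
  rewrite /flow (max_l s0); apply: eq_integral => om _; rewrite /fubini_F /weighted integral_mkcond.
  by apply: eq_integral => r _; rewrite /patch mem_setE in_itv.
rewrite [RHS]integral_mkcond; apply: eq_integral => r _; rewrite /patch mem_setE in_itv /= /F /=.
case: ifP => [/andP[r0 _]|_]; last by rewrite integral0.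
have mkr : measurable_fun setT (k (s + r)%R).
  exact: (@measurable_slice _ _ _ _ _ _ k (s + r)%R mk).
have fl0 y : 0 <= flow r (k (s + r)%R) y by exact: flow_ge0.
have mfl : measurable_fun setT (flow r (k (s + r)%R)) by exact: measurable_flow.
rewrite ge0_integralZl//; last first.
  apply: (measurableT_comp mfl).
  apply: (@measurable_position _ _ _ _ _ _ (fun=> x) (fun=> s) (fun z => B s z)) => //.
  exact: (measurable_brownian hB s0).
by rewrite -(flow_semigroup x s0 r0 mkr (k0 _)) {2}/flow max_l.
Qed.

End discounted.
End flow.

(** * One branching step *)

Section one_particle.
Context {R : realType} {d : nat} {dO : measure_display} {Omega : measurableType dO}.
Variables (P : probability Omega R) (lambda : R) (Q : set (seq nat)).
Variables (tau : seq nat -> Omega -> R) (W : seq nat -> R -> Omega -> 'cV[R]_d).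
Hypothesis lambda0 : 0 < lambda.
Hypothesis htau : switching_times P lambda Q tau.
Hypothesis hW : brownian_motions P Q W.
Hypothesis htauW : times_motions_indep P Q tau W.
Context {dO' : measure_display} {Omega' : measurableType dO'}.
Variables (P' : probability Omega' R) (B : R -> Omega' -> 'cV[R]_d).
Hypothesis hB : brownian P' B.
Variables (mu : 'cV[R]_d) (sigma : 'M[R]_d).
Local Notation position := (position mu sigma).
Local Notation flow := (flow P' B mu sigma).
Local Notation node_type := (node_type tau W).
Local Notation QB := [set i : seq nat * bool | Q i.1].

Lemma measurable_node_sub (D D' : set (seq nat * bool)) : D `<=` D' ->
  measurable_fun [set: node_type D'] (fun w => w : node_type D).
Proof.
move=> DD' _ A mA; rewrite setTI.
suff : <<s \bigcup_(i in D) node_sigma tau W i >> `<=`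
    <<s \bigcup_(i in D') node_sigma tau W i >> by move=> /(_ A mA).
apply: smallest_sub; first exact: smallest_sigma_algebra.
move=> S [i Di Si]; apply: sub_sigma_algebra; exists i => //; exact: DD'.
Qed.

Lemma measurable_node_path (D : set (seq nat * bool)) k : Q k -> D (k, false) ->
  measurable_fun setT (fun z : R * node_type D => W k (Num.max z.1 0) z.2).
Proof.
move=> Qk Dk; apply: measurable_mxP => i j; rewrite ord1.
apply: (measurable_path (B := fun t (w : node_type D) => W k t w i ord0)).
  by move=> t t0; exact: measurable_motion.
by move=> w; exact: (brownian1_cont (brownian_coord (motions_law hW Qk) i)).
Qed.

Local Open Scope ereal_scope.

(** Conditioning on the clock and on the position at the switching date: the
    clock, the motion and the offspring of a particle are independent. *)
Lemma branch_integral k (D : set (seq nat * bool)) (t : R) y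
    (c : 'cV[R]_d -> \bar R) (F : R -> 'cV[R]_d -> Omega -> \bar R) :
  Q k -> D `<=` QB -> (forall b, ~ D (k, b)) -> (0 <= t)%R ->
  measurable_fun setT c -> (forall x, 0 <= c x) ->
  measurable_fun setT (fun z : (R * 'cV[R]_d) * node_type D => F z.1.1 z.1.2 z.2) ->
  (forall r x w, 0 <= F r x w) ->
  \int[P]_w (let r := Num.max (tau k w) 0%R in
    if (t <= r)%R then c (position y t (W k t w)) else F r (position y r (W k r w)) w) =
  (expR (- lambda * t))%:E * flow t c y +
  \int[lebesgue_measure]_(r in `[0%R, t[)
    ((lambda * expR (- lambda * r))%:E * flow r (fun x => \int[P]_w F r x w) y).
Proof.
move=> Qk DQ kD t0 mc c0 mF F0.
pose D1 : set (seq nat * bool) := [set (k, true)].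
pose D2 : set (seq nat * bool) := [set (k, false)].
have D1Q : D1 `<=` QB by move=> _ ->.
have D2Q : D2 `<=` QB by move=> _ ->.
have D23Q : D2 `|` D `<=` QB by move=> i [/D2Q|/DQ].
have D1_23 : D1 `&` (D2 `|` D) = set0.
  by apply/seteqP; split => // i [-> []] //; exact: kD.
have D2_3 : D2 `&` D = set0.
  by apply/seteqP; split => // i [->]; exact: kD.
pose rr w := Num.max (tau k w) 0%R.
have mrr : measurable_fun [set: node_type D1] rr.
  apply: measurable_maxr => //; exact: measurable_clock.
pose X r w := position y r (W k (Num.max r 0%R) w).
have mX D' : D' (k, false) -> measurable_fun setT (fun z : R * node_type D' => X z.1 z.2).
  move=> Dk; have mp := measurable_node_path Qk Dk.
  exact: (@measurable_position _ _ mu sigma _ (R * node_type D')%type _ _ _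
    (measurable_cst y) measurable_fst mp).
pose h (z : node_type D1 * node_type (D2 `|` D)) : \bar R :=
  if (t <= rr z.1)%R then c (X t z.2) else F (rr z.1) (X (rr z.1) z.2) z.2.
have mXt D' : D' (k, false) -> measurable_fun [set: node_type D'] (X t).
  by move=> Dk; exact: (measurableT_comp (mX D' Dk) (pair1_measurable t)).
have mF' : measurable_fun setT (fun z : (R * 'cV[R]_d) * node_type (D2 `|` D) => F z.1.1 z.1.2 z.2).
  have m1 : measurable_fun setT (fun z : (R * 'cV[R]_d) * node_type (D2 `|` D) =>
      (z.1, z.2 : node_type D)).
    apply: measurable_fun_pair => //.
    have ms := @measurable_node_sub D (D2 `|` D) (fun i Di => or_intror Di).
    exact: (measurableT_comp ms measurable_snd).
  exact: (measurableT_comp mF m1).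
have mFX : measurable_fun setT (fun z : R * node_type (D2 `|` D) => F z.1 (X z.1 z.2) z.2).
  have m1 : measurable_fun setT (fun z : R * node_type (D2 `|` D) => ((z.1, X z.1 z.2), z.2)).
    apply: measurable_fun_pair => //; apply: measurable_fun_pair => //.
    by apply: mX; left.
  exact: (measurableT_comp mF' m1).
have mh : measurable_fun setT h.
  have mr : measurable_fun setT (fun z : node_type D1 * node_type (D2 `|` D) => rr z.1).
    exact: (measurableT_comp mrr measurable_fst).
  apply: measurable_fun_ifT.
  - exact: measurable_fun_ler.
  - apply: (measurableT_comp mc); apply: (measurableT_comp _ measurable_snd).
    by apply: mXt; left.
  - have m1 : measurable_fun setT (fun z : node_type D1 * node_type (D2 `|` D) => (rr z.1, z.2)).
      exact: measurable_fun_pair.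
    exact: (measurableT_comp mFX m1).
have h0 z : 0 <= h z by rewrite /h; case: ifP.
have rr0 w : (0 <= rr w)%R by rewrite /rr le_max lexx orbT.
transitivity (\int[P]_w h (w, w)).
  apply: eq_integral => w _; rewrite /h /= /X (max_l t0) (max_l (rr0 w)).
  by [].
rewrite (decouple htau hW htauW D1Q D23Q D1_23 mh h0).
pose G r := \int[P]_w F r (X r w) w.
have mid D' : D' `<=` QB -> measurable_fun [set: Omega] (fun w => w : node_type D').
  by move=> DQ'; exact: (measurable_node_type htau hW).
have mG : measurable_fun setT G.
  have m1 : measurable_fun setT (fun z : R * Omega => F z.1 (X z.1 z.2) z.2).
    have m2 : measurable_fun setT (fun z : R * Omega => (z.1, z.2 : node_type (D2 `|` D))).
      apply: measurable_fun_pair => //.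
      exact: (measurableT_comp (mid _ D23Q) measurable_snd).
    exact: (measurableT_comp mFX m2).
  exact: (@measurable_fun_fubini_tonelli_F _ _ _ _ _ P _ m1 (fun z => F0 _ _ _)).
have G0 r : 0 <= G r by exact: integral_ge0.
transitivity (\int[P]_w1 (if (t <= rr w1)%R then flow t c y else G (rr w1))).
  apply: eq_integral => w1 _; rewrite /h /=; case: ifP => // _.
  have E := flow_law hB mu sigma y (motions_law hW Qk) t0 mc c0; rewrite /X (max_l t0); exact: E.
rewrite (clock_integral lambda0 (switching_meas htau Qk) (switching_law htau Qk) t0 _ mG G0); last first.
  exact: flow_ge0.
rewrite muleC; congr (_ + _); apply: eq_integral => r; rewrite inE /= in_itv /= => /andP[r0 _].
rewrite muleC; congr (_ * _).
have mFr : measurable_fun setT (fun z : 'cV[R]_d * node_type D => F r z.1 z.2).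
  have m1 : measurable_fun setT (fun z : 'cV[R]_d * node_type D => ((r, z.1), z.2)).
    by apply: measurable_fun_pair => //; exact: measurable_fun_pair.
  exact: (measurableT_comp mF m1).
have mFrO : measurable_fun setT (fun z : 'cV[R]_d * Omega => F r z.1 z.2).
  have m1 : measurable_fun setT (fun z : 'cV[R]_d * Omega => (z.1, z.2 : node_type D)).
    apply: measurable_fun_pair => //.
    exact: (measurableT_comp (mid _ DQ) measurable_snd).
  exact: (measurableT_comp mFr m1).
rewrite -(flow_law hB mu sigma y (motions_law hW Qk) r0 (phi := fun x => \int[P]_w F r x w)); last 2 first.
- exact: (@measurable_fun_fubini_tonelli_F _ _ _ _ _ P _ mFrO (fun z => F0 _ _ _)).
- by move=> x; exact: integral_ge0.
pose h2 (z : node_type D2 * node_type D) := F r (X r z.1) z.2.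
have mh2 : measurable_fun setT h2.
  have m1 : measurable_fun setT (fun z : node_type D2 * node_type D => (X r z.1, z.2)).
    apply: measurable_fun_pair => //.
    have mXr : measurable_fun [set: node_type D2] (X r).
      by apply: (measurableT_comp (mX D2 _) (pair1_measurable r)).
    exact: (measurableT_comp mXr measurable_fst).
  exact: (measurableT_comp mFr m1).
have := decouple htau hW htauW D2Q DQ D2_3 mh2 (fun z => F0 _ _ _).
by rewrite /h2 /G /X /= (max_l r0).
Qed.

End one_particle.

(** * The estimator restarted at a date and position *)

Section started_estimator.
Context {R : realType} {d : nat}.
Variables (T lambda : R) (mu : 'cV[R]_d) (sigma : 'M[R]_d).
Variables (f : R -> 'cV[R]_d -> R -> R) (g : 'cV[R]_d -> R) (N : nat -> nat).
Local Notation position := (position mu sigma).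

(** The driver is measurable on the slab only, and is extended by [0]. *)
Definition slab_driver (t : R) (y : 'cV[R]_d) (z : R) : R :=
  if 0 <= t <= T then f t y z else 0.

(** The function [phi] of the estimator with the life time [r], the noise [w]
    and the offspring value [V] as separate arguments, in order to integrate
    them one after the other. *)
Definition payoff (s : R) (y : 'cV[R]_d) (r : R) (w : R -> 'cV[R]_d)
    (V : R -> 'cV[R]_d -> R) : R :=
  if T - s <= r then expR (lambda * (T - s)) * g (position y (T - s) (w (Num.max (T - s) 0)))
  else expR (lambda * r) / lambda * slab_driver (s + r) (position y r (w r))
         (V (s + r) (position y r (w r))).

Section realization.
Variables (tau : seq nat -> R) (W : seq nat -> R -> 'cV[R]_d).

(** The estimator restarted at a deterministic date and position. Conditioning on
    the ancestors of a node replaces its random date and position by constants,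
    and the induction over generations runs over all of them. Clocks are clipped
    at [0], which makes every date lie in [[s, T]]. *)
Fixpoint estimator (n : nat) (k : seq nat) (s : R) (y : 'cV[R]_d) : R :=
  if n is n'.+1 then
    (N (size k))%:R^-1 * \sum_(1 <= m < (N (size k)).+1)
      payoff s y (Num.max (tau (m :: k)) 0) (W (m :: k)) (estimator n' (m :: k))
  else g y.

Variables (x : 'cV[R]_d) (p : nat).
Hypotheses (T0 : 0 < T) (lambda0 : 0 < lambda).
Hypothesis tau0 : forall k, Qupto N p k -> 0 <= tau k.
Local Notation date := (switch_date T tau).
Local Notation part := (particle T x mu sigma tau W).

Lemma child_index k m : is_index N k -> (size k < p)%N -> (1 <= m < (N (size k)).+1)%N ->
  Qupto N p (m :: k).
Proof.
move=> kN kp mN; exists (size k).+1 => //; split => //=.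
by rewrite kN andbT -ltnS.
Qed.

(** The genealogy of a node enters its offspring only through the switching date
    and position. *)
Lemma ubar_recE n k : is_index N k -> (size k + n = p)%N -> 0 <= date k <= T ->
  ubar_rec T lambda x mu sigma f g N tau W n k = estimator n k (date k) (part k (date k)).
Proof.
elim: n k => [//|n IH] k kN kp /andP[s0 sT]; cbn [ubar_rec estimator].
congr (_ * _); apply: eq_big_nat => m mN.
have sk : (size k < p)%N by rewrite -kp addnS ltnS leq_addr.
have tm : 0 <= tau (m :: k) by apply: tau0; exact: child_index.
rewrite (max_l tm); set s := date k in s0 sT *; set r := tau (m :: k) in tm *.
have dE : date (m :: k) = Num.min (s + r) T by [].
have pE : part (m :: k) (date (m :: k)) = position (part k s) (date (m :: k) - s) (W (m :: k) (date (m :: k) - s)).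
  by [].
rewrite /payoff lerBlDl; have [rT|rT] := leP T (s + r).
  rewrite /phi pE dE (min_r rT) lexx ltxx /Fbar mul0r mul0r addr0 mul1r.
  rewrite (max_l (_ : 0 <= T - s)) ?subr_ge0//.
  by rewrite mulNr expRN invrK.
rewrite /phi pE dE (min_l (ltW rT)) rT leNgt rT /= mul0r mul0r add0r mul1r.
have e1 : s + r - s = r by ring.
rewrite e1 /slab_driver addr_ge0// (ltW rT) /= /rho exponential_pdfE// invfM.
rewrite mulNr expRN invrK (mulrC lambda^-1).
congr (_ * f _ _ _); have d1 : date (m :: k) = s + r by rewrite dE (min_l (ltW rT)).
rewrite (IH (m :: k)) /= ?d1 ?addr_ge0 ?(ltW rT)//.
- by rewrite -/s -/r (min_l (ltW rT)) e1.
- by rewrite kN andbT -ltnS.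
- by rewrite -kp addSn addnS.
- by rewrite (min_l (ltW rT)) addr_ge0// ltW.
Qed.

End realization.

Hypothesis hf : Borel_on [set z : R * 'cV[R]_d * R | 0 <= z.1.1 <= T]
  (fun z => f z.1.1 z.1.2 z.2).
Hypothesis hg : Borel_on [set: 'cV[R]_d] g.

Lemma measurable_terminal : measurable_fun setT g.
Proof.
exact: (Borel_on_measurable (i := @idfun 'cV[R]_d) (fun O oO => open_measurable_mx oO) hg).
Qed.

Lemma measurable_slab_driver :
  measurable_fun setT (fun z : R * 'cV[R]_d * R => slab_driver z.1.1 z.1.2 z.2).
Proof.
set S := [set z : R * 'cV[R]_d * R | 0 <= z.1.1 <= T].
have mS : measurable S.
  rewrite (_ : S = (`[0, T]%classic `*` setT) `*` setT).
    by apply: measurableX => //; apply: measurableX => //; exact: measurable_itv.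
  by apply/seteqP; split=> z; rewrite /S /= in_itv /=; [move=> ?; split|case=> -[]].
have := Borel_on_measurable (i := @idfun (R * 'cV[R]_d * R)%type)
  (fun O oO => open_measurable_prod3 oO) hf.
move=> /(measurable_restrictT _ mS).
apply: eq_measurable_fun => z _; rewrite /patch /slab_driver /=.
case: ifPn => [|/negP] zT; case: ifPn => //.
  by move: zT; rewrite inE /S /= => ->.
by move=> z0; case: zT; rewrite inE.
Qed.

Lemma measurable_payoff (dE : measure_display) (E : measurableType dE)
    (s r : E -> R) (y : E -> 'cV[R]_d) (w : R -> E -> 'cV[R]_d) (V : R -> 'cV[R]_d -> E -> R) :
  measurable_fun setT s -> measurable_fun setT y -> measurable_fun setT r ->
  (forall e, 0 <= r e) ->
  measurable_fun setT (fun z : R * E => w (Num.max z.1 0) z.2) ->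
  measurable_fun setT (fun z : (R * 'cV[R]_d) * E => V z.1.1 z.1.2 z.2) ->
  measurable_fun setT (fun e => payoff (s e) (y e) (r e) (w ^~ e) (fun t x => V t x e)).
Proof.
move=> ms my mr r0 mw mV.
have mTs : measurable_fun setT (fun e => T - s e) by exact: measurable_funB.
have mwa (a : E -> R) : measurable_fun setT a ->
    measurable_fun setT (fun e => position (y e) (a e) (w (Num.max (a e) 0) e)).
  move=> ma; have m1 : measurable_fun setT (fun e => (a e, e)) by exact: measurable_fun_pair.
  exact: (measurable_position mu sigma my ma (measurableT_comp mw m1)).
have mX : measurable_fun setT (fun e => position (y e) (r e) (w (r e) e)).
  by have := mwa r mr; under eq_fun do rewrite (max_l (r0 _)).
have msr : measurable_fun setT (fun e => s e + r e) by exact: measurable_funD.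
apply: measurable_fun_ifT; first exact: measurable_fun_ler.
  apply: measurable_funM.
    by apply: (measurableT_comp (@measurable_expR R)); exact: measurable_funM.
  exact: (measurableT_comp measurable_terminal (mwa _ mTs)).
apply: measurable_funM.
  apply: measurable_funM => //.
  by apply: (measurableT_comp (@measurable_expR R)); exact: measurable_funM.
have m1 : measurable_fun setT (fun e => (s e + r e, position (y e) (r e) (w (r e) e))).
  exact: measurable_fun_pair.
have m2 : measurable_fun setT (fun e => V (s e + r e) (position (y e) (r e) (w (r e) e)) e).
  have m3 : measurable_fun setT (fun e => ((s e + r e, position (y e) (r e) (w (r e) e)), e)).
    exact: measurable_fun_pair.
  exact: (measurableT_comp mV m3).
exact: (measurableT_comp measurable_slab_driver (measurable_fun_pair m1 m2)).
Qed.

Definition below (n : nat) (k : seq nat) : set (seq nat) :=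
  [set k' | is_index N k' /\ exists2 l, k' = l ++ k & (0 < size l <= n)%N].

Lemma below_child n m k : is_index N (m :: k) -> below n.+1 k (m :: k).
Proof. by move=> mk; split => //; exists [:: m]. Qed.

Lemma sub_below n m k : below n (m :: k) `<=` below n.+1 k.
Proof.
move=> k' [k'N [l k'E /andP[l0 ln]]]; split; first exact: k'N.
rewrite k'E; exists (rcons l m).
  by rewrite -cats1 -catA.
by rewrite size_rcons /=.
Qed.

Lemma measurable_estimator n k (dE : measure_display) (E : measurableType dE)
    (ta : seq nat -> E -> R) (w : seq nat -> R -> E -> 'cV[R]_d) :
  is_index N k ->
  (forall k', below n k k' -> measurable_fun setT (ta k') /\
     measurable_fun setT (fun z : R * E => w k' (Num.max z.1 0) z.2)) ->
  measurable_fun setT (fun z : (R * 'cV[R]_d) * E =>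
    estimator (ta ^~ z.2) (fun k t => w k t z.2) n k z.1.1 z.1.2).
Proof.
elim: n k => [|n IH] k kN mtw /=.
  exact: (measurableT_comp measurable_terminal (measurableT_comp measurable_snd measurable_fst)).
apply: measurable_funM => //.
under eq_fun do rewrite big_nat big_mkcond /=.
pose h (m : nat) (z : (R * 'cV[R]_d) * E) : R := if (0 < m < (N (size k)).+1)%N then
  payoff z.1.1 z.1.2 (Num.max (ta (m :: k) z.2) 0) ((w (m :: k)) ^~ z.2)
    (estimator (ta ^~ z.2) (fun k t => w k t z.2) n (m :: k)) else 0.
suff mh m : measurable_fun setT (h m) by exact: (measurable_sum (index_iota 1 _) mh).
have [mN|/negPf mN] := boolP (0 < m < (N (size k)).+1)%N; rewrite /h; last first.
  by under eq_fun do rewrite mN; exact: measurable_cst.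
under eq_fun do rewrite mN.
have mk : is_index N (m :: k) by rewrite /= kN andbT -ltnS.
have [mt mw] := mtw _ (below_child n mk).
apply: (@measurable_payoff _ _ (fun z : (R * 'cV[R]_d) * E => z.1.1)
  (fun z => Num.max (ta (m :: k) z.2) 0) (fun z => z.1.2) (fun t z => w (m :: k) t z.2)
  (fun t x z => estimator (ta ^~ z.2) (fun k t => w k t z.2) n (m :: k) t x)).
- exact: (measurableT_comp measurable_fst measurable_fst).
- exact: (measurableT_comp measurable_snd measurable_fst).
- by apply: measurable_maxr => //; exact: (measurableT_comp mt measurable_snd).
- by move=> z; rewrite le_max lexx orbT.
- have m1 : measurable_fun setT (fun z : R * ((R * 'cV[R]_d) * E) => (z.1, z.2.2)).
    by apply: measurable_fun_pair => //; exact: (measurableT_comp measurable_snd measurable_snd).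
  exact: (measurableT_comp mw m1).
- have m1 : measurable_fun setT (fun z : (R * 'cV[R]_d) * ((R * 'cV[R]_d) * E) => (z.1, z.2.2)).
    by apply: measurable_fun_pair => //; exact: (measurableT_comp measurable_snd measurable_snd).
  have mI := IH (m :: k) mk (fun k' kk' => mtw k' (sub_below kk')).
  exact: (measurableT_comp mI m1).
Qed.

End started_estimator.

(** * Mean and variance of one particle *)

Section average.
Context {R : realType} {dO : measure_display} {Omega : measurableType dO}.
Variable P : probability Omega R.

(** The mean square of an average of pairwise uncorrelated variables: the
    diagonal contributes [v / n], the other pairs the squared bias. *)
Lemma mean_square_average (n : nat) (X : 'I_n -> Omega -> R) (v a : R) : (0 < n)%N ->
  (forall i, L2 P (X i)) ->
  (forall i, \int[P]_w (X i w ^+ 2) <= v) ->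
  (forall i, (\int[P]_w X i w) ^+ 2 <= a) ->
  (forall i j, i != j ->
    \int[P]_w (X i w * X j w) = (\int[P]_w X i w) * (\int[P]_w X j w)) ->
  (\int[P]_w ((n%:R^-1 * \sum_i X i w) ^+ 2)%:E <= (v / n%:R + a)%:E)%E.
Proof.
move=> n0 lX Xv Xa Xij.
have nR : 0 < n%:R :> R by rewrite ltr0n.
have lS : L2 P (fun w => n%:R^-1 * \sum_i X i w) by apply: L2Z; exact: L2_sum.
rewrite -(Rintegral_EFin (L2_sqr_integrable lS)) lee_fin.
have a0 : 0 <= a by apply: le_trans (Xa (Ordinal n0)); exact: sqr_ge0.
have hm : has_mean P (fun w => (n%:R^-1 * \sum_i X i w) ^+ 2)
    (n%:R^-1 ^+ 2 * \sum_i \sum_j \int[P]_w (X i w * X j w)).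
  have -> : (fun w => (n%:R^-1 * \sum_i X i w) ^+ 2) =
     (fun w => n%:R^-1 ^+ 2 * \sum_i \sum_j (X i w * X j w)).
    apply/funext => w; rewrite exprMn; congr (_ * _); rewrite expr2 mulr_suml.
    by apply: eq_bigr => i _; rewrite mulr_sumr.
  apply: has_meanZ; apply: has_mean_sum => i; apply: has_mean_sum => j.
  by split => //; exact: L2_mul_integrable.
have [_ ->] := hm.
have bound i : \sum_j \int[P]_w (X i w * X j w) <= v + n%:R * a.
  rewrite (bigD1 i)//=; apply: lerD.
    by under eq_Rintegral do rewrite -expr2.
  apply: (@le_trans _ _ (\sum_(j < n | j != i) a)).
    apply: ler_sum => j ji; rewrite Xij; last by rewrite eq_sym.
    have := Xa i; have := Xa j.
    have : 0 <= (\int[P]_w X i w - \int[P]_w X j w) ^+ 2 by exact: sqr_ge0.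
    move: (\int[P]_w X i w) (\int[P]_w X j w) => p q; nra.
  rewrite sumr_const -[leLHS]mulr_natl ler_wpM2r// ler_nat.
  by rewrite -[leqRHS]card_ord; exact: max_card.
have -> : v / n%:R + a = n%:R^-1 ^+ 2 * (n%:R * (v + n%:R * a)).
  by field; rewrite gt_eqF.
apply: ler_wpM2l; first exact: sqr_ge0.
apply: le_trans (ler_sum _ (fun i _ => bound i)) _.
by rewrite sumr_const card_ord -[leLHS]mulr_natl.
Qed.

Lemma le_integral_sqrD (X Y : Omega -> R) (a b : R) : L2 P X -> L2 P Y ->
  \int[P]_w (X w ^+ 2) <= a -> \int[P]_w (Y w ^+ 2) <= b ->
  \int[P]_w ((X w + Y w) ^+ 2) <= 2 * a + 2 * b.
Proof.
move=> lX lY Xa Yb.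
have hX : has_mean P (fun w => X w ^+ 2) (\int[P]_w (X w ^+ 2)).
  by split => //; exact: L2_sqr_integrable.
have hY : has_mean P (fun w => Y w ^+ 2) (\int[P]_w (Y w ^+ 2)).
  by split => //; exact: L2_sqr_integrable.
have [iS ES] := has_meanD (has_meanZ 2 hX) (has_meanZ 2 hY).
apply: (@le_trans _ _ (2 * \int[P]_w (X w ^+ 2) + 2 * \int[P]_w (Y w ^+ 2))); last first.
  by apply: lerD; rewrite ler_pM2l.
rewrite -ES; apply: le_Rintegral => //.
  by apply: L2_sqr_integrable; exact: L2D.
move=> w _; have : 0 <= (X w - Y w) ^+ 2 by exact: sqr_ge0.
by move: (X w) (Y w) => p q; nra.
Qed.

(** The difference of the two sides is [m ^+ 2]. *)
Lemma centred_le_second_moment (X : Omega -> R) (m : R) : L2 P X -> \int[P]_w X w = m ->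
  \int[P]_w ((X w - m) ^+ 2) <= \int[P]_w (X w ^+ 2).
Proof.
move=> lX Xm.
have h1 : has_mean P (fun w => X w ^+ 2) (\int[P]_w (X w ^+ 2)).
  by split => //; exact: L2_sqr_integrable.
have h2 : has_mean P X m by split => //; exact: L2_integrable.
have [_ ->] : has_mean P (fun w => (X w - m) ^+ 2) (\int[P]_w (X w ^+ 2) + (- (2 * m) * m + m ^+ 2)).
  have -> : (fun w => (X w - m) ^+ 2) = (fun w => X w ^+ 2 + (- (2 * m) * X w + m ^+ 2)).
    by apply/funext => w; ring.
  by apply: has_meanD => //; apply: has_meanD; [exact: has_meanZ|exact: has_mean_cst].
rewrite -[leRHS]addr0 lerD2l; have : 0 <= m ^+ 2 by exact: sqr_ge0.
by rewrite expr2; lra.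
Qed.

Lemma EFin_mul_lty (c : R) (z : \bar R) : 0 < c -> (c%:E * z < +oo)%E -> (z < +oo)%E.
Proof.
move=> c0; case: z => [z _|+|_]; [exact: ltry| |by rewrite ltNye].
by rewrite gt0_muley ?lte_fin.
Qed.

Lemma integral_pos_neg (X : Omega -> R) : P.-integrable setT (fun w => (X w)%:E) ->
  [/\ (\int[P]_w X w)%:E =
    (\int[P]_w (Num.max (X w) 0)%:E - \int[P]_w (Num.max (- X w) 0)%:E)%E,
    (\int[P]_w (Num.max (X w) 0)%:E)%E \is a fin_num &
    (\int[P]_w (Num.max (- X w) 0)%:E)%E \is a fin_num].
Proof.
move=> iX.
have Ep : (\int[P]_w (Num.max (X w) 0)%:E = \int[P]_w ((fun w => (X w)%:E)^\+ w))%E.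
  by apply: eq_integral => w _; rewrite funeposE -EFin_max.
have En : (\int[P]_w (Num.max (- X w) 0)%:E = \int[P]_w ((fun w => (X w)%:E)^\- w))%E.
  by apply: eq_integral => w _; rewrite funenegE -EFinN -EFin_max.
rewrite Ep En (Rintegral_EFin iX) [LHS in LHS = _]integralE; split => //.
  exact: integrable_fin_num (integrable_funepos measurableT iX).
exact: integrable_fin_num (integrable_funeneg measurableT iX).
Qed.

End average.

Section error_analysis.
Context {R : realType} {d : nat}.
Variables (T : R) (lambda : R) (mu : 'cV[R]_d) (sigma : 'M[R]_d).
Variables (f : R -> 'cV[R]_d -> R -> R) (g : 'cV[R]_d -> R) (u : R -> 'cV[R]_d -> R).
Hypotheses (T_gt0 : 0 < T) (lambda0 : 0 < lambda).
Hypothesis hf : Borel_on [set z : R * 'cV[R]_d * R | 0 <= z.1.1 <= T]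
  (fun z => f z.1.1 z.1.2 z.2).
Hypothesis hg : Borel_on [set: 'cV[R]_d] g.
Hypotheses (hu : C12 T u) (hPDE : solves_PDE T mu sigma f g u)
  (hgrowth : quadratic_growth T u).
Variables (p : nat) (N : nat -> nat).
Context {dO : measure_display} {Omega : measurableType dO}.
Variables (P : probability Omega R).
Variables (tau : seq nat -> Omega -> R) (W : seq nat -> R -> Omega -> 'cV[R]_d).
Hypothesis htau : switching_times P lambda (Qupto N p) tau.
Hypothesis hW : brownian_motions P (Qupto N p) W.
Hypothesis htauW : times_motions_indep P (Qupto N p) tau W.
Context {dO' : measure_display} {Omega' : measurableType dO'}.
Variables (P' : probability Omega' R) (B : R -> Omega' -> 'cV[R]_d).
Hypothesis hB : brownian P' B.
Local Notation position := (position mu sigma).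
Local Notation flow := (flow P' B mu sigma).
Local Notation weighted := (weighted P' B mu sigma T lambda).
Local Notation src := (source T mu sigma u).
Local Notation QB := [set i : seq nat * bool | Qupto N p i.1].
Local Notation pay := (payoff T lambda mu sigma f g).

Definition slab_solution (t : R) (y : 'cV[R]_d) : R := if 0 <= t <= T then u t y else 0.

Let mu1 : measurable_fun setT (fun z : R * 'cV[R]_d => slab_solution z.1 z.2).
Proof. exact: measurable_solution. Qed.

Let msrc : measurable_fun setT (fun z : R * 'cV[R]_d => src z.1 z.2).
Proof. exact: measurable_source. Qed.

Let mg := measurable_terminal hg.

Let driver t y : R := slab_driver T f t y (slab_solution t y).

Let mdriver : measurable_fun setT (fun z : R * 'cV[R]_d => driver z.1 z.2).
Proof.
have m1 : measurable_fun setT (fun z : R * 'cV[R]_d => (z, slab_solution z.1 z.2)).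
  exact: measurable_fun_pair.
exact: (measurableT_comp (measurable_slab_driver hf) m1).
Qed.

Let driverE t y : 0 <= t < T -> driver t y = src t y.
Proof.
move=> tT; have /andP[t0 /ltW tT'] := tT.
by rewrite /driver /slab_driver /slab_solution /source t0 tT' /= (PDE_interior hPDE).
Qed.

(** The solution takes the place of the offspring estimator. The result is
    unbiased, and comparison with it separates the bias of a child from its
    variance. *)
Definition exact_payoff (k : seq nat) (s : R) (y : 'cV[R]_d) (w : Omega) : R :=
  pay s y (Num.max (tau k w) 0) (W k ^~ w) slab_solution.

Local Open Scope ereal_scope.

Definition src2 (t : R) (x : 'cV[R]_d) : \bar R := (src t x ^+ 2)%:E.
Definition g2 (x : 'cV[R]_d) : \bar R := (g x ^+ 2)%:E.

Definition second_moment (s : R) (y : 'cV[R]_d) : \bar R :=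
  (expR (lambda * (T - s)))%:E * flow (T - s) g2 y + lambda^-1%:E * weighted src2 s y.

Lemma exact_payoff_integral k s y (phi : R -> R) : Qupto N p k -> (0 <= s < T)%R ->
  measurable_fun setT phi -> (forall a, 0 <= phi a)%R ->
  \int[P]_w (phi (exact_payoff k s y w))%:E =
  (expR (- lambda * (T - s)))%:E *
    flow (T - s) (fun x => (phi (expR (lambda * (T - s)) * g x)%R)%:E) y +
  \int[lebesgue_measure]_(r in `[0%R, (T - s)%R[) ((lambda * expR (- lambda * r))%:E *
    flow r (fun x => (phi (expR (lambda * r) / lambda * src (s + r) x)%R)%:E) y).
Proof.
move=> Qk /andP[s0 sT] mphi phi0.
have t0 : (0 <= T - s)%R by rewrite subr_ge0 ltW.
pose c x : \bar R := (phi (expR (lambda * (T - s)) * g x)%R)%:E.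
pose F r x (w : Omega) : \bar R := (phi (expR (lambda * r) / lambda * driver (s + r) x)%R)%:E.
have mc : measurable_fun setT c.
  by apply/measurable_EFinP; apply: (measurableT_comp mphi); exact: measurable_funM.
have D0 : set0 `<=` QB by [].
have mF : measurable_fun setT (fun z : (R * 'cV[R]_d) * node_type tau W set0 => F z.1.1 z.1.2 z.2).
  have m11 : measurable_fun setT (fun z : (R * 'cV[R]_d) * node_type tau W set0 => z.1.1).
    exact: (measurableT_comp measurable_fst measurable_fst).
  apply/measurable_EFinP; apply: (measurableT_comp mphi); apply: measurable_funM.
    apply: measurable_funM => //.
    by apply: (measurableT_comp (@measurable_expR R)); exact: measurable_funM.
  have m1 : measurable_fun setT (fun z : (R * 'cV[R]_d) * node_type tau W set0 => (s + z.1.1, z.1.2)%R).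
    apply: measurable_fun_pair; first exact: measurable_funD.
    exact: (measurableT_comp measurable_snd measurable_fst).
  exact: (measurableT_comp mdriver m1).
have c0 x : 0 <= c x by rewrite lee_fin.
have F0 r x w : 0 <= F r x w by rewrite lee_fin.
have := branch_integral lambda0 htau hW htauW hB mu sigma y Qk D0 (fun b h => h) t0 mc c0 mF F0.
move=> /= E; transitivity (\int[P]_w (let r := Num.max (tau k w) 0%R in
    if (T - s <= r)%R then c (position y (T - s) (W k (T - s)%R w))
    else F r (position y r (W k r w)) w)).
  apply: eq_integral => w _ /=; rewrite /exact_payoff /payoff /F /c (max_l t0).
  by case: ifP.
rewrite E; congr (_ + _).
apply: eq_integral => r; rewrite inE /= in_itv /= => /andP[r0 rT].
congr (_ * _); congr (flow r _ y); apply/funext => x.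
rewrite integral_cst//= probability_setT mule1 driverE//.
by rewrite addr_ge0//= -ltrBrDl.
Qed.

Let ee (a : R) : (expR (- lambda * a) * expR (lambda * a) = 1)%R.
Proof. by rewrite -expRD mulNr addNr expR0. Qed.

(** One of the two factors [exp (lambda r)] of the squared weight is absorbed by
    the law of the clock. *)
Lemma exact_payoff_sqr k s y : Qupto N p k -> (0 <= s < T)%R ->
  \int[P]_w (exact_payoff k s y w ^+ 2)%:E = second_moment s y.
Proof.
move=> Qk sT.
have msq : measurable_fun setT (fun a : R => a ^+ 2)%R by exact: measurable_funX.
rewrite (@exact_payoff_integral k s y _ Qk sT msq (fun a => sqr_ge0 a)).
have mg2 : measurable_fun setT (fun x => (g x ^+ 2)%:E).
  by apply/measurable_EFinP; exact: (measurable_funX 2 mg).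
have msr r : measurable_fun setT (src r).
  exact: (@measurable_slice _ _ _ _ _ _ src r msrc).
have mr2 r : measurable_fun setT (fun x => (src r x ^+ 2)%:E).
  by apply/measurable_EFinP; exact: (measurable_funX 2 (msr r)).
have g20 x : 0 <= (g x ^+ 2)%:E by rewrite lee_fin sqr_ge0.
have sr20 r x : 0 <= (src r x ^+ 2)%:E by rewrite lee_fin sqr_ge0.
have msrc2 : measurable_fun setT (fun z : R * 'cV[R]_d => src2 z.1 z.2).
  by apply/measurable_EFinP; exact: (measurable_funX 2 msrc).
congr (_ + _).
  under eq_fun do rewrite exprMn EFinM.
  rewrite (flowZ hB mu sigma _ y (sqr_ge0 _) mg2 g20).
  by rewrite muleA -EFinM expr2 mulrA ee mul1r.
rewrite /weighted -ge0_integralZl//; last 3 first.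
- apply: measurable_funTS.
  apply: (@measurable_weighted_integrand _ _ _ _ P' B hB mu sigma lambda src2 _ _ _ _
    (fun r => s + r)%R id (fun=> y)) => //.
  exact: measurable_funD.
- move=> r _; rewrite mule_ge0 ?lee_fin ?expR_ge0//; apply: flow_ge0 => x.
  by rewrite lee_fin sqr_ge0.
- by rewrite lee_fin invr_ge0 ltW.
apply: eq_integral => r _; under eq_fun do rewrite exprMn EFinM.
rewrite (flowZ hB mu sigma _ y (sqr_ge0 _) (mr2 _) (sr20 _)).
rewrite !muleA -!EFinM; congr (_%:E * _).
have := ee r; have l0 : lambda != 0%R by rewrite gt_eqF.
move: (expR (- lambda * r)) (expR (lambda * r)) => a b ab.
transitivity (lambda^-1 * (a * b) * b)%R; first by field.
by rewrite ab mulr1.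
Qed.

(** For a positively homogeneous [phi] the weights cancel against the law of the
    clock; the positive and the negative parts are of this kind. *)
Lemma exact_payoff_hom k s y (phi : R -> R) : Qupto N p k -> (0 <= s < T)%R ->
  measurable_fun setT phi -> (forall a, 0 <= phi a)%R ->
  (forall c a, 0 <= c -> phi (c * a) = c * phi a)%R ->
  \int[P]_w (phi (exact_payoff k s y w))%:E =
  \int[P']_om (phi (g (position y (T - s) (B (T - s) om)%R)))%:E +
  \int[lebesgue_measure]_(r in `[0%R, (T - s)%R])
    \int[P']_om (phi (src (s + r) (position y r (B r om))%R))%:E.
Proof.
move=> Qk sT mphi phi0 phiZ.
rewrite (@exact_payoff_integral k s y _ Qk sT mphi phi0).
have t0 : (0 <= T - s)%R by rewrite subr_ge0 ltW//; have /andP[] := sT.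
have mpg : measurable_fun setT (fun x => (phi (g x))%:E).
  by apply/measurable_EFinP; exact: (measurableT_comp mphi mg).
have pg0 x : 0 <= (phi (g x))%:E by rewrite lee_fin.
have mps : measurable_fun setT (fun z : R * 'cV[R]_d => (phi (src z.1 z.2))%:E).
  by apply/measurable_EFinP; exact: (measurableT_comp mphi msrc).
have ps0 r x : 0 <= (phi (src r x))%:E by rewrite lee_fin.
have mpsr r : measurable_fun setT (fun x => (phi (src r x))%:E).
  exact: (@measurable_slice _ _ _ _ _ _ (fun r x => (phi (src r x))%:E) r mps).
have expE (r : R) (c : R) (F : 'cV[R]_d -> R) : (0 <= c)%R ->
    measurable_fun setT (fun x => (phi (F x))%:E) ->
    flow r (fun x => (phi (c * F x)%R)%:E) y = c%:E * flow r (fun x => (phi (F x))%:E) y.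
  move=> c0 mF; rewrite -(flowZ hB mu sigma r y c0 mF); last by move=> x; rewrite lee_fin.
  by congr (flow r _ y); apply/funext => x; rewrite phiZ.
congr (_ + _).
  rewrite expE ?expR_ge0// muleA -EFinM ee mul1e.
  by rewrite /flow (max_l t0).
transitivity (\int[lebesgue_measure]_(r in `[0%R, (T - s)%R[)
    flow r (fun x => (phi (src (s + r)%R x))%:E) y).
  apply: eq_integral => r _; rewrite expE//; last by rewrite divr_ge0 ?expR_ge0 ?ltW.
  rewrite muleA -EFinM; have := ee r; have l0 : lambda != 0%R by rewrite gt_eqF.
  move: (expR (- lambda * r)) (expR (lambda * r)) => a b ab.
  rewrite (_ : (lambda * a * (b / lambda) = a * b)%R); last by field.
  by rewrite ab mul1e.
have mfl := measurable_flow_time hB mu sigma mps ps0 s y.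
rewrite integral_itv_bndo_bndc; last exact: measurable_funTS.
apply: eq_integral => r; rewrite inE /= in_itv /= => /andP[r0 _].
by rewrite /flow (max_l r0).
Qed.

Lemma second_moment_ge0 s y : 0 <= second_moment s y.
Proof.
apply: adde_ge0; apply: mule_ge0.
- by rewrite lee_fin expR_ge0.
- by apply: flow_ge0 => x; rewrite lee_fin sqr_ge0.
- by rewrite lee_fin invr_ge0 ltW.
- by apply: weighted_ge0 => t x; rewrite lee_fin sqr_ge0.
Qed.

Lemma measurable_exact_payoff (D : set (seq nat * bool)) k s y : Qupto N p k ->
  D (k, true) -> D (k, false) ->
  measurable_fun [set: node_type tau W D] (exact_payoff k s y).
Proof.
move=> Qk Dt Df.
have mr : measurable_fun [set: node_type tau W D] (fun w => Num.max (tau k w) 0%R).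
  by apply: measurable_maxr => //; exact: measurable_clock.
have r0 (w : node_type tau W D) : (0 <= Num.max (tau k w) 0)%R by rewrite le_max lexx orbT.
have mV : measurable_fun setT (fun z : (R * 'cV[R]_d) * node_type tau W D => slab_solution z.1.1 z.1.2).
  exact: (measurableT_comp mu1 measurable_fst).
have h := measurable_payoff lambda mu sigma hf hg (measurable_cst s) (measurable_cst y) mr r0
  (measurable_node_path hW Qk Df) (V := fun t x _ => slab_solution t x) mV.
exact: h.
Qed.

Let mid (D : set (seq nat * bool)) : D `<=` QB ->
  measurable_fun [set: Omega] (fun w => w : node_type tau W D).
Proof. exact: (measurable_node_type htau hW). Qed.

Lemma exact_payoff_L2 k s y : Qupto N p k -> (0 <= s < T)%R -> second_moment s y < +oo ->
  L2 P (exact_payoff k s y).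
Proof.
move=> Qk sT fin; split; last by rewrite exact_payoff_sqr.
have DQ : [set i | i.1 = k] `<=` QB by move=> i /= ->.
have := @measurable_exact_payoff [set i | i.1 = k] k s y Qk erefl erefl.
by move=> m; exact: (measurableT_comp m (mid DQ)).
Qed.

(** After cancellation of the weights, the mean is the Feynman-Kac
    representation of the solution. A finite second moment gives the square
    integrability of the source along the path, since the weight [exp (lambda
    r)] is at least [1]. *)
Lemma exact_payoff_mean k s y : Qupto N p k -> (0 <= s < T)%R -> second_moment s y < +oo ->
  (\int[P]_w exact_payoff k s y w = u s y)%R.
Proof.
move=> Qk sT fin; have lA := exact_payoff_L2 Qk sT fin.
have /andP[s0 sT'] := sT.
have Ts0 : (0 <= T - s)%R by rewrite subr_ge0 ltW.
have mpos : measurable_fun setT (fun a : R => Num.max a 0%R) by exact: measurable_maxr.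
have mneg : measurable_fun setT (fun a : R => Num.max (- a) 0)%R.
  by apply: measurable_maxr => //; exact: measurableT_comp.
have pos0 (a : R) : (0 <= Num.max a 0)%R by rewrite le_max lexx orbT.
have neg0 (a : R) : (0 <= Num.max (- a) 0)%R by rewrite le_max lexx orbT.
have posZ (c a : R) : (0 <= c -> Num.max (c * a) 0 = c * Num.max a 0)%R.
  by move=> c0; rewrite maxr_pMr// mulr0.
have negZ (c a : R) : (0 <= c -> Num.max (- (c * a)) 0 = c * Num.max (- a) 0)%R.
  by move=> c0; rewrite -mulrN posZ.
have Ep := exact_payoff_hom y Qk sT mpos pos0 posZ.
have En := exact_payoff_hom y Qk sT mneg neg0 negZ.
have h2 : \int[lebesgue_measure]_(r in `[0%R, (T - s)%R])
     \int[P']_om (src (s + r) (position y r (B r om)) ^+ 2)%:E < +oo.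
  have : weighted src2 s y < +oo.
    have : lambda^-1%:E * weighted src2 s y < +oo.
      apply: le_lt_trans fin; rewrite /second_moment addeC leeDl//.
      apply: mule_ge0; first by rewrite lee_fin expR_ge0.
      by apply: flow_ge0 => x; rewrite lee_fin sqr_ge0.
    have li : (0 < lambda^-1)%R by rewrite invr_gt0.
    by move=> h; apply: (EFin_mul_lty li h).
  have ms2 : measurable_fun setT (fun z : R * 'cV[R]_d => src2 z.1 z.2).
    by apply/measurable_EFinP; exact: (measurable_funX 2 msrc).
  have s20 t x : 0 <= src2 t x by rewrite lee_fin sqr_ge0.
  have mfl := measurable_flow_time hB mu sigma ms2 s20 s y.
  have fl0 r : 0 <= flow r (src2 (s + r)%R) y by exact: flow_ge0.
  apply: le_lt_trans.
  apply: (@le_trans _ _ (\int[lebesgue_measure]_(r in `[0%R, (T - s)%R[) flow r (src2 (s + r)%R) y)).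
    rewrite integral_itv_bndo_bndc; last exact: measurable_funTS.
    rewrite le_eqVlt; apply/orP; left; apply/eqP; apply: eq_integral => r.
    rewrite inE /= in_itv /= => /andP[r0 _].
    by rewrite /flow (max_l r0).
  apply: ge0_le_integral => //.
  - exact: measurable_funTS.
  - apply: measurable_funTS; apply: emeasurable_funM => //.
    apply/measurable_EFinP; apply: (measurableT_comp (@measurable_expR R)).
    exact: measurable_funM.
  - move=> r /=; rewrite in_itv /= => /andP[r0 _].
    rewrite -[leLHS]mul1e; apply: lee_wpmul2r => //.
    by rewrite lee_fin -expR0 ler_expR mulr_ge0// ltW.
have fk := feynman_kac hu hgrowth hB sT h2.
have lT := solution_L2 mu sigma hu hgrowth hB y sT.
have [EA finAp finAn] := integral_pos_neg (L2_integrable lA).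
have [EG finGp finGn] := integral_pos_neg (L2_integrable lT).
have gE om : u T (position y (T - s) (B (T - s) om)%R) = g (position y (T - s) (B (T - s) om)%R).
  exact: (PDE_terminal hPDE).
have EGp : \int[P']_om (Num.max (u T (position y (T - s) (B (T - s) om)%R)) 0)%:E =
   \int[P']_om (Num.max (g (position y (T - s) (B (T - s) om)%R)) 0)%:E.
  by apply: eq_integral => om _; rewrite gE.
have EGn : \int[P']_om (Num.max (- u T (position y (T - s) (B (T - s) om)%R)) 0)%:E =
   \int[P']_om (Num.max (- g (position y (T - s) (B (T - s) om)%R)) 0)%:E.
  by apply: eq_integral => om _; rewrite gE.
rewrite EGp in finGp EG; rewrite EGn in finGn EG.
rewrite EG in fk; rewrite Ep in finAp EA; rewrite En in finAn EA.
move: fk finAp finAn finGp finGn EA.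
set a := \int[P']_om _; set b := \int[P']_om _.
set i := \int[lebesgue_measure]_(r in _) _; set j := \int[lebesgue_measure]_(r in _) _.
have a0 : 0 <= a by apply: integral_ge0 => om _; rewrite lee_fin.
have b0 : 0 <= b by apply: integral_ge0 => om _; rewrite lee_fin.
have i0 : 0 <= i by apply: integral_ge0 => r _; apply: integral_ge0 => om _; rewrite lee_fin.
have j0 : 0 <= j by apply: integral_ge0 => r _; apply: integral_ge0 => om _; rewrite lee_fin.
move=> fk f1 f2 f3 f4.
move: a b i j a0 b0 i0 j0 fk f1 f2 f3 f4 => [a| |] [b| |] [i| |] [j| |] //= _ _ _ _.
rewrite -!EFinD => -[fk] _ _ _ _ -[->]; lra.
Qed.

End error_analysis.

(** * Recursion for the mean square error *)

Section monotone.
Context {dX : measure_display} {X : measurableType dX} {R : realType}.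
Variable m : {measure set X -> \bar R}.
Local Open Scope ereal_scope.

(** The integral of a nonnegative function is a supremum over the simple
    functions below it, hence monotone for arbitrary functions. *)
Lemma le_integral_ge0 (D : set X) (f1 f2 : X -> \bar R) : (forall x, D x -> 0 <= f1 x) ->
  (forall x, D x -> f1 x <= f2 x) -> \int[m]_(x in D) f1 x <= \int[m]_(x in D) f2 x.
Proof.
move=> f0 ff; rewrite (integral_mkcond D f1) (integral_mkcond D f2).
have p0 x : 0 <= (f1 \_ D) x by rewrite /patch; case: ifPn => //; rewrite inE; exact: f0.
have pf x : (f1 \_ D) x <= (f2 \_ D) x.
  by rewrite /patch; case: ifPn => //; rewrite inE; exact: ff.
rewrite !ge0_integralTE//; last by move=> x; exact: le_trans (pf x).
by apply: le_ereal_sup => _ [h hf <-]; exists h => // x; exact: le_trans (pf x).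
Qed.

End monotone.

Section error_recursion.
Context {R : realType} {d : nat}.
Variables (T : R) (lambda : R) (mu : 'cV[R]_d) (sigma : 'M[R]_d).
Variables (f : R -> 'cV[R]_d -> R -> R) (g : 'cV[R]_d -> R) (u : R -> 'cV[R]_d -> R).
Hypotheses (T_gt0 : 0 < T) (lambda0 : 0 < lambda).
Hypothesis hf : Borel_on [set z : R * 'cV[R]_d * R | 0 <= z.1.1 <= T]
  (fun z => f z.1.1 z.1.2 z.2).
Hypothesis hg : Borel_on [set: 'cV[R]_d] g.
Variable K : R.
Hypothesis hK : forall (t : R) x' y w, 0 <= t <= T ->
  `|f t x' y - f t x' w| <= K * `|y - w|.
Hypotheses (hu : C12 T u) (hPDE : solves_PDE T mu sigma f g u)
  (hgrowth : quadratic_growth T u).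
Variables (p : nat) (N : nat -> nat).
Context {dO : measure_display} {Omega : measurableType dO}.
Variables (P : probability Omega R).
Variables (tau : seq nat -> Omega -> R) (W : seq nat -> R -> Omega -> 'cV[R]_d).
Hypothesis htau : switching_times P lambda (Qupto N p) tau.
Hypothesis hW : brownian_motions P (Qupto N p) W.
Hypothesis htauW : times_motions_indep P (Qupto N p) tau W.
Context {dO' : measure_display} {Omega' : measurableType dO'}.
Variables (P' : probability Omega' R) (B : R -> Omega' -> 'cV[R]_d).
Hypothesis hB : brownian P' B.
Local Notation position := (position mu sigma).
Local Notation flow := (flow P' B mu sigma).
Local Notation weighted := (weighted P' B mu sigma T lambda).
Local Notation slab_u := (slab_solution T u).
Local Notation exact_pay := (exact_payoff T lambda mu sigma f g u tau W).
Local Notation moment2 := (second_moment T lambda mu sigma g u P' B).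
Local Notation src := (source T mu sigma u).
Local Notation QB := [set i : seq nat * bool | Qupto N p i.1].
Local Notation pay := (payoff T lambda mu sigma f g).

Definition tree_estimator n k s y w : R :=
  estimator T lambda mu sigma f g N (tau ^~ w) (fun k t => W k t w) n k s y.

Definition approx_payoff n k s y w : R :=
  pay s y (Num.max (tau k w) 0) (W k ^~ w) (fun t x => tree_estimator n k t x w).

Definition lineage k : set (seq nat * bool) :=
  [set i | Qupto N p i.1 /\ exists l, i.1 = l ++ k].

Let lineageQ k : lineage k `<=` QB. Proof. by move=> i []. Qed.

Let below_Q n k k' : (size k + n <= p)%N -> below N n k k' -> Qupto N p k'.
Proof.
move=> kn [k'N [l k'E /andP[l0 ln]]]; exists (size k') => //=.
rewrite k'E size_cat addn_gt0 l0 /=; apply: leq_trans kn.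
by rewrite addnC leq_add2l.
Qed.

Let lineage_disjoint a b k : a != b -> lineage (a :: k) `&` lineage (b :: k) = set0.
Proof.
move=> ab; apply/seteqP; split => // i [[_ [l1 e1]] [_ [l2 e]]].
rewrite e1 in e.
have sl : size l1 = size l2.
  by have := congr1 size e; rewrite !size_cat /= => /eqP; rewrite eqn_add2r => /eqP.
move: e => /eqP; rewrite eqseq_cat// => /andP[_ /eqP[e]].
by rewrite e eqxx in ab.
Qed.

Let mid (D : set (seq nat * bool)) : D `<=` QB ->
  measurable_fun [set: Omega] (fun w => w : node_type tau W D).
Proof. exact: (measurable_node_type htau hW). Qed.

Let mu1 : measurable_fun setT (fun z : R * 'cV[R]_d => slab_u z.1 z.2).
Proof. exact: measurable_solution. Qed.

Lemma measurable_tree_estimator (D : set (seq nat * bool)) n k :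
  is_index N k -> (size k + n <= p)%N -> (forall k' b, below N n k k' -> D (k', b)) ->
  measurable_fun setT (fun z : (R * 'cV[R]_d) * node_type tau W D =>
    tree_estimator n k z.1.1 z.1.2 z.2).
Proof.
move=> kN kn kD.
apply: (measurable_estimator lambda mu sigma hf hg (E := node_type tau W D) (ta := tau) (w := W)) => // k' kk'.
split; first by apply: measurable_clock; exact: kD.
by apply: (measurable_node_path hW); [exact: below_Q kn kk'|exact: kD].
Qed.

Lemma measurable_approx_payoff n k s y : is_index N k -> (0 < size k)%N ->
  (size k + n <= p)%N ->
  measurable_fun [set: node_type tau W (lineage k)] (approx_payoff n k s y).
Proof.
move=> kN k0 kn.
have Qk : Qupto N p k.
  by exists (size k) => //=; rewrite k0 (leq_trans _ kn)// leq_addr.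
have Dk b : lineage k (k, b) by split => //; exists [::].
have mr : measurable_fun [set: node_type tau W (lineage k)] (fun w => Num.max (tau k w) 0).
  by apply: measurable_maxr => //; exact: measurable_clock.
have r0 (w : node_type tau W (lineage k)) : 0 <= Num.max (tau k w) 0 by rewrite le_max lexx orbT.
have mV : measurable_fun setT (fun z : (R * 'cV[R]_d) * node_type tau W (lineage k) =>
    tree_estimator n k z.1.1 z.1.2 z.2).
  apply: measurable_tree_estimator => // k' b kk'; split; first exact: below_Q kn kk'.
  by have [_ [l -> _]] := kk'; exists l.
have h := measurable_payoff lambda mu sigma hf hg (measurable_cst s) (measurable_cst y) mr r0
  (measurable_node_path hW Qk (Dk false)) mV.
exact: h.
Qed.

Local Open Scope ereal_scope.

(** If the particle reaches [T] the two payoffs agree. Otherwise they differ by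
    the Lipschitz constant times the error of the offspring estimator at the
    switching date, of which [branch_integral] gives the mean square. *)
Lemma child_error n k s y (b : R -> 'cV[R]_d -> \bar R) :
  is_index N k -> (0 < size k)%N -> (size k + n <= p)%N -> (0 <= s < T)%R ->
  measurable_fun setT (fun z : R * 'cV[R]_d => b z.1 z.2) -> (forall t x, 0 <= b t x) ->
  (forall t x, (0 <= t < T)%R ->
    \int[P]_w ((tree_estimator n k t x w - u t x) ^+ 2)%:E <= b t x) ->
  \int[P]_w ((approx_payoff n k s y w - exact_pay k s y w) ^+ 2)%:E
    <= (K ^+ 2 / lambda)%:E * weighted b s y.
Proof.
move=> kN k0 kn /andP[s0 sT] mb b0 IH.
have Qk : Qupto N p k.
  by exists (size k) => //=; rewrite k0 (leq_trans _ kn)// leq_addr.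
have t0 : (0 <= T - s)%R by rewrite subr_ge0 ltW.
have li0 : (0 <= lambda^-1)%R by rewrite invr_ge0 ltW.
pose D : set (seq nat * bool) := [set i | below N n k i.1].
have DQ : D `<=` QB by move=> i; exact: below_Q.
have Dk b' : ~ D (k, b').
  move=> [_ [l /= kl /andP[l0 _]]]; have := congr1 size kl.
  by rewrite size_cat => /eqP; rewrite -[X in X == _]add0n eqn_add2r => /eqP l0'; rewrite -l0' in l0.
pose cc (r : R) := ((expR (lambda * r) / lambda) ^+ 2 * K ^+ 2)%R.
have cc0 r : (0 <= cc r)%R by rewrite /cc mulr_ge0 ?sqr_ge0.
have mcc : measurable_fun setT cc.
  apply: measurable_funM => //; apply: measurable_funX; apply: measurable_funM => //.
  by apply: (measurableT_comp (@measurable_expR R)); exact: measurable_funM.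
pose e2 r x (w : Omega) : \bar R := ((tree_estimator n k (s + r) x w - slab_u (s + r) x) ^+ 2)%:E.
pose F r x (w : Omega) : \bar R := (cc r)%:E * e2 r x w.
have e20 r x w : 0 <= e2 r x w by rewrite lee_fin sqr_ge0.
have F0 r x w : 0 <= F r x w by rewrite mule_ge0// lee_fin.
have me2 : measurable_fun setT (fun z : (R * 'cV[R]_d) * node_type tau W D => e2 z.1.1 z.1.2 z.2).
  have mD := @measurable_tree_estimator D n k kN kn (fun k' b h => h).
  have msr : measurable_fun setT (fun z : (R * 'cV[R]_d) * node_type tau W D => (s + z.1.1, z.1.2)%R).
    apply: measurable_fun_pair.
      by apply: measurable_funD => //; exact: (measurableT_comp measurable_fst measurable_fst).
    exact: (measurableT_comp measurable_snd measurable_fst).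
  apply/measurable_EFinP; apply: (measurable_funX 2); apply: measurable_funB.
    have m1 : measurable_fun setT (fun z : (R * 'cV[R]_d) * node_type tau W D => ((s + z.1.1, z.1.2)%R, z.2)).
      exact: measurable_fun_pair.
    exact: (measurableT_comp mD m1).
  exact: (measurableT_comp mu1 msr).
have mF : measurable_fun setT (fun z : (R * 'cV[R]_d) * node_type tau W D => F z.1.1 z.1.2 z.2).
  apply: emeasurable_funM => //; apply/measurable_EFinP; apply: (measurableT_comp mcc).
  exact: (measurableT_comp measurable_fst measurable_fst).
have mc0 : measurable_fun setT (fun _ : 'cV[R]_d => 0 : \bar R) by exact: measurable_cst.
have BI := branch_integral lambda0 htau hW htauW hB mu sigma y Qk DQ Dk t0 mc0 (fun _ => lexx 0) mF F0.
have mAp : measurable_fun setT (approx_payoff n k s y).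
  exact: (measurableT_comp (measurable_approx_payoff s y kN k0 kn) (mid (@lineageQ k))).
have mEx : measurable_fun setT (exact_pay k s y).
  have h := measurable_exact_payoff lambda mu sigma hf hg hu hW (tau := tau) s y Qk (D := lineage k) (conj Qk (ex_intro _ [::] erefl)) (conj Qk (ex_intro _ [::] erefl)).
  exact: (measurableT_comp h (mid (@lineageQ k))).
apply: (@le_trans _ _ (\int[P]_w (let r := Num.max (tau k w) 0%R in
    if (T - s <= r)%R then 0 else F r (position y r (W k r w)) w))).
  apply: le_integral_ge0 => w _; first by rewrite lee_fin sqr_ge0.
  rewrite /approx_payoff /exact_payoff /payoff /=; set r := Num.max (tau k w) 0%R.
  have r0 : (0 <= r)%R by rewrite /r le_max lexx orbT.
  have [rT|rT] := leP (T - s)%R r; first by rewrite subrr expr0n.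
  have sr : (0 <= s + r <= T)%R by rewrite addr_ge0//= -lerBrDl ltW.
  rewrite -mulrBr exprMn /slab_driver sr /F /e2 /cc -EFinM lee_fin -[leRHS]mulrA.
  rewrite ler_wpM2l ?sqr_ge0// -exprMn -real_normK ?num_real// -[leRHS]real_normK ?num_real//.
  rewrite ler_sqr ?nnegrE// normrM; apply: le_trans (hK _ _ _ sr) _.
  by rewrite ler_wpM2r// ler_norm.
have -> : \int[P]_w (let r := Num.max (tau k w) 0%R in
    if (T - s <= r)%R then 0 else F r (position y r (W k r w)) w) =
  \int[lebesgue_measure]_(r in `[0%R, (T - s)%R[)
    ((lambda * expR (- lambda * r))%:E * flow r (fun x => \int[P]_w F r x w) y).
  by rewrite BI flow_cst mule0 add0e.
rewrite /weighted -ge0_integralZl//; last 3 first.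
- apply: measurable_funTS.
  apply: (@measurable_weighted_integrand _ _ _ _ P' B hB mu sigma lambda b _ _ _ _
    (fun r => s + r)%R id (fun=> y)) => //.
  exact: measurable_funD.
- by move=> r _; rewrite mule_ge0 ?lee_fin ?expR_ge0//; exact: flow_ge0.
- by rewrite lee_fin mulr_ge0// sqr_ge0.
have Fint r x : \int[P]_w F r x w = (cc r)%:E * \int[P]_w e2 r x w.
  rewrite ge0_integralZl//; last by rewrite lee_fin.
  have m1 : measurable_fun [set: Omega] (fun w => ((r, x), w : node_type tau W D)).
    by apply: measurable_fun_pair => //; exact: mid.
  exact: (measurableT_comp me2 m1).
apply: le_integral_ge0 => r /=; rewrite in_itv /= => /andP[r0 rT].
  apply: mule_ge0; first by rewrite lee_fin mulr_ge0 ?expR_ge0 ?ltW.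
  by apply: flow_ge0 => x; exact: integral_ge0.
have sr : (0 <= s + r < T)%R by rewrite addr_ge0//= -ltrBrDl.
have sr' : (0 <= s + r <= T)%R by have /andP[-> /ltW] := sr.
have fl : flow r (fun x => \int[P]_w F r x w) y <= (cc r)%:E * flow r (b (s + r)%R) y.
  have mbr : measurable_fun setT (b (s + r)%R).
    exact: (@measurable_slice _ _ _ _ _ _ b (s + r)%R mb).
  rewrite -(flowZ hB mu sigma r y (cc0 r) mbr (b0 _)) /flow.
  apply: le_integral_ge0 => om _; first by apply: integral_ge0.
  rewrite Fint; apply: lee_wpmul2l; first by rewrite lee_fin.
  apply: le_trans (IH _ _ sr); rewrite le_eqVlt; apply/orP; left; apply/eqP.
  by apply: eq_integral => w _; rewrite /e2 /slab_solution sr'.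
have l0 : (0 <= lambda * expR (- lambda * r))%R by rewrite mulr_ge0 ?expR_ge0 ?ltW.
apply: (@le_trans _ _ ((lambda * expR (- lambda * r))%:E * ((cc r)%:E * flow r (b (s + r)%R) y))).
  by apply: lee_wpmul2l fl; rewrite lee_fin.
rewrite !muleA -!EFinM; rewrite le_eqVlt; apply/orP; left; apply/eqP; congr (_%:E * _).
rewrite /cc; have ee : (expR (- lambda * r) * expR (lambda * r) = 1)%R.
  by rewrite -expRD mulNr addNr expR0.
have ln0 : lambda != 0%R by rewrite gt_eqF.
move: (expR (- lambda * r)) (expR (lambda * r)) ee => a c ac.
transitivity (K ^+ 2 / lambda * (a * c) * c)%R; first by field.
by rewrite ac mulr1.
Qed.

Variables (Khat theta : R).
Hypothesis htheta : (0 < theta)%R.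
Hypothesis hHolder : forall (t s : R) x', (0 <= t <= T)%R -> (0 <= s <= T)%R ->
     (`|u t x' - u s x'| <= Khat * `|t - s| `^ theta)%R.
Hypothesis hN : forall i, (i < p)%N -> (0 < N i)%N.

(** The first summand carries the error of the children, both as bias and as
    variance; the second one is the variance of the exact payoffs. *)
Fixpoint error_recursion n (s : R) (y : 'cV[R]_d) : \bar R :=
  if n is n'.+1 then
    (1 + 2 / (N (p - n))%:R)%:E * ((K ^+ 2 / lambda)%:E * weighted (error_recursion n') s y)
    + (2 / (N (p - n))%:R)%:E * moment2 s y
  else (Khat ^+ 2 * (T `^ theta) ^+ 2)%:E.

Lemma error_recursion_ge0 n s y : 0 <= error_recursion n s y.
Proof.
elim: n s y => [|n IH] s y /=; first by rewrite lee_fin mulr_ge0 ?sqr_ge0.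
apply: adde_ge0; apply: mule_ge0.
- by rewrite lee_fin addr_ge0// divr_ge0.
- apply: mule_ge0; first by rewrite lee_fin mulr_ge0 ?sqr_ge0// invr_ge0 ltW.
  exact: weighted_ge0.
- by rewrite lee_fin divr_ge0.
- exact: second_moment_ge0.
Qed.

Lemma measurable_second_moment : measurable_fun setT (fun z : R * 'cV[R]_d => moment2 z.1 z.2).
Proof.
have ms2 : measurable_fun setT (fun z : R * 'cV[R]_d => src2 T mu sigma u z.1 z.2).
  by apply/measurable_EFinP; exact: (measurable_funX 2 (measurable_source mu sigma hu)).
have mg2 : measurable_fun setT (g2 g).
  by apply/measurable_EFinP; exact: (measurable_funX 2 (measurable_terminal hg)).
have mTs : measurable_fun setT (fun z : R * 'cV[R]_d => T - z.1)%R by exact: measurable_funB.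
apply: emeasurable_funD; apply: emeasurable_funM => //.
- apply/measurable_EFinP; apply: (measurableT_comp (@measurable_expR R)).
  exact: measurable_funM.
- apply: (measurable_flow_gen hB mu sigma (k := fun _ => g2 g) mTs measurable_snd).
    exact: (measurableT_comp mg2 measurable_snd).
  by move=> _ x; rewrite lee_fin sqr_ge0.
- by apply: (measurable_weighted hB mu sigma T lambda ms2) => t x; rewrite lee_fin sqr_ge0.
Qed.

Lemma measurable_error_recursion n :
  measurable_fun setT (fun z : R * 'cV[R]_d => error_recursion n z.1 z.2).
Proof.
elim: n => [|n IH] /=; first exact: measurable_cst.
apply: emeasurable_funD; apply: emeasurable_funM => //; last exact: measurable_second_moment.
apply: emeasurable_funM => //.
by apply: (measurable_weighted hB mu sigma T lambda IH); exact: error_recursion_ge0.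
Qed.

(** With [a] the bound of [child_error] and [b] the second moment of the exact
    payoff, the error of one child is the sum of a term of mean square at most
    [a], which also bounds its squared bias, and of a centred term of mean
    square at most [b]. The children are independent, so their average has mean
    square error at most [(2 a + 2 b) / M + a]. In the last generation the
    estimator is [g = u T], and the bound is the time regularity of [u]. *)
Lemma tree_estimator_error n k : is_index N k -> (size k + n = p)%N ->
  forall s y, (0 <= s < T)%R ->
  \int[P]_w ((tree_estimator n k s y w - u s y) ^+ 2)%:E <= error_recursion n s y.
Proof.
elim: n k => [|n IH] k kN kp s y sT; have /andP[s0 sT'] := sT.
  rewrite /tree_estimator /= integral_cst//= probability_setT mule1 lee_fin.
  have TT : (0 <= T <= T)%R by rewrite lexx ltW.
  have sT2 : (0 <= s <= T)%R by rewrite s0 ltW.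
  rewrite -(PDE_terminal hPDE) -real_normK ?num_real// -exprMn.
  have := hHolder y TT sT2; set q := (`|T - s| `^ theta)%R => h.
  apply: (@le_trans _ _ ((Khat * q) ^+ 2)%R).
    by rewrite ler_sqr ?nnegrE// (le_trans _ h).
  rewrite !exprMn ler_wpM2l ?sqr_ge0// ler_sqr ?nnegrE ?powR_ge0//.
  apply: ge0_ler_powR; rewrite ?nnegrE//; [exact: ltW|exact: ltW|].
  have -> : (`|T - s| = T - s)%R by rewrite ger0_norm// subr_ge0 ltW.
  by rewrite gerBl.
set M := N (size k).
have sk : (size k < p)%N by rewrite -kp addnS ltnS leq_addr.
have M0 : (0 < M)%N by exact: hN.
have pn : (p - n.+1 = size k)%N by rewrite -kp addnK.
pose ch (i : 'I_M) := i.+1 :: k.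
have chN i : is_index N (ch i) by rewrite /= kN andbT /= ltn_ord.
have chp i : (size (ch i) + n = p)%N by rewrite /= addSn -addnS.
have chQ i : Qupto N p (ch i).
  by exists (size k).+1 => //; split => //; exact: chN.
set a := (K ^+ 2 / lambda)%:E * weighted (error_recursion n) s y.
have kl0 : (0 <= K ^+ 2 / lambda)%R by rewrite mulr_ge0 ?sqr_ge0// invr_ge0 ltW.
have a0 : 0 <= a.
  rewrite /a mule_ge0 ?lee_fin//; apply: weighted_ge0; exact: error_recursion_ge0.
have b0 := second_moment_ge0 T mu sigma g u lambda0 P' B s y.
rewrite /= pn -/M -/a; set b := moment2 s y in b0 *.
have MR : (0 < 2 / M%:R :> R)%R by rewrite divr_gt0// ltr0n.
have [aoo|afin] := eqVneq a +oo.
  rewrite aoo gt0_muley ?lte_fin ?addr_gt0// addye ?leey//.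
  by rewrite gt_eqF// (lt_le_trans (ltNy0)) // mule_ge0// lee_fin ltW.
have [boo|bfin] := eqVneq b +oo.
  rewrite boo gt0_muley ?lte_fin// addey ?leey// gt_eqF// (lt_le_trans ltNy0)//.
  by rewrite mule_ge0// lee_fin addr_ge0// ltW.
have [ar aE] : exists ar : R, a = ar%:E.
  by case: a afin a0 => [a1 _ _|//|//]; exists a1.
have [br bE] : exists br : R, b = br%:E.
  by case: b bfin b0 => [b1 _ _|//|//]; exists b1.
have bfin' : moment2 s y < +oo by rewrite -/b bE ltry.
pose A i := approx_payoff n (ch i) s y.
pose E i := exact_pay (ch i) s y.
have mA i : measurable_fun setT (A i).
  have m := @measurable_approx_payoff n (ch i) s y (chN i) isT (eq_leq (chp i)).
  exact: (measurableT_comp m (mid (@lineageQ (ch i)))).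
have lE i : L2 P (E i) by exact: (exact_payoff_L2 lambda0 hf hg hu hPDE htau hW htauW hB (chQ i) sT bfin').
have hD i := child_error y (chN i) isT (eq_leq (chp i)) sT (measurable_error_recursion n)
  (@error_recursion_ge0 n) (IH (ch i) (chN i) (chp i)).
have lD i : L2 P (fun w => A i w - E i w)%R.
  split; first by apply: measurable_funB => //; exact: (lE i).1.
  by apply: le_lt_trans (hD i) _; rewrite -/a aE ltry.
have D2 i : (\int[P]_w ((A i w - E i w) ^+ 2) <= ar)%R.
  by rewrite -lee_fin Rintegral_EFin -?aE; [exact: hD|exact: L2_sqr_integrable].
have Emean i : (\int[P]_w E i w = u s y)%R.
  exact: (exact_payoff_mean lambda0 hf hg hu hPDE hgrowth htau hW htauW hB (chQ i) sT bfin').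
have E2 i : (\int[P]_w (E i w ^+ 2) = br)%R.
  apply: EFin_inj; rewrite Rintegral_EFin; last exact: L2_sqr_integrable.
  rewrite -bE; exact: (exact_payoff_sqr lambda0 hf hg hu hPDE htau hW htauW hB y (chQ i) sT).
pose X i w := (A i w - u s y)%R.
have XE i w : X i w = ((A i w - E i w) + (E i w - u s y))%R by rewrite /X; ring.
have lEc i : L2 P (fun w => E i w - u s y)%R by apply: L2B => //; exact: L2_cst.
have lX i : L2 P (X i).
  by have := L2D (lD i) (lEc i); under eq_fun do rewrite -XE.
have X2 i : (\int[P]_w (X i w ^+ 2) <= 2 * ar + 2 * br)%R.
  under eq_Rintegral do rewrite XE.
  apply: le_integral_sqrD => //; rewrite -(E2 i).
  exact: centred_le_second_moment.
have Xm i : ((\int[P]_w X i w) ^+ 2 <= ar)%R.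
  have -> : (\int[P]_w X i w = \int[P]_w (A i w - E i w))%R.
    under eq_Rintegral do rewrite XE.
    rewrite RintegralD//; [|exact: L2_integrable|exact: L2_integrable].
    rewrite [X in (_ + X)%R]RintegralB//; [|exact: L2_integrable|exact: prob_integrable_cst].
    by rewrite Emean Rintegral_prob_cst subrr addr0.
  by apply: le_trans (D2 i); exact: sqr_mean_le.
have Xij i j : i != j ->
    (\int[P]_w (X i w * X j w) = (\int[P]_w X i w) * (\int[P]_w X j w))%R.
  move=> ij; have mX i' : measurable_fun [set: node_type tau W (lineage (ch i'))] (X i').
    apply: measurable_funB => //.
    exact: (@measurable_approx_payoff n (ch i') s y (chN i') isT (eq_leq (chp i'))).
  apply: (mean_mul_nodes htau hW htauW (@lineageQ (ch i)) (@lineageQ (ch j)) _ (mX i) (mX j)) => //.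
  by apply: lineage_disjoint; rewrite eqSS.
have := mean_square_average M0 lX X2 Xm Xij.
have -> : \int[P]_w ((M%:R^-1 * \sum_i X i w) ^+ 2)%:E =
    \int[P]_w ((tree_estimator n.+1 k s y w - u s y) ^+ 2)%:E.
  apply: eq_integral => w _; congr ((_ ^+ 2)%:E).
  rewrite /tree_estimator /= -/M big_add1 big_mkord /= /X sumrB sumr_const card_ord mulrBr.
  by rewrite -[(u s y *+ M)%R]mulr_natl mulKf// pnatr_eq0 -lt0n.
move=> /le_trans; apply; rewrite aE bE -!EFinM -EFinD lee_fin.
by rewrite le_eqVlt; apply/orP; left; apply/eqP; field; rewrite pnatr_eq0 -lt0n.
Qed.

End error_recursion.

(** * Iterated integrals and the Gamma function *)

Section primitives.
Context {R : realType}.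
Local Notation leb := (@lebesgue_measure R).
Implicit Types (F G : R -> R) (c : R).

Definition monomial (k : nat) (t : R) : R := t ^+ k / k`!%:R.

Lemma monomial_ge0 k t : 0 <= t -> 0 <= monomial k t.
Proof. by move=> t0; rewrite /monomial divr_ge0// exprn_ge0. Qed.

Lemma measurable_monomial k : measurable_fun setT (monomial k).
Proof. by apply: measurable_funM => //; exact: measurable_funX. Qed.

Lemma integral_monomial_rev k (t : R) : 0 <= t ->
  (\int[leb]_(r in `[0%R, t[) (monomial k (t - r))%:E = (monomial k.+1 t)%:E)%E.
Proof.
move=> t0; rewrite integral_itv_bndo_bndc; last first.
  apply/measurable_EFinP; apply: measurable_funTS.
  by apply: (measurableT_comp (measurable_monomial k)); exact: measurable_funB.
move: t0; rewrite le_eqVlt => /predU1P[<-|t0].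
  by rewrite set_itv1 integral_set1 /monomial expr0n mul0r.
have cM j : continuous (fun r => monomial j (t - r)).
  move=> r; apply: cvgM; last exact: cvg_cst.
  apply: (@continuous_comp _ _ _ (fun r => t - r) (fun z => z ^+ j)); last exact: exprn_continuous.
  by apply: cvgB; [exact: cvg_cst|exact: cvg_id].
have dM (r : R) : is_derive r 1 (fun r => - monomial k.+1 (t - r)) (monomial k (t - r)).
  have d1 : is_derive r (1 : R) (fun r : R => t - r) (-1).
    have := is_deriveB (is_derive_cst t r (1 : R)) (is_derive_id r (1 : R)).
    by rewrite sub0r.
  have d2 := is_deriveX k.+1 d1.
  have d3 := is_deriveZ (- (k.+1)`!%:R^-1) d2.
  have -> : (fun r => - monomial k.+1 (t - r)) = (- (k.+1)`!%:R^-1) \*: ((fun r : R => t - r) ^+ k.+1).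
    have powE j z : ((fun r : R => t - r) ^+ j) z = (t - z) ^+ j.
      by elim: j => [|j IH]; rewrite ?expr0// !exprS -IH.
    apply/funext => z.
    rewrite -[RHS]/(- (k.+1)`!%:R^-1 * ((fun r : R => t - r) ^+ k.+1) z) powE.
    by rewrite /monomial mulNr mulrC.
  apply: (@is_derive_eq _ _ _ _ _ _ _ _ d3).
  rewrite /GRing.scale /= /monomial factS natrM.
  have k0 : k`!%:R != 0 :> R by rewrite pnatr_eq0 -lt0n fact_gt0.
  have k1 : k.+1%:R != 0 :> R by rewrite pnatr_eq0.
  move: (k.+1%:R : R) k1 (k`!%:R : R) k0 => a a0 c c0.
  by field; rewrite a0 c0.
rewrite (@continuous_FTC2 _ _ (fun r => - monomial k.+1 (t - r)))//.
- by rewrite subrr subr0 {1}/monomial expr0n mul0r oppr0 -EFinB opprK add0r.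
- by apply: continuous_subspaceT => r; exact: cM.
- split.
  + by move=> r _; exact: ex_derive.
  + by apply/cvg_at_right_filter; apply: cvgN; exact: cM.
  + by apply/cvg_at_left_filter; apply: cvgN; exact: cM.
- by move=> r _; rewrite derive1E; exact: derive_val.
Qed.

(** Expressed by the integral over the remaining time, which is the form in
    which the error recursion produces it. *)
Definition primitive F G := [/\ measurable_fun setT F, forall t, 0 <= t -> 0 <= F t &
  forall t, 0 <= t -> (\int[leb]_(r in `[0%R, t[) (F (t - r))%:E = (G t)%:E)%E].

Let measurable_rev F (t : R) (D : set R) : measurable_fun setT F ->
  measurable_fun D (fun r => (F (t - r))%:E).
Proof.
move=> mF; apply/measurable_EFinP; apply: measurable_funTS.
by apply: (measurableT_comp mF); exact: measurable_funB.
Qed.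

Let rev_ge0 F (t r : R) : (forall t, 0 <= t -> 0 <= F t) -> `[0, t[%classic r -> (0 <= (F (t - r))%:E)%E.
Proof.
by move=> F0; rewrite /= in_itv /= => /andP[r0 rt]; rewrite lee_fin F0// subr_ge0 ltW.
Qed.

Lemma primitive_monomial k : primitive (monomial k) (monomial k.+1).
Proof.
split; [exact: measurable_monomial|exact: monomial_ge0|exact: integral_monomial_rev].
Qed.

Lemma primitiveD F1 G1 F2 G2 : primitive F1 G1 -> primitive F2 G2 ->
  primitive (fun t => F1 t + F2 t) (fun t => G1 t + G2 t).
Proof.
move=> [m1 p1 e1] [m2 p2 e2]; split; first exact: measurable_funD.
  by move=> t t0; rewrite addr_ge0 ?p1 ?p2.
move=> t t0; under eq_integral do rewrite EFinD.
rewrite ge0_integralD//; [by rewrite e1// e2|..].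
- by move=> r; exact: rev_ge0.
- exact: measurable_rev.
- by move=> r; exact: rev_ge0.
- exact: measurable_rev.
Qed.

Lemma primitiveZ c F G : 0 <= c -> primitive F G ->
  primitive (fun t => c * F t) (fun t => c * G t).
Proof.
move=> c0 [m p e]; split; first exact: measurable_funM.
  by move=> t t0; rewrite mulr_ge0 ?p.
move=> t t0; under eq_integral do rewrite EFinM.
rewrite ge0_integralZl//; [by rewrite e|exact: measurable_rev|].
by move=> r; exact: rev_ge0.
Qed.

Lemma primitive_sum n (F G : nat -> R -> R) : (forall i, primitive (F i) (G i)) ->
  primitive (fun t => \sum_(i < n) F i t) (fun t => \sum_(i < n) G i t).
Proof.
move=> FG; elim: n => [|n IH].
  under [X in primitive X _]eq_fun do rewrite big_ord0.
  under [X in primitive _ X]eq_fun do rewrite big_ord0.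
  by split => // t t0; rewrite integral0.
under [X in primitive X _]eq_fun do rewrite big_ord_recr /=.
under [X in primitive _ X]eq_fun do rewrite big_ord_recr /=.
exact: primitiveD.
Qed.

End primitives.

Section gamma.
Context {R : realType}.
Local Notation leb := (@lebesgue_measure R).

Let mexpN : measurable_fun setT (fun x : R => expR (- x)).
Proof.
under eq_fun do rewrite -mulN1r.
by apply: (measurableT_comp (@measurable_expR R)); exact: measurable_funM.
Qed.

Local Open Scope ereal_scope.

Let exp_tail (t : R) : (0 <= t)%R ->
  \int[leb]_(x in `[t, +oo[) (expR (- x))%:E = (expR (- t))%:E.
Proof.
move=> t0; have := @exponential_tail R 1 ltr01 t t0; rewrite mulN1r => <-.
apply: eq_integral => x; rewrite inE /= in_itv /= andbT => tx.
by rewrite exponential_pdfE ?(le_trans t0)// mul1r mulN1r.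
Qed.

(** [monomial n.+1] is the integral of [monomial n]; exchanging the two
    integrals leaves the tail [expR (- r)] in front of [monomial n r]. *)
Lemma integral_monomial_exp n :
  \int[leb]_(t in `[0%R, +oo[) (monomial n t * expR (- t))%:E = 1.
Proof.
elim: n => [|n IH].
  transitivity (\int[leb]_(x in `[0%R, +oo[) (expR (- x))%:E : \bar R).
    by apply: eq_integral => x _; rewrite /monomial expr0 fact0 divr1 mul1r.
  by rewrite exp_tail// oppr0 expR0.
rewrite -{}IH.
pose F (z : measurableTypeR R * measurableTypeR R) : \bar R :=
  if (0 <= z.2)%R && (z.2 <= z.1)%R then (monomial n z.2 * expR (- z.1))%:E else 0.
have mF : measurable_fun setT F.
  apply: measurable_fun_ifT => //.
    by apply: measurable_and; exact: measurable_fun_ler.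
  apply/measurable_EFinP; apply: measurable_funM.
    exact: (measurableT_comp (measurable_monomial n) measurable_snd).
  exact: (measurableT_comp mexpN measurable_fst).
have F0 z : 0 <= F z.
  by rewrite /F; case: ifP => // /andP[z0 _]; rewrite lee_fin mulr_ge0 ?expR_ge0 ?monomial_ge0.
have m2 : measurable_fun setT (fun t : R => (expR (- t))%:E).
  by apply/measurable_EFinP; exact: mexpN.
transitivity (\int[leb]_t \int[leb]_r F (t, r)).
  rewrite integral_mkcond; apply: eq_integral => t _; rewrite /patch mem_setE in_itv /= andbT.
  have [t0|t0] := leP 0%R t; last first.
    rewrite integral0_eq// => r _; rewrite /F /=; case: ifP => // /andP[r0 rt].
    by have := lt_le_trans t0 (le_trans r0 rt); rewrite ltxx.
  transitivity (\int[leb]_(r in `[0%R, t]) ((expR (- t))%:E * (monomial n r)%:E)).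
    rewrite ge0_integralZl//; last 2 first.
    - by apply/measurable_EFinP; apply: measurable_funTS; exact: measurable_monomial.
    - by move=> r; rewrite /= in_itv /= => /andP[r0 _]; rewrite lee_fin monomial_ge0.
    have -> : \int[leb]_(r in `[0%R, t]) (monomial n r)%:E = (monomial n.+1 t)%:E.
      have := integral_power n t0.
      have k0 : ((n.+1)`!%:R != 0 :> R)%R by rewrite pnatr_eq0 -lt0n fact_gt0.
      move=> /(congr1 (fun z => ((n.+1)`!%:R^-1)%:E * z)); rewrite -ge0_integralZl//.
      - rewrite -EFinM /monomial mulrC => <-; apply: eq_integral => r _.
        rewrite -EFinM; congr EFin; rewrite factS natrM.
        have n0 : (n`!%:R != 0 :> R)%R by rewrite pnatr_eq0 -lt0n fact_gt0.
        have n1 : (n.+1%:R != 0 :> R)%R by rewrite pnatr_eq0.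
        move: (n.+1%:R : R) n1 (n`!%:R : R) n0 => a a0 c c0.
        by field; rewrite a0 c0.
      - apply/measurable_EFinP; apply: measurable_funTS; exact: measurable_funM.
      - by move=> r; rewrite /= in_itv /= => /andP[r0 _]; rewrite lee_fin mulr_ge0// exprn_ge0.
    by rewrite -EFinM mulrC.
  rewrite integral_mkcond; apply: eq_integral => r _; rewrite /patch mem_setE in_itv /= /F /=.
  by case: ifP => // _; rewrite -EFinM mulrC.
rewrite (@fubini_tonelli _ _ _ _ _ leb leb F mF F0).
rewrite [RHS]integral_mkcond; apply: eq_integral => r _; rewrite /patch mem_setE in_itv /= andbT /fubini_G /=.
have [r0|r0] := leP 0%R r; last first.
  by rewrite integral0_eq// => t _; rewrite /F /= leNgt r0.
transitivity (\int[leb]_(t in `[r, +oo[) ((monomial n r)%:E * (expR (- t))%:E)).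
  rewrite [RHS]integral_mkcond; apply: eq_integral => t _; rewrite /patch mem_setE in_itv /= andbT /F /=.
  by rewrite r0 /=; case: ifP.
rewrite ge0_integralZl//; last 2 first.
- exact: (measurable_funTS m2).
- by rewrite lee_fin monomial_ge0.
by rewrite exp_tail.
Qed.

Lemma Gamma_fact n : Gamma n.+1%:R = n`!%:R :> R.
Proof.
have k0 : (n`!%:R != 0 :> R)%R by rewrite pnatr_eq0 -lt0n fact_gt0.
rewrite /Gamma /Rintegral integral_itv_obnd_cbnd; last first.
  apply/measurable_EFinP; apply: measurable_funM.
    exact: (measurableT_comp (measurable_powR _)).
  exact: measurable_funTS.
transitivity (fine (n`!%:R%:E * \int[leb]_(t in `[0%R, +oo[) (monomial n t * expR (- t))%:E)); last first.
  by rewrite integral_monomial_exp mule1.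
congr fine; rewrite -ge0_integralZl//; last 2 first.
- apply/measurable_EFinP; apply: measurable_funTS; apply: measurable_funM; first exact: measurable_monomial.
  exact: measurable_funTS.
- by move=> t; rewrite /= in_itv /= andbT => t0; rewrite lee_fin mulr_ge0 ?expR_ge0 ?monomial_ge0.
apply: eq_integral => t; rewrite inE /= in_itv /= andbT => t0.
rewrite -EFinM /monomial mulrA mulrCA mulfV// mulr1; congr ((_ * _)%:E).
have -> : (n.+1%:R - 1 = n%:R :> R)%R by rewrite -natr1 addrK.
exact: powR_mulrn.
Qed.

End gamma.

(** * The bound at the starting point *)

Section scalar_recursion.
Context {R : realType}.
Variables (N : nat -> nat) (C0 kap G Fl : R).
Hypotheses (C00 : 0 <= C0) (kap0 : 0 <= kap) (G0 : 0 <= G) (Fl0 : 0 <= Fl).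

Definition sampling_weight j : R := 2 / (N j)%:R.

Definition sampling_prod (c : R) q m : R := \prod_(i < m) (1 + c / (N (q + i))%:R).

(** Solution of the scalar recursion, as a polynomial in the remaining time;
    [sh] shifts all the degrees, so that [sh = 1] gives the primitive. *)
Definition error_poly (sh n q : nat) (t : R) : R :=
  sampling_prod 2 q n * kap ^+ n * C0 * monomial (n + sh) t +
  \sum_(m < n) sampling_weight (q + m) * sampling_prod 2 q m * kap ^+ m *
    (G * monomial (m + sh) t + Fl * monomial (m.+1 + sh) t).

Lemma sampling_prod_ge0 c q m : 0 <= c -> 0 <= sampling_prod c q m.
Proof. by move=> c0; apply: prodr_ge0 => i _; rewrite addr_ge0// divr_ge0. Qed.

Lemma sampling_weight_ge0 j : 0 <= sampling_weight j.
Proof. by rewrite divr_ge0. Qed.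

Lemma error_poly_primitive n q : primitive (error_poly 0 n q) (error_poly 1 n q).
Proof.
apply: primitiveD.
  apply: primitiveZ; first by rewrite !mulr_ge0 ?sampling_prod_ge0 ?exprn_ge0.
  by rewrite addn0 addn1; exact: primitive_monomial.
apply: (primitive_sum n (F := fun m t => sampling_weight (q + m) * sampling_prod 2 q m * kap ^+ m *
    (G * monomial (m + 0) t + Fl * monomial (m.+1 + 0) t))
  (G := fun m t => sampling_weight (q + m) * sampling_prod 2 q m * kap ^+ m *
    (G * monomial (m + 1) t + Fl * monomial (m.+1 + 1) t))) => m.
apply: primitiveZ.
  by rewrite !mulr_ge0 ?sampling_weight_ge0 ?sampling_prod_ge0 ?exprn_ge0.
by rewrite !addn0 !addn1; apply: primitiveD; apply: primitiveZ => //; exact: primitive_monomial.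
Qed.

Lemma sampling_prodS c q m :
  sampling_prod c q m.+1 = (1 + c / (N q)%:R) * sampling_prod c q.+1 m.
Proof.
rewrite /sampling_prod big_ord_recl addn0; congr (_ * _).
by apply: eq_bigr => i _; rewrite /bump /= addSnnS.
Qed.

Lemma error_polyS n q t : error_poly 0 n.+1 q t =
  (1 + sampling_weight q) * (kap * error_poly 1 n q.+1 t) + sampling_weight q * (G + Fl * t).
Proof.
rewrite /error_poly big_ord_recl /= !addn0 sampling_prodS {2}/sampling_prod big_ord0 expr0.
have -> : monomial 0 t = 1 by rewrite /monomial expr0 fact0 divr1.
have -> : monomial 1 t = t by rewrite /monomial expr1 divr1.
have -> : \sum_(i < n) sampling_weight (q + bump 0 i) * sampling_prod 2 q (bump 0 i) *
     kap ^+ bump 0 i * (G * monomial (bump 0 i + 0) t + Fl * monomial ((bump 0 i).+1 + 0) t) =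
  (1 + sampling_weight q) * kap * \sum_(m < n) sampling_weight (q.+1 + m) * sampling_prod 2 q.+1 m *
     kap ^+ m * (G * monomial (m + 1) t + Fl * monomial (m.+1 + 1) t).
  rewrite mulr_sumr; apply: eq_bigr => i _.
  by rewrite /bump leq0n add1n !addn0 !addn1 sampling_prodS addSnnS exprS -/(sampling_weight q); ring.
rewrite addn1 exprS -/(sampling_weight q).
move: (\sum_(m < n) _) (sampling_prod _ _ _) (kap ^+ n) (monomial _ _) => S a b c.
by rewrite -/(sampling_weight q); ring.
Qed.

End scalar_recursion.

Section integrated_error.
Context {R : realType} {d : nat}.
Variables (T : R) (lambda : R) (x : 'cV[R]_d) (mu : 'cV[R]_d) (sigma : 'M[R]_d).
Variables (f : R -> 'cV[R]_d -> R -> R) (g : 'cV[R]_d -> R) (u : R -> 'cV[R]_d -> R).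
Hypotheses (T_gt0 : 0 < T) (lambda0 : 0 < lambda).
Hypothesis hg : Borel_on [set: 'cV[R]_d] g.
Variable K : R.
Hypotheses (hu : C12 T u).
Variables (p : nat) (N : nat -> nat).
Context {dO' : measure_display} {Omega' : measurableType dO'}.
Variables (P' : probability Omega' R) (B : R -> Omega' -> 'cV[R]_d).
Hypothesis hB : brownian P' B.
Variables (Khat theta : R).
Local Notation flow := (flow P' B mu sigma).
Local Notation weighted := (weighted P' B mu sigma T lambda).
Local Notation src2 := (src2 T mu sigma u).
Local Notation moment2 := (second_moment T lambda mu sigma g u P' B).
Local Notation recursion := (error_recursion T lambda mu sigma g u K p N P' B Khat theta).
Variables (G F : R).
Hypotheses (F0 : 0 <= F).
Hypothesis hG : flow T (g2 g) x = G%:E.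
Hypothesis hF : forall t, 0 <= t < T -> (flow t (src2 t) x <= F%:E)%E.
Local Notation C0 := (Khat ^+ 2 * (T `^ theta) ^+ 2).
Local Notation kap := (K ^+ 2 / lambda).
Local Notation poly := (error_poly N C0 kap G (F / lambda)).
Local Open Scope ereal_scope.

Let ms2 : measurable_fun setT (fun z : R * 'cV[R]_d => src2 z.1 z.2).
Proof. by apply/measurable_EFinP; exact: (measurable_funX 2 (measurable_source mu sigma hu)). Qed.

Let s20 t y : 0 <= src2 t y. Proof. by rewrite lee_fin sqr_ge0. Qed.

Let mg2 : measurable_fun setT (g2 g).
Proof. by apply/measurable_EFinP; exact: (measurable_funX 2 (measurable_terminal hg)). Qed.

Let g20 y : 0 <= g2 g y. Proof. by rewrite lee_fin sqr_ge0. Qed.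

Let expD (s r : R) : (expR (lambda * r) * expR (lambda * (T - (s + r))) = expR (lambda * (T - s)))%R.
Proof. by rewrite -expRD; congr expR; ring. Qed.

Let lint_cst (t c : R) : (0 <= t)%R ->
  \int[lebesgue_measure]_(r in `[0%R, t[) c%:E = (c * t)%:E.
Proof.
move=> t0; rewrite integral_cst//= lebesgue_measure_itv /= lte_fin.
move: t0; rewrite le_eqVlt => /predU1P[<-|t0]; first by rewrite ltxx mule0 mulr0.
by rewrite t0 -EFinB subr0.
Qed.

(** Averaging over the position at [s] moves the terminal time of the first
    summand to [T] and each time of the second one to a time below [T], where
    [G] and [F] are the bounds. *)
Lemma integrated_moment s : (0 <= s < T)%R ->
  flow s (moment2 s) x <= (expR (lambda * (T - s)) * (G + F / lambda * (T - s)))%:E.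
Proof.
move=> /andP[s0 sT]; have t0 : (0 <= T - s)%R by rewrite subr_ge0 ltW.
have li0 : (0 <= lambda^-1)%R by rewrite invr_ge0 ltW.
have mw := measurable_weighted hB mu sigma T lambda ms2 s20.
have mws : measurable_fun setT (weighted src2 s).
  exact: (@measurable_slice _ _ _ _ _ _ (weighted src2) s mw).
have w0 := weighted_ge0 P' B mu sigma T lambda s20 s.
have mfl := measurable_flow hB mu sigma (T - s) mg2 g20.
have fl0 y : 0 <= flow (T - s) (g2 g) y by exact: flow_ge0.
rewrite /second_moment (flowD hB mu sigma s x); last 4 first.
- exact: measurable_funeM.
- exact: measurable_funeM.
- by move=> y; rewrite mule_ge0// lee_fin expR_ge0.
- by move=> y; rewrite mule_ge0// lee_fin.
rewrite (flowZ hB mu sigma s x (expR_ge0 _) mfl fl0) (flowZ hB mu sigma s x li0 mws w0).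
rewrite (flow_semigroup hB mu sigma x s0 t0 mg2 g20) (_ : (s + (T - s) = T)%R); last by ring.
rewrite hG (flow_weighted hB mu sigma T lambda ms2 s20 x s0) (mulrDr (expR _)) EFinD -EFinM.
apply: leeD2l.
have -> : (expR (lambda * (T - s)) * (F / lambda * (T - s)))%:E =
    lambda^-1%:E * (expR (lambda * (T - s)) * F * (T - s))%:E.
  by rewrite -EFinM; congr EFin; ring.
apply: lee_wpmul2l; first by rewrite lee_fin.
rewrite -(lint_cst _ t0); apply: le_integral_ge0 => r /=; rewrite in_itv /= => /andP[r0 rT].
  by apply: mule_ge0; [rewrite lee_fin expR_ge0|exact: flow_ge0].
have sr : (0 <= s + r < T)%R by rewrite addr_ge0//= -ltrBrDl.
rewrite EFinM; apply: lee_pmul; rewrite ?lee_fin ?expR_ge0//.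
- exact: flow_ge0.
- by rewrite ler_expR ler_wpM2l// ltW.
- exact: hF.
Qed.

Let G0 : (0 <= G)%R. Proof. by rewrite -lee_fin -hG; exact: flow_ge0. Qed.
Let kap0 : (0 <= kap)%R. Proof. by rewrite mulr_ge0 ?sqr_ge0// invr_ge0 ltW. Qed.
Let Fl0 : (0 <= F / lambda)%R. Proof. by rewrite mulr_ge0// invr_ge0 ltW. Qed.
Let C00 : (0 <= C0)%R. Proof. by rewrite mulr_ge0 ?sqr_ge0. Qed.

(** The recursion is not closed for the worst case over positions, only for
    averages along the diffusion started at [x]: there the semigroup property
    turns [weighted] into an integral over later dates, the exponentials combine
    to [expR (lambda * (T - s))], and the scalar recursion [error_polyS]
    remains. *)
Lemma integrated_error n : (n <= p)%N -> forall s, (0 <= s < T)%R ->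
  flow s (recursion n s) x <= (expR (lambda * (T - s)) * poly 0 n (p - n) (T - s))%:E.
Proof.
elim: n => [|n IH] np s sT; have /andP[s0 sT'] := sT.
  rewrite /= flow_cst /error_poly big_ord0 addr0 /sampling_prod big_ord0 expr0 !mul1r.
  rewrite /monomial expr0 fact0 divr1 mulr1 lee_fin ler_peMl//.
  by rewrite -expR0 ler_expR mulr_ge0 ?(ltW lambda0)// subr_ge0 ltW.
have t0 : (0 <= T - s)%R by rewrite subr_ge0 ltW.
have mr := measurable_error_recursion mu sigma lambda0 hg K hu p N hB Khat theta n.
have r0 := error_recursion_ge0 T mu sigma g u lambda0 K p N P' B Khat theta n.
have mw := measurable_weighted hB mu sigma T lambda mr r0.
have mws : measurable_fun setT (weighted (recursion n) s).
  exact: (@measurable_slice _ _ _ _ _ _ (weighted (recursion n)) s mw).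
have w0 := weighted_ge0 P' B mu sigma T lambda r0 s.
have mm : measurable_fun setT (moment2 s).
  exact: (@measurable_slice _ _ _ _ _ _ moment2 s (measurable_second_moment lambda mu sigma hg hu hB)).
have m0 := second_moment_ge0 T mu sigma g u lambda0 P' B s.
pose wq : R := (2 / (N (p - n.+1))%:R)%R.
have wq0 : (0 <= wq)%R by rewrite divr_ge0.
have wq10 : (0 <= 1 + wq)%R by rewrite addr_ge0.
have recE : recursion n.+1 s =
    (fun y => (1 + wq)%:E * (kap%:E * weighted (recursion n) s y) + wq%:E * moment2 s y).
  by [].
rewrite recE.
have mkw : measurable_fun setT (fun y => kap%:E * weighted (recursion n) s y) by exact: measurable_funeM.
have kw0 y : 0 <= kap%:E * weighted (recursion n) s y by rewrite mule_ge0 ?lee_fin.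
rewrite (flowD hB mu sigma s x); last 4 first.
- exact: measurable_funeM.
- exact: measurable_funeM.
- by move=> y; rewrite mule_ge0// lee_fin.
- by move=> y; rewrite mule_ge0// lee_fin.
rewrite (flowZ hB mu sigma s x wq10 mkw kw0) (flowZ hB mu sigma s x kap0 mws w0).
rewrite (flowZ hB mu sigma s x wq0 mm m0).
have pn : (p - n.+1).+1 = (p - n)%N by rewrite -subSn// subSS.
rewrite error_polyS pn (mulrDr (expR _)) [leRHS]EFinD; apply: leeD; last first.
  rewrite (mulrCA (expR _) (sampling_weight _ _)) [leRHS]EFinM.
  by apply: lee_wpmul2l; [rewrite lee_fin|exact: integrated_moment].
have -> : (expR (lambda * (T - s)) * ((1 + sampling_weight N (p - n.+1)) *
    (kap * poly 1 n (p - n) (T - s))) =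
  (1 + wq) * (kap * (expR (lambda * (T - s)) * poly 1 n (p - n) (T - s))))%R.
  by rewrite /wq /sampling_weight; ring.
rewrite [leRHS]EFinM; apply: lee_wpmul2l; first by rewrite lee_fin.
rewrite [leRHS]EFinM; apply: lee_wpmul2l; first by rewrite lee_fin.
rewrite (flow_weighted hB mu sigma T lambda mr r0 x s0).
have [mp pp ep] := error_poly_primitive N C00 kap0 G0 Fl0 n (p - n).
rewrite EFinM -(ep _ t0) -ge0_integralZl//; last 2 first.
- apply/measurable_EFinP; apply: measurable_funTS; apply: (measurableT_comp mp).
  exact: measurable_funB.
- by move=> r /=; rewrite in_itv /= => /andP[r0' rT]; rewrite lee_fin pp// subr_ge0 ltW.
apply: le_integral_ge0 => r /=; rewrite in_itv /= => /andP[r0' rT].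
  by apply: mule_ge0; [rewrite lee_fin expR_ge0|exact: flow_ge0].
have sr : (0 <= s + r < T)%R by rewrite addr_ge0//= -ltrBrDl.
have -> : (T - s - r = T - (s + r))%R by ring.
rewrite -(expD s r) -EFinM -mulrA EFinM; apply: lee_wpmul2l; first by rewrite lee_fin expR_ge0.
exact: IH (ltnW np) _ sr.
Qed.

End integrated_error.

Section null_sets.
Context {R : realType} {dO : measure_display} {Omega : measurableType dO}.
Variable P : probability Omega R.
Local Open Scope ereal_scope.

(** Giving [h2] the value [+oo] on the exceptional set does not change its
    integral and makes the comparison hold everywhere. *)
Lemma ae_le_integral (h1 h2 : Omega -> \bar R) : measurable_fun setT h2 ->
  (forall w, 0 <= h1 w) -> (forall w, 0 <= h2 w) -> {ae P, forall w, h1 w <= h2 w} ->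
  \int[P]_w h1 w <= \int[P]_w h2 w.
Proof.
move=> m2 p1 p2 [A [mA PA hA]].
pose h3 w := h2 w + +oo * (\1_A w)%:E.
have h3A w : A w -> h3 w = +oo.
  by move=> wA; rewrite /h3 indicE mem_set// mule1 addey// gt_eqF// (lt_le_trans ltNy0).
have h3N w : ~ A w -> h3 w = h2 w.
  by move=> wA; rewrite /h3 indicE memNset// mule0 adde0.
have m3 : measurable_fun setT h3.
  apply: emeasurable_funD => //; apply: measurable_funeM.
  by apply/measurable_EFinP; exact: measurable_indic.
have p3 w : 0 <= h3 w by have [/h3A ->|/h3N ->] := pselect (A w); rewrite ?leey.
have -> : \int[P]_w h2 w = \int[P]_w h3 w.
  apply: ge0_ae_eq_integral => //.
  exists A; split => // w /= h; apply: contrapT => wA; apply: h => _.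
  by rewrite h3N.
apply: le_integral_ge0 => // w _.
have [/h3A ->|wA] := pselect (A w); first exact: leey.
by rewrite h3N//; apply: contrapT => h; apply: wA; exact: hA.
Qed.

Lemma clocks_nonneg (lambda : R) (Q : set (seq nat)) (tau : seq nat -> Omega -> R) :
  switching_times P lambda Q tau -> {ae P, forall w k, Q k -> (0 <= tau k w)%R}.
Proof.
move=> htau.
pose pr (o : option (seq nat)) w := if o is Some k then Q k -> (0 <= tau k w)%R else True.
have H (n : nat) : {ae P, forall w, pr (choice.unpickle n) w}.
  case: (choice.unpickle n) => [k|]; last exact: aeW.
  have [Qk|nQk] := pselect (Q k); last by apply: aeW => w /nQk.
  by have := clock_nonneg (switching_meas htau Qk) (switching_law htau Qk); apply: filterS => w h _.
have := ae_foralln H; apply: filterS => w Hw k Qk.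
by have := Hw (choice.pickle k); rewrite choice.pickleK => /(_ Qk).
Qed.

End null_sets.

Section final_comparison.
Context {R : realType}.
Variables (N : nat -> nat) (T lambda K Khat theta G F : R).
Hypotheses (T_gt0 : 0 < T) (lambda0 : 0 < lambda) (G0 : 0 <= G) (F0 : 0 <= F).

Lemma inv_Gamma i : (if (0 < i)%N then (i%:R * Gamma i%:R)^-1 else 0) + (i == 0%N)%:R
  = (i`!%:R)^-1 :> R.
Proof.
case: i => [|i]; first by rewrite fact0 invr1 add0r.
by rewrite /= Gamma_fact addr0 -natrM -factS.
Qed.

Lemma sampling_prod_le q m : sampling_prod N 2 q m <= sampling_prod N 8 q m :> R.
Proof.
apply: ler_prod => i _; rewrite addr_ge0 ?divr_ge0//= lerD2l ler_wpM2r ?invr_ge0//.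
by rewrite ler_nat.
Qed.

Lemma sampling_prodE m : sampling_prod N 8 0 m = \prod_(1 <= i < m.+1) (1 + 8 / (N i.-1)%:R) :> R.
Proof. by rewrite big_add1 big_mkord. Qed.

(** The two sides agree term by term up to the factors [1 + 2 / N] against [1 +
    8 / N] and [2] against [4]. *)
Lemma error_poly_le p : (0 < p)%N ->
  expR (lambda * T) * error_poly N (Khat ^+ 2 * (T `^ theta) ^+ 2) (K ^+ 2 / lambda) G (F / lambda) 0 p 0 T
  <= (\prod_(1 <= i < p.+1) (1 + 8 / (N i.-1)%:R))
    * (K ^+ (2 * p) * expR (lambda * T) / lambda ^+ p)
    * T `^ (2 * theta) * Khat ^+ 2 * (T ^+ p / (p%:R * Gamma p%:R))
  + \sum_(0 <= i < p)
      (K ^+ (2 * i) / (N i)%:R * (\prod_(1 <= j < i.+1) (1 + 8 / (N j.-1)%:R))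
        * (T ^+ i * expR (lambda * T) / lambda ^+ i)) *
      (4 * T / (lambda * (i.+1)`!%:R) * F + 2 * G *
        ((if (0 < i)%N then (i%:R * Gamma i%:R)^-1 else 0) + (i == 0%N)%:R)).
Proof.
move=> p0; have e0 : 0 <= expR (lambda * T) by exact: expR_ge0.
have T0 : 0 <= T by exact: ltW.
have ln0 : lambda != 0 by rewrite gt_eqF.
have kE m : (K ^+ 2 / lambda) ^+ m = K ^+ (2 * m) / lambda ^+ m by rewrite expr_div_n exprM.
rewrite /error_poly mulrDr; apply: lerD.
  have -> : T `^ (2 * theta) = (T `^ theta) ^+ 2.
    by rewrite mulrC powRrM powR_mulrn// powR_ge0.
  have -> : T ^+ p / (p%:R * Gamma p%:R) = monomial p T.
    by case: p p0 => // n _; rewrite Gamma_fact -natrM -factS.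
  rewrite addn0 -sampling_prodE kE.
  have m0 : 0 <= monomial p T by exact: monomial_ge0.
  set c := K ^+ (2 * p) / lambda ^+ p.
  have c0 : 0 <= c.
    apply: divr_ge0; last exact/exprn_ge0/ltW.
    by rewrite exprM exprn_ge0// sqr_ge0.
  have -> : sampling_prod N 8 0 p * (K ^+ (2 * p) * expR (lambda * T) / lambda ^+ p) *
     (T `^ theta) ^+ 2 * Khat ^+ 2 * monomial p T =
    expR (lambda * T) * (sampling_prod N 8 0 p * c * (Khat ^+ 2 * (T `^ theta) ^+ 2) * monomial p T).
    by rewrite /c; ring.
  apply: ler_wpM2l => //; apply: ler_wpM2r => //; apply: ler_wpM2r; first by rewrite mulr_ge0 ?sqr_ge0.
  by apply: ler_wpM2r => //; exact: sampling_prod_le.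
rewrite big_mkord mulr_sumr; apply: ler_sum => i _; rewrite inv_Gamma add0n !addn0 kE.
rewrite -sampling_prodE /sampling_weight.
set c := K ^+ (2 * i) / lambda ^+ i.
have c0 : 0 <= c.
    apply: divr_ge0; last exact/exprn_ge0/ltW.
    by rewrite exprM exprn_ge0// sqr_ge0.
have -> : expR (lambda * T) * (2 / (N i)%:R * sampling_prod N 2 0 i * c *
    (G * monomial i T + F / lambda * monomial i.+1 T)) =
  (expR (lambda * T) * (N i)%:R^-1 * c * T ^+ i) * (sampling_prod N 2 0 i *
    (2 * G * i`!%:R^-1 + 2 * (T / (lambda * (i.+1)`!%:R) * F))).
  by rewrite /monomial exprS invfM; ring.
have -> : K ^+ (2 * i) / (N i)%:R * sampling_prod N 8 0 i * (T ^+ i * expR (lambda * T) / lambda ^+ i) *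
    (4 * T / (lambda * (i.+1)`!%:R) * F + 2 * G / i`!%:R) =
  (expR (lambda * T) * (N i)%:R^-1 * c * T ^+ i) * (sampling_prod N 8 0 i *
    (2 * G * i`!%:R^-1 + 4 * (T / (lambda * (i.+1)`!%:R) * F))).
  by rewrite /c; ring.
clearbody c; apply: ler_wpM2l.
  by rewrite !mulr_ge0 ?exprn_ge0 ?invr_ge0 ?expR_ge0.
have b0 : 0 <= T / (lambda * (i.+1)`!%:R) * F by rewrite mulr_ge0// divr_ge0// mulr_ge0// ltW.
have g0 : 0 <= 2 * G * i`!%:R^-1 by rewrite mulr_ge0 ?invr_ge0// mulr_ge0.
apply: ler_pM.
- exact: sampling_prod_ge0.
- by rewrite addr_ge0// mulr_ge0.
- exact: sampling_prod_le.
- by rewrite lerD2l ler_wpM2r// ler_nat.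
Qed.

End final_comparison.

Theorem proposition2p3 (R : realType) (d : nat) (hd : (1 <= d)%N)
  (T : R) (hT : 0 < T) (x : 'cV[R]_d) (lambda : R) (hlambda : 0 < lambda)
  (mu : 'cV[R]_d) (sigma : 'M[R]_d)
  (f : R -> 'cV[R]_d -> R -> R) (g : 'cV[R]_d -> R)
  (hf : Borel_on [set z : R * 'cV[R]_d * R | 0 <= z.1.1 <= T]
          (fun z => f z.1.1 z.1.2 z.2))
  (hg : Borel_on [set: 'cV[R]_d] g)
  (K : R)
  (hK : forall (t : R) x' y w, 0 <= t <= T ->
     `|f t x' y - f t x' w| <= K * `|y - w|)
  (u : R -> 'cV[R]_d -> R) (hu : C12 T u) (hPDE : solves_PDE T mu sigma f g u)
  (theta : R) (htheta : 0 < theta <= 1) (Khat : R)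
  (hHolder : forall (t s : R) x', 0 <= t <= T -> 0 <= s <= T ->
     `|u t x' - u s x'| <= Khat * `|t - s| `^ theta)
  (hgrowth : quadratic_growth T u)
  (p : nat) (hp : (1 <= p)%N)
  (N : nat -> nat) (hN : forall i, (i < p)%N -> (0 < N i)%N)
  (dO : measure_display) (Omega : measurableType dO) (P : probability Omega R)
  (tau : seq nat -> Omega -> R) (W : seq nat -> R -> Omega -> 'cV[R]_d)
  (htau : switching_times P lambda (Qupto N p) tau)
  (hW : brownian_motions P (Qupto N p) W)
  (htauW : times_motions_indep P (Qupto N p) tau W)
  (dO' : measure_display) (Omega' : measurableType dO')
  (P' : probability Omega' R)
  (B : R -> Omega' -> 'cV[R]_d) (hB : brownian P' B) :
  ('E_P[(fun w => (ubar T lambda x mu sigma f g N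
                    (fun k => tau k w) (fun k s => W k s w) p - u 0 x) ^+ 2)%R]
   <= error_bound P' T lambda f g u
        (fun t w => x + t *: mu + sigma *m B t w)%R p N K Khat theta)%E.
Proof.
set X := fun (t : R) (w : Omega') => x + t *: mu + sigma *m B t w.
set Fs := (ereal_sup [set 'E_P'[(fun w => f t (X t w) (u t (X t w)) ^+ 2)%R]
              | t in `[0%R, T]])%E.
set Gs := ('E_P'[(fun w => g (X T w) ^+ 2)%R])%E.
have T0 : 0 <= T by exact: ltW.
have E0 (h : Omega' -> R) : (0 <= 'E_P'[(fun w => h w ^+ 2)%R])%E.
  by rewrite unlock; apply: integral_ge0 => w _; rewrite lee_fin sqr_ge0.
have Gs0 : (0 <= Gs)%E by exact: E0.
have Fs0 : (0 <= Fs)%E.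
  apply: le_trans (E0 (fun w => f T (X T w) (u T (X T w)))) _.
  by apply: ereal_sup_ubound; exists T => //=; rewrite in_itv /= T0 lexx.
have kE i : kappa P' T lambda f g u X i =
   ((4 * T / (lambda * (i.+1)`!%:R))%:E * Fs + 2%:E * Gs *
    (i`!%:R^-1)%:E)%E.
  by rewrite /kappa inv_Gamma.
have k0 i : (0 <= kappa P' T lambda f g u X i)%E.
  rewrite kE; apply: adde_ge0; apply: mule_ge0 => //.
  - by rewrite lee_fin divr_ge0 ?mulr_ge0// ltW.
  - exact: mule_ge0.
rewrite /error_bound.
set A := (X in (_ <= X%:E + _)%E).
set b := fun i => K ^+ (2 * i) / (N i)%:R * (\prod_(1 <= j < i.+1) (1 + 8 / (N j.-1)%:R))
        * (T ^+ i * expR (lambda * T) / lambda ^+ i).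
have b0 i : 0 <= b i.
  have k2 : 0 <= K ^+ (2 * i) by rewrite exprM exprn_ge0// sqr_ge0.
  rewrite /b -sampling_prodE; apply: mulr_ge0.
    by apply: mulr_ge0; [exact: divr_ge0|exact: sampling_prod_ge0].
  apply: divr_ge0; last exact/exprn_ge0/ltW.
  by apply: mulr_ge0; [exact: exprn_ge0|exact: expR_ge0].
(* The summand of index [0] has positive coefficients in front of both moments,
   so the bound is infinite as soon as one of them is. *)
have infinite : kappa P' T lambda f g u X 0 = +oo%E ->
    (A%:E + \sum_(0 <= i < p) (b i)%:E * kappa P' T lambda f g u X i = +oo)%E.
  move=> koo; rewrite big_ltn// koo gt0_muley; last first.
    have -> : b 0%N = (N 0%N)%:R^-1 * expR (lambda * T).
      by rewrite /b big_geq// ?muln0 !expr0 divr1; ring.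
    by rewrite lte_fin mulr_gt0 ?expR_gt0// invr_gt0 ltr0n hN.
  rewrite addye; last first.
    rewrite gt_eqF// (lt_le_trans ltNy0)//; apply: sume_ge0 => i _.
    by apply: mule_ge0 => //; rewrite lee_fin.
  by rewrite addey.
have [Goo|Gfin] := eqVneq Gs +oo%E.
  rewrite infinite ?leey// kE Goo fact0 invr1 mule1 gt0_muley ?lte_fin//.
  rewrite addey// gt_eqF// (lt_le_trans ltNy0)//; apply: mule_ge0 => //.
  by rewrite lee_fin divr_ge0 ?mulr_ge0// ltW.
have [Foo|Ffin] := eqVneq Fs +oo%E.
  rewrite infinite ?leey// kE Foo gt0_muley; last first.
    by rewrite lte_fin divr_gt0 ?mulr_gt0// fact1.
  rewrite addye// gt_eqF// (lt_le_trans ltNy0)//; apply: mule_ge0 => //.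
  exact: mule_ge0.
have real z : (0 <= z)%E -> z != +oo%E -> exists r : R, z = r%:E.
  by case: z => [r _ _|//|//]; exists r.
have [G GE] := real _ Gs0 Gfin; have [F FE] := real _ Fs0 Ffin.
have G0 : 0 <= G by rewrite -lee_fin -GE.
have F0 : 0 <= F by rewrite -lee_fin -FE.
have hG : flow P' B mu sigma T (g2 g) x = G%:E.
  by rewrite -GE /flow (max_l T0) /Gs unlock.
have hF t : 0 <= t < T -> (flow P' B mu sigma t (src2 T mu sigma u t) x <= F%:E)%E.
  move=> /andP[t0 tT]; rewrite -FE /flow (max_l t0); apply: ereal_sup_ubound.
  exists t; first by rewrite /= in_itv /= t0 ltW.
  rewrite unlock; apply: eq_integral => w _; rewrite /src2 /source t0 (ltW tT) /=.
  by rewrite (PDE_interior hPDE) ?t0.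
have theta0 : 0 < theta by have /andP[] := htheta.
have s0 : 0 <= (0 : R) < T by rewrite lexx.
have main := integrated_error hlambda hg K hu N hB Khat theta F0 hG hF (n := p) (p := p) (leqnn p) s0.
have err := tree_estimator_error hT hlambda hf hg hK hu hPDE hgrowth htau hW htauW hB
  theta0 hHolder hN (n := p) (k := [::]) isT (add0n p) x s0.
have mt : measurable_fun setT (fun w => tree_estimator T lambda mu sigma f g N tau W p [::] 0 x w).
  have mE : measurable_fun setT (fun z : (R * 'cV[R]_d) * node_type tau W [set i | Qupto N p i.1] =>
      tree_estimator T lambda mu sigma f g N tau W p [::] z.1.1 z.1.2 z.2).
    apply: (measurable_tree_estimator lambda mu sigma hf hg hW) => // k' b' [k'N [l k'E /andP[l0 ln]]].
    by exists (size k') => //=; rewrite k'E cats0 l0.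
  have mi := measurable_node_type htau hW (D := [set i | Qupto N p i.1]) (fun i h => h).
  have m1 := measurable_fun_pair (measurable_cst ((0 : R), x)) mi.
  exact: (measurableT_comp mE m1).
(* The restarted estimator clips the clocks at [0], and so it agrees with the
   original one almost surely. *)
have le1 : ('E_P[(fun w => (ubar T lambda x mu sigma f g N
                    (fun k => tau k w) (fun k s => W k s w) p - u 0 x) ^+ 2)%R] <=
   \int[P]_w ((tree_estimator T lambda mu sigma f g N tau W p [::] 0 x w - u 0 x) ^+ 2)%:E)%E.
  rewrite unlock; apply: ae_le_integral.
  - by apply/measurable_EFinP; apply: (measurable_funX 2); exact: measurable_funB.
  - by move=> w; rewrite lee_fin sqr_ge0.
  - by move=> w; rewrite lee_fin sqr_ge0.
  apply: filterS (clocks_nonneg htau) => w tw.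
  have date0 : 0 <= switch_date T (fun k => tau k w) [::] <= T by rewrite /= lexx.
  have E : ubar T lambda x mu sigma f g N (fun k => tau k w) (fun k s => W k s w) p =
      tree_estimator T lambda mu sigma f g N tau W p [::] 0 x w.
    exact: (ubar_recE _ _ _ _ _ _ _ tw _ _ date0).
  by rewrite E.
apply: le_trans le1 _; apply: le_trans err _.
have flow0 (phi : 'cV[R]_d -> \bar R) : measurable_fun setT phi -> (forall y, 0 <= phi y)%E ->
    flow P' B mu sigma 0 phi x = phi x.
  move=> mphi phi0; have m' : measurable_fun setT (fun w => phi (position mu sigma x 0 w)).
    apply: (measurableT_comp mphi).
    exact: (measurable_position mu sigma (measurable_cst x) (measurable_cst (0 : R)) (@measurable_id _ _ setT)).
  rewrite flow_heat (heat0 hB)//.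
  by rewrite /position scale0r mulmx0 !addr0.
have mrec := measurable_error_recursion mu sigma hlambda hg K hu p N hB Khat theta p.
rewrite flow0 in main; last 2 first.
- exact: (@measurable_slice _ _ _ _ _ _ (error_recursion T lambda mu sigma g u K p N P' B Khat theta p) 0 mrec).
- by move=> y; exact: error_recursion_ge0.
apply: le_trans main _; rewrite subr0 subnn.
have := error_poly_le N K Khat theta hT hlambda G0 F0 hp.
rewrite -lee_fin => /le_trans; apply.
rewrite EFinD -sumEFin leeD2l//; apply: lee_sum => i _.
have -> : kappa P' T lambda f g u X i =
    (4 * T / (lambda * (i.+1)`!%:R) * F + 2 * G * i`!%:R^-1)%:E by rewrite kE GE FE.
by rewrite inv_Gamma [leLHS]EFinM.
Qed.
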